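(* Let $K$ be a number field of degree $d$ over $\mathbb{Q}$ with discriminant $\mathcal{D}_K$. Let $N \geq 2$ be an integer, $l = \left[ \frac{N}{2} \right]$ (integer part), and let $W$ be a subspace of $K^N$ of dimension $w$, $1 \leq w \leq N$. Let $1 \leq s < w$ be an integer, and let $V_1,\dots,V_M$ be nonzero subspaces of $K^N$ with $\max_{1 \leq i \leq M} \{ \dim_K(V_i) \} \leq s$. Then there exists a point $\boldsymbol{x} \in W \setminus \bigcup_{i=1}^M V_i$ such that $$H(\boldsymbol{x}) \leq \mathcal{C}_{K,N}(w,s)\, \mathcal{H}(W)^d \left\{ \left( \sum_{i=1}^M \frac{1}{\mathcal{H}(V_i)^d} \right)^{\frac{1}{(w-s)d}} + M^{\frac{1}{(w-s)d+1}} \right\},$$ where $$\mathcal{C}_{K,N}(w,s) = 2^{w(d+3)} |\mathcal{D}_K|^{\frac{w}{2}} \left( (wd)^w \binom{Nd}{ld}^{\frac{1}{2d}} \right)^{\frac{1}{w-s}}.$$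
   Context: Heights. Let $M(K)$ be the set of places of $K$; for $v \in M(K)$ let $K_v$ be the completion and $d_v = [K_v:\mathbb{Q}_v]$ the local degree. Let $\|\cdot\|_v$ be the unique absolute value on $K_v$ extending the usual absolute value on $\mathbb{R}$ or $\mathbb{C}$ (if $v \mid \infty$) or the usual $p$-adic absolute value on $\mathbb{Q}_p$ (if $v \mid p$), and set $|a|_v = \|a\|_v^{d_v/d}$. For $\boldsymbol{x} \in K_v^N$ put $H_v(\boldsymbol{x}) = \max_{1\le i\le N} |x_i|_v$, and for $v \mid \infty$ put $\mathcal{H}_v(\boldsymbol{x}) = \left(\sum_{i=1}^N \|x_i\|_v^2\right)^{d_v/(2d)}$. For $\boldsymbol{x} \in K^N$ define $H(\boldsymbol{x}) = \prod_{v \in M(K)} H_v(\boldsymbol{x})$ and $\mathcal{H}(\boldsymbol{x}) = \prod_{v \nmid \infty} H_v(\boldsymbol{x}) \prod_{v \mid \infty} \mathcal{H}_v(\boldsymbol{x})$. For a subspace $V \subseteq K^N$ of dimension $J \geq 1$, choose a basis and let $X$ be the $N \times J$ basis matrix; let $Gr(X) \in K^{\binom{N}{J}}$ be the vector of all $J \times J$ minors of $X$ (Grassmann coordinates). The height of $V$ is $\mathcal{H}(V) = \mathcal{H}(Gr(X))$, which is independent of the choice of basis. *)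

(* Defs.v *)
From HB Require Import structures.
From mathcomp Require Import all_boot all_order all_algebra all_field.
From mathcomp Require Import all_classical all_reals all_analysis.

Set Implicit Arguments.
Unset Strict Implicit.
Unset Printing Implicit Defensive.

Import Order.TTheory GRing.Theory Num.Theory.
Import numFieldNormedType.Exports.

Local Open Scope classical_set_scope.
Local Open Scope ring_scope.

(* A number field is a finite extension [K : fieldExtType rat]; its degree
   over the rationals is [\dim {:K}]. *)

Section Discriminant.

Variable K : fieldExtType rat.

Definition algebraic_integer (x : K) : Prop :=
  integralOver (fun z : int => z%:~R : K) x.

(* trace of the Q-linear map y |-> x * y *)
Definition field_trace (x : K) : rat :=
  \sum_(i < \dim {:K}) coord (vbasis {:K}) i (x * (vbasis {:K})`_i).

Definition integral_basis (b : (\dim {:K}).-tuple K) : Prop :=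
  basis_of {:K} b /\ forall x : K, algebraic_integer x <-> inIntSpan b x.

(* The value does not depend on the integral basis; the default 0 is never
   taken, since integral bases exist. *)
Definition discriminant : rat :=
  xget 0 [set D | exists2 b, integral_basis b &
                  D = \det (\matrix_(i < \dim {:K}, j < \dim {:K})
                            field_trace (b`_i * b`_j))].

End Discriminant.

Definition padic_abs (p : nat) (q : rat) : rat :=
  if q == 0 then 0
  else p%:R ^ ((logn p `|denq q|)%:Z - (logn p `|numq q|)%:Z).

Section Places.

Variables (R : realType) (K : fieldExtType rat).

Record absolute_value (v : K -> R) : Prop := AbsoluteValue {
  absval_ge0 : forall x, 0 <= v x;
  absval_eq0 : forall x, v x = 0 <-> x = 0;
  absvalM : forall x y, v (x * y) = v x * v y;
  absvalD : forall x y, v (x + y) <= v x + v y }.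

(* A place is represented by the absolute value || ||_v that it contains and
   that extends the usual absolute value or a usual p-adic one on Q. *)
Definition infinite_places : set (K -> R) :=
  [set v | absolute_value v /\ forall q : rat, v q%:A = ratr `|q|].

Definition finite_places : set (K -> R) :=
  [set v | absolute_value v /\ exists2 p : nat, prime p &
           forall q : rat, v q%:A = ratr (padic_abs p q)].

Definition places : set (K -> R) := infinite_places `|` finite_places.

Definition absval_cauchy (v : K -> R) (u : nat -> K) : Prop :=
  forall e : R, 0 < e -> exists n0 : nat,
    forall m n : nat, (n0 <= m)%N -> (n0 <= n)%N -> v (u m - u n) < e.

Definition absval_null (v : K -> R) (u : nat -> K) : Prop :=
  v (u n) @[n --> \oo] --> (0 : R).

Definition rat_cauchy (v : K -> R) (a : nat -> rat) : Prop :=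
  absval_cauchy v (fun n => (a n)%:A).

(* K_v is the ring of v-Cauchy sequences of K modulo v-null sequences, and Q_v
   its subfield of classes of sequences of rationals; the classes of
   e_0, ..., e_(n-1) are required to form a basis of K_v over Q_v. *)
Definition completion_basis (v : K -> R) (n : nat) (e : 'I_n -> nat -> K) :
    Prop :=
  [/\ forall i, absval_cauchy v (e i),
      forall u : nat -> K, absval_cauchy v u ->
        exists2 a : 'I_n -> nat -> rat, forall i, rat_cauchy v (a i) &
          absval_null v (fun m => u m - \sum_(i < n) a i m *: e i m)
    & forall a : 'I_n -> nat -> rat, (forall i, rat_cauchy v (a i)) ->
        absval_null v (fun m => \sum_(i < n) a i m *: e i m) ->
        forall i, absval_null v (fun m => (a i m)%:A)].

(* d_v = [K_v : Q_v] *)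
Definition local_degree (v : K -> R) : nat :=
  xget 0%N [set n | exists e : 'I_n -> nat -> K, completion_basis v e].

(* | |_v, as opposed to || ||_v *)
Definition normalized_abs (v : K -> R) (a : K) : R :=
  v a `^ ((local_degree v)%:R / (\dim {:K})%:R).

End Places.

Arguments infinite_places R K : clear implicits.
Arguments finite_places R K : clear implicits.
Arguments places R K : clear implicits.

Section Heights.

Variables (R : realType) (K : fieldExtType rat).

Definition local_height N (v : K -> R) (x : 'rV[K]_N) : R :=
  \big[Num.max/0]_(i < N) normalized_abs v (x 0 i).

Definition local_height2 N (v : K -> R) (x : 'rV[K]_N) : R :=
  (\sum_(i < N) v (x 0 i) ^+ 2)
    `^ ((local_degree v)%:R / (2 * (\dim {:K})%:R)).

(* [\big[_/_]_(v \in A)] is the product over the v in A with a factor different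
   from 1 (there are finitely many of them when x != 0), and 1 if they are
   infinitely many; the latter happens at x = 0, where every factor is 0. *)
Definition height N (x : 'rV[K]_N) : R :=
  if x == 0 then 0
  else \big[*%R/1]_(v \in places R K) local_height v x.

Definition height2 N (x : 'rV[K]_N) : R :=
  if x == 0 then 0
  else (\big[*%R/1]_(v \in finite_places R K) local_height v x)
       * (\big[*%R/1]_(v \in infinite_places R K) local_height2 v x).

End Heights.

Section Grassmann.

Variable K : fieldType.

(* the J x J minors of X, indexed by the increasing J-tuples of rows *)
Definition grassmann N J (X : 'M[K]_(N, J)) : 'rV[K]_('C(N, J)) :=
  \row_k \det (rowsub
    (tnth (enum_val (cast_ord (esym (card_ltn_sorted_tuples J N)) k))) X).

Definition basis_matrix N (V : {vspace 'rV[K]_N}) : 'M[K]_(N, \dim V) :=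
  \matrix_(i, j) (vbasis V)`_j 0 i.

End Grassmann.

Definition subspace_height (R : realType) (K : fieldExtType rat) N
    (V : {vspace 'rV[K]_N}) : R :=
  height2 R (grassmann (basis_matrix V)).

Definition siegel_const (R : realType) (K : fieldExtType rat) (N w s : nat) :
    R :=
  let d := \dim {:K} in
  let l := (N %/ 2)%N in
  2 ^+ (w * (d + 3)) * (ratr `|discriminant K|) `^ (w%:R / 2)
  * ((w * d)%:R ^+ w * 'C(N * d, l * d)%:R `^ (1 / (2 * d%:R)))
      `^ (1 / (w - s)%:R).

(* Main.v *)
(* Let O be the ring of integers of K and H the height of subspaces. The points of
   W with coordinates in O, whose conjugates are all bounded by B, are the points of
   a lattice of rank wd in a ball-like region, so they number at least a constant
   times B^(wd) / H(W)^d. The same points in V_i number at most a constant times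
   B^(sd) / H(V_i)^d, plus (2B+1)^(sd-1) to account for the case where they do not
   span V_i over Q. When B is the right-hand side of the theorem, the points of the
   V_i cannot exhaust those of W, and an integral point with conjugates bounded by B
   has height at most B.

   The determinant of the lattice is controlled by the identity det Gram = |tau| A,
   where tau is a rational number, the trace discriminant of the coordinates of a
   Z-basis with respect to a basis X of the subspace, and A is the archimedean part of
   the height of Gr(X). At each prime p, |tau|_p is compared with the p-part of the
   height of Gr(X), using a maximal minor of X at every place above p; by the product
   formula this bounds |tau| from both sides. The places above p and their
   local degrees are read off the embeddings of K into a splitting field over Q_p
   with an extension of the p-adic absolute value. *)

(* The integral points of a subspace V need not be free over O, so no basis X of V need generate
   them. X is therefore arbitrary, a matrix C records a Z-basis in the coordinates given by X, and a
   different maximal minor of X may be inverted at each place. Two inequalities result: |tau| A lies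
   between H(V)^(2d), used for the V_i, and |D_K|^(dim V) H(V)^(2d), used for W.

   [local_degree] speaks of Cauchy sequences modulo null sequences, and heights carry real exponents
   d_v/d. The degree is computed as the rank of an idempotent of K tensor Q_v, and heights are
   raised to the power d or 2d, where they become products over embeddings.

   No volume enters: lattice points are counted by pigeonhole modulo an integral approximation of
   the lattice, in a cube inscribed in the ball. The cube costs (wd)^(wd/2); the rest of the factor
   (wd)^w pays for trading (Nd)^(sd) for the binomial coefficient. The degenerate count has one
   factor B less than the main one, whence the two exponents 1/((w-s)d) and 1/((w-s)d+1). *)
From HB Require Import structures.
Require Import Defs.
From mathcomp Require Import all_boot all_order all_algebra all_field.
From mathcomp Require Import all_classical all_reals all_analysis.
From mathcomp Require Import complex perm ring lra zify.

Set Implicit Arguments.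
Unset Strict Implicit.
Unset Printing Implicit Defensive.

Import Order.TTheory GRing.Theory Num.Theory.
Import Normc.
Import numFieldNormedType.Exports.
Local Open Scope classical_set_scope.
Local Open Scope ring_scope.

(** * Absolute values and weak approximation *)

Section AbsoluteValues.

Variables (R : realType) (F : fieldType).

(** The axioms of [absolute_value] for an arbitrary field: they serve for completions and splitting
    fields as well as for K. *)
Record is_absval (v : F -> R) : Prop := IsAbsval {
  av_ge0 : forall x, 0 <= v x;
  av_eq0P : forall x, v x = 0 <-> x = 0;
  avM : forall x y, v (x * y) = v x * v y;
  av_leD : forall x y, v (x + y) <= v x + v y }.

Definition ultrametric (v : F -> R) :=
  forall x y, v (x + y) <= Num.max (v x) (v y).

Variable v : F -> R.
Hypothesis vP : is_absval v.

Lemma av0 : v 0 = 0. Proof. exact/(av_eq0P vP). Qed.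

Lemma av_eq0 x : (v x == 0) = (x == 0).
Proof. by apply/eqP/eqP => /(av_eq0P vP). Qed.

Lemma av_gt0 x : (0 < v x) = (x != 0).
Proof. by rewrite lt_def av_ge0 // andbT av_eq0. Qed.

Lemma av1 : v 1 = 1.
Proof.
have n0 : v 1 != 0 by rewrite av_eq0 oner_eq0.
by apply: (mulfI n0); rewrite -(avM vP) !mulr1.
Qed.

Lemma avN x : v (- x) = v x.
Proof.
rewrite -mulN1r avM //.
have h : v (-1) ^+ 2 == 1 ^+ 2 by rewrite expr2 -avM // mulrNN mulr1 av1 expr1n.
have := h; rewrite eqrXn2 ?av_ge0 // => /eqP ->; exact: mul1r.
Qed.

Lemma avB x y : v (x - y) = v (y - x). Proof. by rewrite -avN opprB. Qed.

Lemma avX x n : v (x ^+ n) = v x ^+ n.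
Proof. by elim: n => [|n ih]; rewrite ?expr0 ?av1 // !exprS avM // ih. Qed.

Lemma avV x : v x^-1 = (v x)^-1.
Proof.
have [->|x0] := eqVneq x 0; first by rewrite invr0 av0 invr0.
have n0 : v x != 0 by rewrite av_eq0.
by apply: (mulfI n0); rewrite -avM // !mulfV // av1.
Qed.

Lemma av_leB x y : v (x - y) <= v x + v y.
Proof. by rewrite (le_trans (av_leD vP _ _)) // avN. Qed.

Lemma av_sub x y : v x - v y <= v (x - y).
Proof. by rewrite lerBlDr -{1}(subrK y x) av_leD. Qed.

Lemma av_sum I (r : seq I) (P : pred I) (f : I -> F) :
  v (\sum_(i <- r | P i) f i) <= \sum_(i <- r | P i) v (f i).
Proof.
elim/big_rec2: _ => [|i y x _ h]; first by rewrite av0.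
by rewrite (le_trans (av_leD vP _ _)) // lerD2l.
Qed.

Lemma av_prod I (r : seq I) (P : pred I) (f : I -> F) :
  v (\prod_(i <- r | P i) f i) = \prod_(i <- r | P i) v (f i).
Proof. by elim/big_rec2: _ => [|i y x _ <-]; rewrite ?av1 // avM. Qed.

Lemma av_sign n : v ((-1) ^+ n) = 1.
Proof. by rewrite avX avN av1 expr1n. Qed.

End AbsoluteValues.

Section RealPowers.

Variable R : realType.
Implicit Types a b c e : R.

Lemma near_expr_lt c e : 0 <= c -> c < 1 -> 0 < e -> \forall n \near \oo, c ^+ n < e.
Proof.
move=> c0 c1 e0.
have c1' : `|c| < 1 by rewrite ger0_norm.
have /cvgrPdist_lt /(_ e e0) := cvg_expr c1'.
apply: filterS => n; rewrite sub0r normrN normrX ger0_norm //.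
Qed.

Lemma near_expr_gt c e : 1 < c -> \forall n \near \oo, e < c ^+ n.
Proof.
move=> c1; have c0 : 0 < c by rewrite (lt_trans _ c1).
have [e0|e0] := lerP e 0.
  by near=> n; rewrite (le_lt_trans e0) // exprn_gt0.
have := @near_expr_lt c^-1 e^-1; rewrite invr_ge0 ltW // invf_lt1 // c1 invr_gt0 e0.
move=> /(_ isT isT isT); apply: filterS => n.
by rewrite exprVn ltf_pV2 // posrE exprn_gt0.
Unshelve. all: by end_near.
Qed.

(** Otherwise (a/b)^n is unbounded. Passing to powers thus removes a constant from an inequality
    between multiplicative quantities. *)
Lemma pow_le_trick a b c : 0 <= a -> 0 <= b ->
  (forall n, a ^+ n <= c * b ^+ n) -> a <= b.
Proof.
move=> a0 b0 h; rewrite leNgt; apply/negP => ba.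
have [be|bn] := eqVneq b 0.
  by have := h 1; rewrite be expr0n mulr0 expr1 leNgt -be ba.
have bp : 0 < b by rewrite lt_def bn.
have : 1 < a / b by rewrite ltr_pdivlMr // mul1r.
move/(@near_expr_gt _ c) => [n _ /(_ n (leqnn _)) /=].
rewrite expr_div_n ltr_pdivlMr ?exprn_gt0 // => /lt_geF.
by rewrite h.
Qed.

End RealPowers.

Section Independence.

Variables (R : realType) (F : fieldType).
Implicit Types (v w : F -> R) (z : F).

(** Tends to 1 for absolute values with |z| > 1 and to 0 for those with |z| < 1. *)
Let squash z n : F := z ^+ n / (1 + z ^+ n).

Lemma squash_gt1 v z e : is_absval v -> 1 < v z -> 0 < e ->
  \forall n \near \oo, v (squash z n - 1) < e.
Proof.
move=> vP z1 e0.
have := near_expr_gt (e^-1 + 1) z1.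
apply: filterS => n h.
have hd : e^-1 < v (1 + z ^+ n).
  have := av_sub vP (z ^+ n) (- 1); rewrite opprK (avN vP) (av1 vP) (avX vP) [_ ^+ n + 1]addrC.
  by apply: lt_le_trans; rewrite ltrBrDr.
have hp : 0 < v (1 + z ^+ n) by rewrite (lt_trans _ hd) // invr_gt0.
have n0 : 1 + z ^+ n != 0 by rewrite -(av_gt0 vP).
have -> : squash z n - 1 = - (1 + z ^+ n)^-1.
  by rewrite /squash; field.
by rewrite avN // avV // -[e]invrK ltf_pV2 // posrE invr_gt0.
Qed.

Lemma squash_lt1 v z e : is_absval v -> v z < 1 -> 0 < e ->
  \forall n \near \oo, v (squash z n) < e.
Proof.
move=> vP z1 e0.
have := @near_expr_lt R (v z) (e / (1 + e)) (av_ge0 vP _) z1.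
rewrite divr_gt0 ?addr_gt0 // => /(_ isT).
apply: filterS => n h.
have h1 : v z ^+ n < e - e * v z ^+ n.
  have e1 : 0 < 1 + e by lra.
  by move: h; rewrite ltr_pdivlMr // mulrDr mulr1 mulrC; lra.
have hd : 1 - v z ^+ n <= v (1 + z ^+ n).
  by have := av_sub vP 1 (- z ^+ n); rewrite opprK avN // av1 // avX.
have zn0 : 0 <= v z ^+ n by rewrite exprn_ge0 // av_ge0.
have hp : 0 < v (1 + z ^+ n).
  apply: lt_le_trans hd.
  by rewrite -(pmulr_rgt0 _ e0) mulrBr mulr1 (le_lt_trans zn0).
rewrite /squash avM // avV // avX // ltr_pdivrMr //.
by rewrite (lt_le_trans h1) // -{1}[e]mulr1 -mulrBr ler_pM2l.
Qed.

Section Step.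

Variables (S : set (F -> R)).
Hypothesis SP : forall v, S v -> is_absval v.
Variables (q0 : F) (u0 : R).
Hypothesis u01 : 0 < u0 < 1.
Hypothesis Su0 : forall v, S v -> v q0 = u0.

(** Distinct members of S are inequivalent because they agree at [q0], with a value strictly between
    0 and 1. Once v x < w x, some power of [q0] has a value strictly between those of a power of
    x. *)
Lemma absval_separate v w : S v -> S w -> v <> w ->
  exists z, 1 < v z /\ w z < 1.
Proof.
move=> Sv Sw vw.
have vP := SP Sv; have wP := SP Sw.
have [u00 u0lt1] := andP u01.
have q00 : q0 != 0 by rewrite -(av_gt0 vP) Su0.
suff H : exists x, x != 0 /\ v x < w x.
  have [x [x0 xlt]] := H.
  have vx : 0 < v x by rewrite av_gt0.
  have wx : 0 < w x by rewrite av_gt0.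
  have l0 : ln u0 < 0 by rewrite ln_lt0 // u00.
  pose dl := ln (w x) - ln (v x).
  have dl0 : 0 < dl by rewrite subr_gt0 ltr_ln // posrE.
  (* The interval from b ln (v x) to b ln (w x) is now longer than -ln u0, so it contains a multiple
     a ln u0 in its interior; the witness is q0^a / x^b. *)
  pose b := (Num.trunc (- ln u0 / dl)).+1.
  have bP : - ln u0 < b%:R * dl.
    by rewrite -ltr_pdivrMr // /b truncnS_gt.
  pose a := Num.floor (b%:R * ln (w x) / ln u0) + 1.
  have a1 : a%:~R * ln u0 < b%:R * ln (w x).
    by rewrite -ltr_ndivrMr // /a -floor_lt_int ltzD1.
  have a2 : b%:R * ln (v x) < a%:~R * ln u0.
    have h : (a - 1)%:~R <= b%:R * ln (w x) / ln u0 by rewrite /a addrK floor_le.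
    have h2 : b%:R * ln (w x) <= (a - 1)%:~R * ln u0 by rewrite -ler_ndivlMr.
    move: h2; rewrite rmorphB /= mulrBl mul1r => h2.
    by move: bP; rewrite /dl mulrBr; lra.
  have av_exprz y (n : int) : is_absval y -> y (q0 ^ n) = (y q0) ^ n.
    by move=> yP; case: n => n; rewrite /exprz /= ?avV // avX.
  have lnz (n : int) : ln (u0 ^ n) = n%:~R * ln u0.
    case: n => n; first by rewrite /= -exprnP lnXn // -mulr_natl.
    by rewrite NegzE -exprnN lnV ?posrE ?exprn_gt0 // lnXn // rmorphN mulNr /= mulr_natl.
  exists (q0 ^ a / x ^+ b).
  rewrite (avM vP) (avV vP) (avX vP) (avM wP) (avV wP) (avX wP) !av_exprz // !Su0 //.
  have up : 0 < u0 ^ a by rewrite exprz_gt0.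
  split.
    rewrite ltr_pdivlMr ?exprn_gt0 // mul1r -ltr_ln ?posrE ?exprn_gt0 //.
    by rewrite lnz lnXn // -mulr_natl.
  rewrite ltr_pdivrMr ?exprn_gt0 // mul1r -ltr_ln ?posrE ?exprn_gt0 //.
  by rewrite lnz lnXn // -mulr_natl.
have [x hx] : exists x, v x != w x.
  apply: contrapT => /forallNP h; apply: vw; apply: funext => x.
  by apply/eqP/negPn/negP; exact: h.
have x0 : x != 0 by apply: contraNneq hx => ->; rewrite !av0.
case: (ltgtP (v x) (w x)) hx => // h _; first by exists x.
by exists x^-1; rewrite invr_eq0 !avV // ltf_pV2 // posrE av_gt0.
Qed.

Lemma near_all_seq (T : eqType) (s : seq T) (P : T -> nat -> Prop) :
  (forall t, t \in s -> \forall n \near \oo, P t n) ->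
  \forall n \near \oo, forall t, t \in s -> P t n.
Proof.
elim: s => [_|t s ih h]; first by near=> n.
have h1 : \forall n \near \oo, P t n by apply: h; rewrite mem_head.
have h2 : \forall n \near \oo, forall t, t \in s -> P t n.
  by apply: ih => t' t's; apply: h; rewrite inE t's orbT.
by near=> n => t'; rewrite inE => /orP[/eqP->|]; [near: n|move: t'; near: n].
Unshelve. all: by end_near.
Qed.

(** Artin-Whaples induction: z works for the tail, y separates v from w. If w z <= 1, a high power
    of z is multiplied by y; if w z > 1, the power is replaced by z^n/(1+z^n), which tends to 1 at
    both v and w. *)
Lemma absval_independence v (ws : seq (F -> R)) : S v ->
  (forall w, w \in ws -> S w /\ v <> w) ->
  exists z, 1 < v z /\ forall w, w \in ws -> w z < 1.
Proof.
move=> Sv; have vP := SP Sv; elim: ws => [_|w ws ih H].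
  have [u00 u0lt1] := andP u01.
  exists q0^-1; split=> //.
  by rewrite avV // Su0 // invf_gt1.
have [w' w'ws|z [vz wsz]] := ih; first by apply: H; rewrite inE w'ws orbT.
have [Sw vw] := H w (mem_head _ _).
have wP := SP Sw.
have wsP w' : w' \in ws -> is_absval w'.
  by move=> w'ws; apply: SP; apply: (H w' _).1; rewrite inE w'ws orbT.
have [y [vy wy]] := absval_separate Sv Sw vw.
have [wz|wz] := lerP (w z) 1.
  have [n _ /(_ n (leqnn _)) /= hn] : \forall n \near \oo,
      forall w', w' \in ws -> w' z ^+ n < (1 + w' y)^-1.
    apply: near_all_seq => w' w'ws; apply: near_expr_lt.
    - exact: av_ge0 (wsP _ _) _.
    - exact: wsz.
    - by rewrite invr_gt0 ltr_pwDl // av_ge0 //; exact: wsP.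
  exists (z ^+ n * y); split.
    rewrite avM // avX // (lt_le_trans vy) // ler_peMl ?av_ge0 //.
    by rewrite exprn_ege1 // ltW.
  move=> w'; rewrite inE => /orP[/eqP->|w'ws].
    rewrite avM // avX // (le_lt_trans _ wy) // ler_piMl ?av_ge0 //.
    by rewrite exprn_ile1 // av_ge0.
  have w'P := wsP _ w'ws; have := hn w' w'ws.
  have p : 0 <= w' y by rewrite av_ge0.
  rewrite avM // avX // -[_^-1]mul1r ltr_pdivlMr ?ltr_pwDl //.
  have : 0 <= w' z ^+ n by rewrite exprn_ge0 // av_ge0.
  by nra.
have wy0 : 0 <= w y by rewrite av_ge0.
have wy1 : 0 < w y + 1 by lra.
(* The first bound keeps v (squash z n) * v y above 1, since 1 - e >= 1 / v y; the second keeps (1 +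
   e) * w y below 1, since w y < 1. *)
pose e := Num.min (1 - (v y)^-1) ((w y + 1)^-1 - 2^-1).
have e0 : 0 < e.
  rewrite lt_min !subr_gt0 invf_lt1 ?vy ?(lt_trans _ vy) //=.
  by rewrite ltf_pV2 ?posrE //; lra.
have [n _ /(_ n (leqnn _)) /= hn] : \forall n \near \oo,
    [/\ v (squash z n - 1) < e, w (squash z n - 1) < e &
     forall w', w' \in ws -> w' (squash z n) < (1 + w' y)^-1].
  near=> n; split; near: n.
  - exact: squash_gt1.
  - exact: squash_gt1.
  - apply: near_all_seq => w' w'ws; apply: squash_lt1; [exact: wsP|exact: wsz|].
    by rewrite invr_gt0 ltr_pwDl // av_ge0 //; exact: wsP.
have [h1 h2 h3] := hn.
exists (squash z n * y); split.
  have : 1 - e < v (squash z n).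
    have := av_sub vP 1 (1 - squash z n); rewrite subKr (av1 vP) (avB vP 1).
    by lra.
  rewrite avM // => h.
  have e1 : e <= 1 - (v y)^-1 by rewrite ge_min lexx.
  have : (v y)^-1 < v (squash z n) by lra.
  have vy0 : 0 < v y by rewrite (lt_trans _ vy).
  by rewrite -[_^-1]mul1r ltr_pdivrMr.
move=> w'; rewrite inE => /orP[/eqP->|w'ws].
  have : w (squash z n) < 1 + e.
    have := av_leD wP 1 (squash z n - 1); rewrite addrC subrK (av1 wP); lra.
  rewrite avM // => h.
  have e1 : e <= (w y + 1)^-1 - 2^-1 by rewrite ge_min lexx orbT.
  have h' : w (squash z n) < (w y + 1)^-1 + 2^-1 by lra.
  have : w (squash z n) * (w y + 1) < 1 + (w y + 1) / 2.
    have <- : ((w y + 1)^-1 + 2^-1) * (w y + 1) = 1 + (w y + 1) / 2.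
      by field; rewrite lt0r_neq0.
    by rewrite ltr_pM2r.
  by have := av_ge0 wP (squash z n); nra.
have w'P := wsP _ w'ws; have := h3 w' w'ws.
have p : 0 <= w' y by rewrite av_ge0.
rewrite avM // -[_^-1]mul1r ltr_pdivlMr ?ltr_pwDl //.
have : 0 <= w' (squash z n) by rewrite av_ge0.
by nra.
Unshelve. all: by end_near.
Qed.

Lemma absval_approx1 v (ws : seq (F -> R)) e : S v -> 0 < e ->
  (forall w, w \in ws -> S w /\ v <> w) ->
  exists z, v (z - 1) < e /\ forall w, w \in ws -> w z < e.
Proof.
move=> Sv e0 H; have [z [vz wz]] := absval_independence Sv H.
have [n _ /(_ n (leqnn _)) /= hn] : \forall n \near \oo,
    v (squash z n - 1) < e /\ forall w', w' \in ws -> w' (squash z n) < e.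
  near=> n; split; near: n; first exact: squash_gt1 (SP Sv) _ _.
  apply: near_all_seq => w' w'ws; apply: squash_lt1; [|exact: wz|exact: e0].
  exact: SP (H w' w'ws).1.
by exists (squash z n).
Unshelve. all: by end_near.
Qed.

(** Each target t w is multiplied by an element close to 1 at w and close to 0 at the other members
    of the list, and the products are added. *)
Lemma weak_approximation (ws : seq (F -> R)) (t : (F -> R) -> F) e : 0 < e ->
  (forall w, w \in ws -> S w) -> uniq ws ->
  exists z, forall w, w \in ws -> w (z - t w) < e.
Proof.
move=> e0 wsS uws.
pose C := \sum_(w <- ws) \sum_(w' <- ws) w' (t w).
have C0 : 0 <= C.
  by apply: sumr_ge0 => w _; rewrite big_seq_cond; apply: sumr_ge0 => w' /andP[/wsS/SP h _]; exact: av_ge0.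
have e1 : 0 < e / (1 + C) by rewrite divr_gt0 // ltr_pwDl.
have ex w : exists z, w \in ws -> w (z - 1) < e / (1 + C) /\
    forall w', w' \in ws -> w' != w -> w' z < e / (1 + C).
  have [wws|wn] := boolP (w \in ws); last by exists 0.
  have [|z [h1 h2]] := @absval_approx1 w (rem w ws) _ (wsS _ wws) e1.
    move=> w'; rewrite (mem_rem_uniq _ uws) !inE => /andP[w'w w'ws].
    by split; [exact: wsS|apply/eqP; rewrite eq_sym].
  exists z => _; split=> // w' w'ws w'w.
  by apply: h2; rewrite (mem_rem_uniq _ uws) !inE w'w.
have [f fP] := choice ex.
exists (\sum_(w <- ws) f w * t w) => w wws.
have wP := SP (wsS _ wws).
rewrite (bigD1_seq w) //= addrAC -{2}[t w]mul1r -mulrBl.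
apply: le_lt_trans (_ : e / (1 + C) * \sum_(w' <- ws) w (t w') < _).
  rewrite (le_trans (av_leD wP _ _)) // [X in _ <= _ * X](bigD1_seq w) //= mulrDr.
  apply: lerD.
    by rewrite avM // ler_wpM2r ?av_ge0 // ltW // (fP w wws).1.
  rewrite (le_trans (av_sum wP _ _ _)) // mulr_sumr.
  rewrite big_seq_cond [leRHS]big_seq_cond; apply: ler_sum => w' /andP[w'ws w'w].
  by rewrite avM // ler_wpM2r ?av_ge0 // ltW // (fP w' w'ws).2 // eq_sym.
have h : \sum_(w' <- ws) w (t w') <= C.
  rewrite /C exchange_big /= [leRHS](bigD1_seq w) //= lerDl.
  rewrite big_seq_cond; apply: sumr_ge0 => w' /andP[/wsS/SP w'P _].
  by apply: sumr_ge0 => ? _; exact: av_ge0.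
rewrite mulrAC ltr_pdivrMr ?ltr_pwDl // ltr_pM2l //; lra.
Qed.

End Step.

End Independence.

(** * Coordinates and embeddings of a number field *)

Section Coordinates.

Variables (F0 : fieldType) (K : fieldExtType F0).
Let d := \dim {:K}.
Let b := vbasis {:K}.

Definition crd (x : K) : 'rV[F0]_d := \row_l coord b l x.

Lemma crd_sum x : x = \sum_l crd x 0 l *: b`_l.
Proof. by rewrite [LHS](coord_vbasis (memvf x)); apply: eq_bigr => l _; rewrite mxE. Qed.

Lemma crd_lin (r : 'rV[F0]_d) : crd (\sum_l r 0 l *: b`_l) = r.
Proof.
apply/rowP => l; rewrite mxE coord_sum_free //.
exact: basis_free (vbasisP _).
Qed.

Lemma crd0 : crd 0 = 0. Proof. by apply/rowP => l; rewrite !mxE raddf0. Qed.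
Lemma crdD x y : crd (x + y) = crd x + crd y.
Proof. by apply/rowP => l; rewrite !mxE raddfD. Qed.
Lemma crdB x y : crd (x - y) = crd x - crd y.
Proof. by apply/rowP => l; rewrite !mxE raddfB. Qed.
Lemma crdZ q x : crd (q *: x) = q *: crd x.
Proof. by apply/rowP => l; rewrite !mxE linearZ. Qed.
Lemma crd_bigsum I r (P : pred I) (f : I -> K) :
  crd (\sum_(i <- r | P i) f i) = \sum_(i <- r | P i) crd (f i).
Proof. exact: (big_morph _ crdD crd0). Qed.

Lemma crd_inj : injective crd.
Proof. by move=> x y xy; rewrite (crd_sum x) (crd_sum y) xy. Qed.

Definition mulmat (x : K) : 'M[F0]_d := \matrix_l crd (b`_l * x).

Lemma crdM y x : crd (y * x) = crd y *m mulmat x.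
Proof.
rewrite {1}(crd_sum y) mulr_suml crd_bigsum; apply/rowP => m.
rewrite summxE !mxE; apply: eq_bigr => l _.
by rewrite -scalerAl crdZ !mxE.
Qed.

End Coordinates.

Section Embeddings.

Lemma rmorphism_of (A B : nzRingType) (f : A -> B) :
  {morph f : x y / x - y} -> f 1 = 1 -> {morph f : x y / x * y} ->
  exists g : {rmorphism A -> B}, g =1 f.
Proof.
move=> fB f1 fM.
pose g : {rmorphism A -> B} := HB.pack f
  (GRing.isZmodMorphism.Build _ _ f fB) (GRing.isMonoidMorphism.Build _ _ f (f1, fM)).
by exists g.
Qed.

Lemma rat_rmorphism_eq (L : fieldType) (f g : {rmorphism rat -> L}) : f =1 g.
Proof.
move=> q; rewrite -(divq_num_den q).
by rewrite !(rmorphM, fmorphV) /= !rmorph_int.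
Qed.

Variable K : fieldExtType rat.
Let d := \dim {:K}.
Let b := vbasis {:K}.

Lemma pchar_numfield : [pchar K] =i pred0.
Proof. by move=> p; rewrite pchar_lalg pchar_num. Qed.

(** f is the minimal polynomial of a primitive element; it is fixed before L so that it can be split
    over the complex numbers and over an extension of Q_p alike. Its roots give the embeddings, and
    the matrix of the sigma k b_l is invertible because the Vandermonde matrix of the roots factors
    through it. *)
Lemma embeddings_exist : exists2 f : {poly rat}, f != 0 &
  forall (L : fieldType) (i : {rmorphism rat -> L}) (rs : seq L),
    map_poly i f %= \prod_(z <- rs) ('X - z%:P) ->
    exists sigma : 'I_d -> {rmorphism K -> L},
      (\matrix_(l, k) sigma k (b`_l)) \in unitmx.
Proof.
have sepK : separable 1 {:K}.
  by apply/separableP => y _; apply: pcharf0_separable; exact: pchar_numfield.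
pose t := separable_generator 1 {:K}.
have tK : <<1; t>>%VS = {:K}%VS.
  by rewrite -(eq_adjoin_separable_generator sepK) // sub1v.
have sept : separable_poly (minPoly 1 t).
  by have /separableP/(_ t (memvf t)) := sepK.
have /polyOver1P[f fE] := minPolyOver 1%AS t.
have sf : size f = d.+1.
  rewrite -(size_map_poly (in_alg K)) -fE size_minPoly; congr _.+1.
  by have := dim_Fadjoin 1%AS t; rewrite tK dimv1 muln1.
have f0 : f != 0 by rewrite -size_poly_eq0 sf.
exists f => // L i rs fs.
have urs : uniq rs.
  rewrite -separable_prod_XsubC -(eqp_separable fs) separable_map.
  by rewrite -(separable_map (in_alg K)) -fE.
have srs : size rs = d.
  by move/eqp_size: fs; rewrite size_map_poly sf size_prod_XsubC => -[].
have [s sE] : exists s : K -> {poly rat}, forall x, (map_poly (in_alg K) (s x)).[t] = x.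
  suff H : forall x, exists p, x == (map_poly (in_alg K) p).[t].
    by exists (fun x => xchoose (H x)) => x; rewrite -(eqP (xchooseP (H x))).
  by move=> x; have := memvf x; rewrite -tK => /Fadjoin1_polyP[p ->]; exists p.
have kerP (z : L) (q : {poly rat}) : z \in rs -> (map_poly (in_alg K) q).[t] = 0 ->
    (map_poly i q).[z] = 0.
  move=> zrs q0; have : map_poly (in_alg K) f %| map_poly (in_alg K) q.
    by rewrite -fE minPoly_dvdp // ?/root ?q0 //; apply/polyOver1P; exists q.
  rewrite dvdp_map => fq; have : map_poly i f %| map_poly i q by rewrite dvdp_map.
  rewrite (eqp_dvdl _ fs) => /(dvdp_trans _) -/(_ ('X - z%:P)).
  by rewrite dvdp_XsubCl root_prod_XsubC => /(_ zrs); rewrite dvdp_XsubCl => /eqP.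
have ext (z : L) : z \in rs -> exists g : {rmorphism K -> L},
    forall q, g (map_poly (in_alg K) q).[t] = (map_poly i q).[z].
  move=> zrs.
  have gq q : (map_poly i (s (map_poly (in_alg K) q).[t])).[z] = (map_poly i q).[z].
    apply/eqP; rewrite -subr_eq0 -hornerN -hornerD -rmorphB; apply/eqP.
    by apply: kerP => //; rewrite rmorphB hornerD hornerN sE subrr.
  have [|||g gE] := @rmorphism_of K L (fun x => (map_poly i (s x)).[z]).
  - move=> x y; rewrite -hornerN -hornerD -rmorphB -[in RHS]gq.
    by rewrite rmorphB hornerD hornerN !sE.
  - by have := gq 1; rewrite !rmorph1 !hornerC.
  - by move=> x y; rewrite -hornerM -rmorphM -[in RHS]gq rmorphM hornerM !sE.
  by exists g => q; rewrite gE.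
have rsk (k : 'I_d) : rs`_k \in rs by rewrite mem_nth // srs.
have [sigma sigmaE] : exists sigma : 'I_d -> {rmorphism K -> L},
   forall k q, sigma k (map_poly (in_alg K) q).[t] = (map_poly i q).[rs`_k].
  have [f1 f1P] := choice (fun k : 'I_d => ext _ (rsk k)).
  by exists f1.
exists sigma.
pose A := \matrix_(j < d, l < d) coord b l (t ^+ j).
pose O := \matrix_(l < d, k < d) sigma k (b`_l).
have VE : Vandermonde d (\row_k rs`_k) = map_mx i A *m O.
  apply/matrixP => j k; rewrite !mxE.
  have -> : rs`_k ^+ j = sigma k (t ^+ j).
    have := sigmaE k 'X^j; rewrite !map_polyXn !hornerXn => <- //.
  rewrite [t ^+ j in LHS](coord_vbasis (memvf _)) rmorph_sum /=.
  apply: eq_bigr => l _; rewrite !mxE -mulr_algl rmorphM /=; congr (_ * _).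
  exact: (rat_rmorphism_eq (sigma k \o in_alg K) i).
have : Vandermonde d (\row_k rs`_k) \in unitmx.
  rewrite unitmxE det_Vandermonde unitfE; apply/prodf_neq0 => j _.
  apply/prodf_neq0 => k jk; rewrite !mxE subr_eq0 nth_uniq ?srs //.
  by rewrite eq_sym; apply: contraTneq jk => ->; rewrite ltnn.
by rewrite VE unitmx_mul => /andP[].
Qed.

Lemma field_traceE (x : K) : field_trace x = \tr (mulmat x).
Proof. by apply: eq_bigr => l _; rewrite !mxE mulrC. Qed.

Section Sigma.

Variables (L : fieldType) (i : {rmorphism rat -> L}) (sigma : 'I_d -> {rmorphism K -> L}).

Definition embmx : 'M[L]_d := \matrix_(l, k) sigma k (b`_l).
Hypothesis embmx_unit : embmx \in unitmx.

Lemma sigmaZ k q x : sigma k (q *: x) = i q * sigma k x.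
Proof.
rewrite -mulr_algl rmorphM; congr (_ * _).
exact: (rat_rmorphism_eq (sigma k \o in_alg K) i).
Qed.

Lemma crd_embmx (x : K) : map_mx i (crd x) *m embmx = \row_k sigma k x.
Proof.
apply/rowP => k; rewrite !mxE [in RHS](crd_sum x) rmorph_sum.
by apply: eq_bigr => l _; rewrite sigmaZ !mxE.
Qed.

Lemma crd_embmxV (x : K) : map_mx i (crd x) = (\row_k sigma k x) *m invmx embmx.
Proof. by rewrite -crd_embmx mulmxK. Qed.

(** The columns of [embmx] are common eigenvectors of all multiplication matrices. Trace, norm and
    characteristic polynomial are read off this diagonalization. *)
Lemma mulmat_embmx (x : K) :
  map_mx i (mulmat x) *m embmx = embmx *m diag_mx (\row_k sigma k x).
Proof.
apply/row_matrixP => l; rewrite !row_mul -map_row rowK crd_embmx.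
apply/rowP => k; rewrite mul_mx_diag !mxE rmorphM //.
Qed.

Lemma mulmatE (x : K) :
  map_mx i (mulmat x) = embmx *m diag_mx (\row_k sigma k x) *m invmx embmx.
Proof. by rewrite -mulmat_embmx mulmxK. Qed.

Lemma trace_sigma (x : K) : i (field_trace x) = \sum_k sigma k x.
Proof.
rewrite field_traceE -trace_map_mx mulmatE mxtrace_mulC mulmxA mulVmx // mul1mx.
by rewrite mxtrace_diag; apply: eq_bigr => k _; rewrite mxE.
Qed.

Lemma norm_sigma (x : K) : i (\det (mulmat x)) = \prod_k sigma k x.
Proof.
rewrite -det_map_mx mulmatE !det_mulmx mulrAC -det_mulmx mulmxV // det1 mul1r.
by rewrite det_diag; apply: eq_bigr => k _; rewrite mxE.
Qed.

Lemma char_poly_sigma (x : K) :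
  map_poly i (char_poly (mulmat x)) = \prod_k ('X - (sigma k x)%:P).
Proof.
rewrite map_char_poly mulmatE /char_poly /char_poly_mx.
set D := diag_mx _; set O := embmx.
have -> : 'X%:M - map_mx polyC (O *m D *m invmx O) =
    map_mx polyC O *m ('X%:M - map_mx polyC D) *m map_mx polyC (invmx O).
  rewrite !map_mxM mulmxBr mulmxBl mul_mx_scalar -scalemxAl.
  by rewrite -[map_mx polyC O *m map_mx polyC (invmx O)]map_mxM mulmxV // map_mx1 scalemx1.
rewrite !det_mulmx mulrAC -det_mulmx -map_mxM mulmxV // map_mx1 det1 mul1r.
have -> : 'X%:M - map_mx polyC D = diag_mx (\row_k ('X - (sigma k x)%:P)).
  apply/matrixP => k l; rewrite !mxE; case: eqP => [->|_].
    by rewrite !mulr1n.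
  by rewrite !mulr0n rmorph0 subr0.
by rewrite det_diag; apply: eq_bigr => k _; rewrite mxE.
Qed.

Lemma char_poly_mulmat_root (x : K) : root (map_poly (in_alg K) (char_poly (mulmat x))) x.
Proof.
have k0 : 'I_d by apply: (Ordinal (adim_gt0 {:K}%AS)).
rewrite -(fmorph_root (sigma k0)) -map_poly_comp.
rewrite (eq_map_poly (rat_rmorphism_eq (sigma k0 \o in_alg K) i)).
by rewrite char_poly_sigma (bigD1 k0) //= rootM root_XsubC eqxx.
Qed.

(** The values of tau on the basis form a common eigenvector of the multiplication matrices.
    Expanded in the eigenvectors given by the sigma k, it has a nonzero coordinate k, which forces
    the eigenvalues tau x and sigma k x to agree. *)
Lemma rmorphism_sigma (tau : {rmorphism K -> L}) : exists k, tau =1 sigma k.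
Proof.
pose t : 'rV[L]_d := \row_l tau (b`_l).
have tM x : t *m map_mx i (mulmat x)^T = tau x *: t.
  apply/rowP => l; rewrite !mxE -rmorphM mulrC (crd_sum (b`_l * x)) rmorph_sum.
  apply: eq_bigr => m _; rewrite !mxE -mulr_algl rmorphM mulrC; congr (_ * _).
  exact/esym/(rat_rmorphism_eq (tau \o in_alg K) i).
pose s := t *m invmx embmx^T.
have eu : embmx^T \in unitmx by rewrite unitmx_tr.
have sD x : s *m diag_mx (\row_k sigma k x) = tau x *: s.
  rewrite /s scalemxAl -tM -!mulmxA; congr (_ *m _).
  have := congr1 trmx (mulmat_embmx x); rewrite !trmx_mul tr_diag_mx map_trmx => h.
  by rewrite -[diag_mx _](mulmxK eu) -h !mulmxA mulVmx // mul1mx.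
have [k sk] : exists k, s 0 k != 0.
  apply/existsP; rewrite -negb_forall; apply/negP => /forallP s0.
  have s00 : s = 0 by apply/rowP => k; rewrite [RHS]mxE; apply/eqP/s0.
  have t0 : t = 0 by have := mulmxKV eu t; rewrite -/s s00 mul0mx.
  have : tau 1 = 0.
    rewrite (crd_sum 1) rmorph_sum big1 // => l _.
    rewrite -mulr_algl rmorphM.
    by have := congr1 (fun t : 'rV_d => t 0 l) t0; rewrite !mxE => ->; rewrite mulr0.
  by rewrite rmorph1 => /eqP; rewrite oner_eq0.
clearbody s; exists k => x; have := congr1 (fun s : 'rV_d => s 0 k) (sD x).
rewrite mul_mx_diag !mxE mulrC => /eqP; rewrite -subr_eq0 -mulrBl mulf_eq0 (negPf sk) orbF.
by rewrite subr_eq0 => /eqP.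
Qed.

Lemma sigma_inj k l : sigma k =1 sigma l -> k = l.
Proof.
move=> kl; apply/eqP; apply: contraT => nkl.
have : \det embmx == 0.
  rewrite -det_tr; apply/eqP; apply: (@determinant_alternate _ _ _ k l) => // m.
  by rewrite !mxE.
by move: embmx_unit; rewrite unitmxE unitfE => /negPf->.
Qed.

End Sigma.

End Embeddings.

(** * Local degrees *)

Section MatrixNorm.

Variables (R : realType) (F : fieldType) (a : F -> R).
Hypothesis aP : is_absval a.

Definition mxnorm m n (A : 'M[F]_(m, n)) : R := \sum_i \sum_j a (A i j).

Lemma mxnorm_ge0 m n (A : 'M[F]_(m, n)) : 0 <= mxnorm A.
Proof. by apply: sumr_ge0 => i _; apply: sumr_ge0 => j _; exact: av_ge0. Qed.

Lemma le_mxnorm m n (A : 'M[F]_(m, n)) i j : a (A i j) <= mxnorm A.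
Proof.
rewrite /mxnorm (bigD1 i) //= (bigD1 j) //= -addrA lerDl addr_ge0 //.
  by apply: sumr_ge0 => ? _; exact: av_ge0.
by apply: sumr_ge0 => ? _; apply: sumr_ge0 => ? _; exact: av_ge0.
Qed.

Lemma mxnorm_eq0 m n (A : 'M[F]_(m, n)) : mxnorm A <= 0 -> A = 0.
Proof.
move=> A0; apply/matrixP => i j; rewrite mxE; apply/(av_eq0P aP)/eqP.
by rewrite eq_le av_ge0 // andbT (le_trans (le_mxnorm A i j)).
Qed.

Lemma mxnormD m n (A B : 'M[F]_(m, n)) : mxnorm (A + B) <= mxnorm A + mxnorm B.
Proof.
rewrite /mxnorm -big_split; apply: ler_sum => i _ /=.
by rewrite -big_split; apply: ler_sum => j _ /=; rewrite mxE av_leD.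
Qed.

Lemma mxnormN m n (A : 'M[F]_(m, n)) : mxnorm (- A) = mxnorm A.
Proof. by apply: eq_bigr => i _; apply: eq_bigr => j _; rewrite mxE avN. Qed.

Lemma mxnormM m n p (A : 'M[F]_(m, n)) (B : 'M[F]_(n, p)) :
  mxnorm (A *m B) <= mxnorm A * mxnorm B.
Proof.
rewrite /mxnorm mulr_suml; apply: ler_sum => i _.
apply: (@le_trans _ _ (\sum_k \sum_j a (A i j) * a (B j k))).
  apply: ler_sum => k _; rewrite mxE (le_trans (av_sum aP _ _ _)) //.
  by apply: ler_sum => j _; rewrite avM.
rewrite exchange_big /= mulr_suml; apply: ler_sum => j _.
rewrite -mulr_sumr ler_wpM2l ?av_ge0 // (bigD1 j) //= lerDl.
by apply: sumr_ge0 => ? _; apply: sumr_ge0 => ? _; exact: av_ge0.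
Qed.

Definition mxtends m n (x : nat -> 'M[F]_(m, n)) l :=
  forall e : R, 0 < e -> \forall k \near \oo, mxnorm (x k - l) < e.

Definition mxcauchy m n (x : nat -> 'M[F]_(m, n)) :=
  forall e : R, 0 < e -> exists n0 : nat,
    forall k l : nat, (n0 <= k)%N -> (n0 <= l)%N -> mxnorm (x k - x l) < e.

Lemma mxtends_cst m n (l : 'M[F]_(m, n)) : mxtends (fun=> l) l.
Proof.
move=> e e0; near=> k; rewrite subrr /mxnorm big1 // => i _; rewrite big1 // => j _.
by rewrite mxE av0.
Unshelve. all: by end_near.
Qed.

Lemma mxtends_cauchy m n (x : nat -> 'M[F]_(m, n)) l : mxtends x l -> mxcauchy x.
Proof.
move=> xl e e0; have [n0 _ h] : \forall k \near \oo, mxnorm (x k - l) < e / 2.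
  by apply: xl; lra.
exists n0 => k1 k2 /h h1 /h h2; rewrite -(subrK l (x k1)) -addrA.
rewrite (le_lt_trans (mxnormD _ _)) // -[l - x k2]opprB mxnormN.
by rewrite /= in h1 h2; lra.
Unshelve. all: by end_near.
Qed.

Lemma mxtends_unique m n (x : nat -> 'M[F]_(m, n)) l l' :
  mxtends x l -> mxtends x l' -> l = l'.
Proof.
move=> xl xl'; apply/eqP; rewrite -subr_eq0; apply/eqP/mxnorm_eq0.
apply/ler_addgt0Pr => e e0; rewrite add0r ltW //.
have e2 : 0 < e / 2 by lra.
near \oo => k.
have h1 : mxnorm (x k - l) < e / 2 by near: k; exact: xl.
have h2 : mxnorm (x k - l') < e / 2 by near: k; exact: xl'.
have -> : l - l' = - (x k - l) + (x k - l') by rewrite opprB addrA subrK.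
by rewrite (le_lt_trans (mxnormD _ _)) // mxnormN; lra.
Unshelve. all: by end_near.
Qed.

Lemma mxtendsB m n (x y : nat -> 'M[F]_(m, n)) l l' :
  mxtends x l -> mxtends y l' -> mxtends (fun k => x k - y k) (l - l').
Proof.
move=> xl yl e e0; have e2 : 0 < e / 2 by lra.
near=> k.
have h1 : mxnorm (x k - l) < e / 2 by near: k; exact: xl.
have h2 : mxnorm (y k - l') < e / 2 by near: k; exact: yl.
have -> : x k - y k - (l - l') = (x k - l) - (y k - l') by apply/matrixP => ? ?; rewrite !mxE; ring.
by rewrite (le_lt_trans (mxnormD _ _)) // mxnormN; lra.
Unshelve. all: by end_near.
Qed.

Lemma mxtendsM m n p (x : nat -> 'M[F]_(m, n)) (y : nat -> 'M[F]_(n, p)) l l' :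
  mxtends x l -> mxtends y l' -> mxtends (fun k => x k *m y k) (l *m l').
Proof.
move=> xl yl e e0.
have n1 : 0 <= mxnorm l by exact: mxnorm_ge0.
have n2 : 0 <= mxnorm l' by exact: mxnorm_ge0.
pose D := mxnorm l + mxnorm l' + 1.
pose t := Num.min 1 (e / (2 * D)).
have D0 : 0 < 2 * D by rewrite /D; lra.
have t0 : 0 < t by rewrite lt_min ltr01 divr_gt0.
have t1 : t <= 1 by rewrite ge_min lexx.
have t2 : t * (2 * D) <= e by rewrite -ler_pdivlMr // ge_min lexx orbT.
near=> k.
have h1 : mxnorm (x k - l) < t by near: k; exact: xl.
have h2 : mxnorm (y k - l') < t by near: k; exact: yl.
have -> : x k *m y k - l *m l' = (x k - l) *m (y k - l') + (x k - l) *m l' + l *m (y k - l').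
  by apply/matrixP => ? ?; rewrite !(mulmxBl, mulmxBr) !mxE; ring.
rewrite (le_lt_trans (mxnormD _ _)) // (le_lt_trans (lerD (mxnormD _ _) (lexx _))) //.
have g1 := mxnormM (x k - l) (y k - l').
have g2 := mxnormM (x k - l) l'.
have g3 := mxnormM l (y k - l').
have p1 := mxnorm_ge0 (x k - l); have p2 := mxnorm_ge0 (y k - l').
have q1 := ler_pM p1 p2 (ltW h1) (le_trans (ltW h2) t1).
have q2 := ler_wpM2r n2 (ltW h1).
have q3 := ler_wpM2l n1 (ltW h2).
by move: t2; rewrite /D; lra.
Unshelve. all: by end_near.
Qed.

Lemma mxtends0_le m n (x : nat -> 'M[F]_(m, n)) (f : nat -> R) (C : R) : 0 <= C ->
  (forall k, mxnorm (x k) <= C * f k) ->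
  (forall e, 0 < e -> \forall k \near \oo, f k < e) -> mxtends x 0.
Proof.
move=> C0 h f0 e e0; have := f0 (e / (1 + C)); rewrite divr_gt0 ?ltr_pwDl // => /(_ isT).
apply: filterS => k fk; rewrite subr0 (le_lt_trans (h k)) //.
have p : 0 < 1 + C by lra.
move: fk; rewrite ltr_pdivlMr // => fk.
have := mxnorm_ge0 (x k); have := h k; nra.
Qed.

Section Complete.

Variable i : {rmorphism rat -> F}.
Hypothesis complete : forall x : nat -> F,
  (forall e : R, 0 < e -> exists n0 : nat,
    forall k l : nat, (n0 <= k)%N -> (n0 <= l)%N -> a (x k - x l) < e) ->
  exists l, forall e : R, 0 < e -> \forall k \near \oo, a (x k - l) < e.
Hypothesis dense : forall (x : F) (e : R), 0 < e -> exists q, a (i q - x) < e.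

Lemma mxtends_entries m n (x : nat -> 'M[F]_(m, n)) (l : 'M[F]_(m, n)) :
  (forall k k' (e : R), 0 < e -> \forall j \near \oo, a (x j k k' - l k k') < e) -> mxtends x l.
Proof.
move=> h e e0; pose D : R := (m * n)%:R + 1.
have D0 : 0 < D by rewrite ltr_wpDl.
have hD : 0 < e / D by rewrite divr_gt0.
have : \forall j \near \oo, forall k, k \in enum [set: 'I_m * 'I_n]%SET -> a (x j k.1 k.2 - l k.1 k.2) < e / D.
  by apply: near_all_seq => k _; exact: h.
apply: filterS => j hj.
rewrite /mxnorm (le_lt_trans (_ : _ <= \sum_(k < m) \sum_(k' < n) e / D)) //.
  apply: ler_sum => k _; apply: ler_sum => k' _; rewrite !mxE ltW //.
  by apply: (hj (k, k')); rewrite mem_enum inE.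
rewrite sumr_const card_ord sumr_const card_ord -mulrnA -mulr_natr mulnC.
rewrite mulrAC ltr_pdivrMr // ltr_pM2l // /D; lra.
Qed.

Lemma mx_complete m n (x : nat -> 'M[F]_(m, n)) : mxcauchy x -> exists l, mxtends x l.
Proof.
move=> xc.
have H (kk : 'I_m * 'I_n) : exists l, forall e : R, 0 < e -> \forall j \near \oo, a (x j kk.1 kk.2 - l) < e.
  apply: complete => e /xc[n0 h]; exists n0 => j1 j2 h1 h2.
  by apply: le_lt_trans (h _ _ h1 h2); have := le_mxnorm (x j1 - x j2) kk.1 kk.2; rewrite !mxE.
have [f fP] := choice H.
by exists (\matrix_(k, k') f (k, k')); apply: mxtends_entries => k k' e e0; rewrite mxE; exact: fP (k, k') e e0.
Qed.

Lemma mx_approx m n (x : nat -> 'M[F]_(m, n)) :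
  exists q : nat -> 'M[rat]_(m, n), mxtends (fun k => map_mx i (q k) - x k) 0.
Proof.
have H (t : nat * 'I_m * 'I_n) : exists q, a (i q - x t.1.1 t.1.2 t.2) < (t.1.1.+1)%:R^-1.
  by apply: dense; rewrite invr_gt0.
have [f fP] := choice H.
exists (fun k => \matrix_(j, l) f (k, j, l)); apply: mxtends_entries => j l e e0.
have := near_infty_natSinv_lt (PosNum e0); apply: filterS => k /= he.
by rewrite !mxE subr0 (lt_trans (fP (k, j, l))).
Qed.

Lemma mx_approx_cst m n (l : 'M[F]_(m, n)) :
  exists q : nat -> 'M[rat]_(m, n), mxtends (fun k => map_mx i (q k)) l.
Proof.
have [q qP] := mx_approx (fun=> l); exists q => e /qP; apply: filterS => k.
by rewrite subr0.
Qed.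

End Complete.

End MatrixNorm.

Section LocalDegree.

Variables (R : realType) (K : fieldExtType rat) (F : fieldType) (a : F -> R).
Variable i : {rmorphism rat -> F}.
Hypothesis aP : is_absval a.
Hypothesis complete : forall x : nat -> F,
  (forall e : R, 0 < e -> exists n0 : nat,
    forall k l : nat, (n0 <= k)%N -> (n0 <= l)%N -> a (x k - x l) < e) ->
  exists l, forall e : R, 0 < e -> \forall k \near \oo, a (x k - l) < e.
Hypothesis dense : forall (x : F) (e : R), 0 < e -> exists q, a (i q - x) < e.
Let d := \dim {:K}.
Let b := vbasis {:K}.
Variables (v : K -> R) (P : 'M[F]_d) (C : R).
Hypothesis vP : is_absval v.
Hypothesis vu : forall q : rat, v q%:A = a (i q).
Hypothesis PP : P *m P = P.
Hypothesis C0 : 0 <= C.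
(* P projects K tensor F onto the summand that is the completion of K at v *)
Let X (x : K) : 'rV[F]_d := map_mx i (crd x) *m P.
Hypothesis le_vX : forall x, v x <= C * mxnorm a (X x).
Hypothesis le_Xv : forall x, mxnorm a (X x) <= C * v x.

Let XB x y : X (x - y) = X x - X y.
Proof. by rewrite /X crdB map_mxB mulmxBl. Qed.

Let X_sum n (c : 'I_n -> rat) (e : 'I_n -> K) :
  X (\sum_k c k *: e k) = map_mx i (\row_k c k) *m (\matrix_k X (e k)).
Proof.
rewrite /X crd_bigsum map_mx_sum mulmx_suml; apply/rowP => l.
rewrite summxE !mxE; apply: eq_bigr => k _.
by rewrite crdZ map_mxZ -scalemxAl !mxE.
Qed.

Let absval_nullP (x : nat -> K) :
  absval_null v x <-> forall e : R, 0 < e -> \forall n \near \oo, v (x n) < e.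
Proof.
split=> [/cvgrPdist_lt h e e0|h].
  by have := h e e0; apply: filterS => n; rewrite sub0r normrN ger0_norm // av_ge0.
apply/cvgrPdist_lt => e e0; have := h e e0.
by apply: filterS => n; rewrite sub0r normrN ger0_norm // av_ge0.
Qed.

Let null_tends (x : nat -> K) : absval_null v x <-> mxtends a (fun n => X (x n)) 0.
Proof.
split=> [/absval_nullP|] h.
  exact: (mxtends0_le aP C0 (fun n => le_Xv (x n))).
apply/absval_nullP => e e0.
have := h (e / (1 + C)); rewrite divr_gt0 ?ltr_pwDl // => /(_ isT).
apply: filterS => n; rewrite subr0 ltr_pdivlMr ?ltr_pwDl // => h1.
rewrite (le_lt_trans (le_vX _)) //; have := mxnorm_ge0 aP (X (x n)); nra.
Qed.

Let cauchy_mx (x : nat -> K) : absval_cauchy v x <-> mxcauchy a (fun n => X (x n)).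
Proof.
split=> h e e0.
  have e1 : 0 < e / (1 + C) by rewrite divr_gt0 ?ltr_pwDl.
  have [n0 hn] := h _ e1; exists n0 => k l k0 l0.
  rewrite -XB (le_lt_trans (le_Xv _)) //.
  have := hn k l k0 l0; rewrite ltr_pdivlMr ?ltr_pwDl //.
  by have := av_ge0 vP (x k - x l); nra.
have e1 : 0 < e / (1 + C) by rewrite divr_gt0 ?ltr_pwDl.
have [n0 hn] := h _ e1; exists n0 => k l k0 l0.
rewrite (le_lt_trans (le_vX _)) // XB.
have := hn k l k0 l0; rewrite ltr_pdivlMr ?ltr_pwDl //.
by have := mxnorm_ge0 aP (X (x k) - X (x l)); nra.
Qed.

Let rat_cauchyP n (c : 'I_n -> nat -> rat) :
  (forall k, rat_cauchy v (c k)) <-> mxcauchy a (fun m => map_mx i (\row_k c k m)).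
Proof.
split=> [h|h k e e0]; last first.
  have [n0 hn] := h e e0; exists n0 => m m' m0 m0'.
  rewrite -scalerBl vu; apply: le_lt_trans (hn _ _ m0 m0').
  by have := le_mxnorm aP (map_mx i (\row_k c k m) - map_mx i (\row_k c k m')) 0 k;
     rewrite !mxE rmorphB.
have H k : exists l, forall e : R, 0 < e -> \forall m \near \oo, a (i (c k m) - l) < e.
  apply: complete => e /(h k)[n0 hn]; exists n0 => m m' m0 m0'.
  by have := hn m m' m0 m0'; rewrite -scalerBl vu rmorphB.
have [l lP] := choice H.
apply: (@mxtends_cauchy _ _ _ aP _ _ _ (\row_k l k)).
by apply: mxtends_entries => k k' e e0; have := lP k' e e0; apply: filterS => m; rewrite !mxE.
Qed.

Let null_row n (c : 'I_n -> nat -> rat) :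
  mxtends a (fun m => map_mx i (\row_k c k m)) 0 <->
  forall k, absval_null v (fun m => (c k m)%:A).
Proof.
split=> [h k|h].
  apply/(absval_nullP (fun m => (c k m)%:A)) => e e0; have := h e e0; apply: filterS => m; rewrite subr0 vu.
  by apply: le_lt_trans; have := le_mxnorm aP (map_mx i (\row_k c k m)) 0 k; rewrite !mxE.
apply: mxtends_entries => k k' e e0; have /absval_nullP/(_ e e0) := h k'.
by apply: filterS => m; rewrite vu !mxE subr0.
Qed.

Let tendsP (x : nat -> 'rV[F]_d) l : mxtends a x l -> mxtends a (fun n => x n *m P) (l *m P).
Proof. by move=> h; apply: (mxtendsM aP h); exact: mxtends_cst. Qed.

(** The images X (e k m) converge as m grows, and their limits form a basis of the row space of P.
    Freeness uses that Q is dense in F, spanning that each row of P is a limit of images of elements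
    of K. *)
Lemma completion_basis_rank n (e : 'I_n -> nat -> K) :
  completion_basis v e -> n = \rank P.
Proof.
case=> eC eS eF.
have Y k : mxcauchy a (fun m => X (e k m)) by apply/cauchy_mx.
have [g gP] := choice (fun k => mx_complete aP complete (Y k)).
pose G : 'M[F]_(n, d) := \matrix_k g k.
have YG : mxtends a (fun m => \matrix_k X (e k m)) G.
  apply: mxtends_entries => k k' r r0; have := gP k r r0; apply: filterS => m.
  by apply: le_lt_trans; have := le_mxnorm aP (X (e k m) - g k) 0 k'; rewrite !mxE.
have GP : G *m P = G.
  have XP : (fun m => (\matrix_k X (e k m)) *m P) = (fun m => \matrix_k X (e k m)).
    apply: funext => m; apply/row_matrixP => k; rewrite row_mul !rowK /X.
    by rewrite -mulmxA PP.
  apply: (mxtends_unique aP _ YG).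
  by rewrite -XP; apply: (mxtendsM aP YG); exact: mxtends_cst.
have free : row_free G.
  apply: inj_row_free => c cG.
  have [q qc] := mx_approx_cst dense c.
  pose c' k m := q m 0 k.
  have qE m : q m = \row_k c' k m by apply/rowP => k; rewrite mxE.
  have : mxtends a (fun m => map_mx i (q m)) 0.
    under [fun _ => _]funext do rewrite qE.
    apply/null_row/eF.
      apply/rat_cauchyP; under [fun _ => _]funext do rewrite -qE.
      exact: mxtends_cauchy qc.
    apply/null_tends; under [fun _ => _]funext do rewrite X_sum -qE.
    by rewrite -cG; exact: mxtendsM.
  exact: mxtends_unique.
have span : (P <= G)%MS.
  apply/row_subP => k; set y := row k P.
  have yP : y *m P = y by rewrite -row_mul PP.
  have [q qy] := mx_approx_cst dense y.
  pose x m : K := \sum_l q m 0 l *: b`_l.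
  have qX : mxtends a (fun m => X (x m)) y.
    rewrite -yP; under [fun _ => _]funext do rewrite /X crd_lin.
    exact: (tendsP qy).
  clearbody x.
  have [|c cC cS] := eS x; first by apply/cauchy_mx; exact: mxtends_cauchy qX.
  have /rat_cauchyP/(mx_complete aP complete)[l cl] := cC.
  have h1 := mxtendsM aP cl YG.
  have /null_tends := cS.
  under [fun _ => _]funext do rewrite XB X_sum.
  move=> h2; have h3 := mxtendsB aP qX h1.
  have /eqP := mxtends_unique aP h2 h3; rewrite eq_sym subr_eq0 => /eqP ->.
  exact: submxMl.
apply/eqP; rewrite -(eqP free) eqn_leq; apply/andP; split; apply: mxrankS => //.
by rewrite -GP submxMl.
Qed.

(** A basis of the row space of P is approximated by rational matrices, whose rows are the
    coordinates of sequences in K. *)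
Lemma completion_basis_exists : exists e : 'I_(\rank P) -> nat -> K, completion_basis v e.
Proof.
pose B : 'M[F]_(\rank P, d) := row_base P.
have [q qB] := mx_approx_cst dense B.
have BP : B *m P = B.
  have : (B <= P)%MS by rewrite eq_row_base.
  by case/submxP => D ->; rewrite -mulmxA PP.
pose e k m : K := \sum_l q m k l *: b`_l.
have crde k m : crd (e k m) = row k (q m).
  rewrite -[RHS]crd_lin; congr crd; apply: eq_bigr => l _; by rewrite mxE.
have XeB : mxtends a (fun m => \matrix_k X (e k m)) B.
  have -> : (fun m => \matrix_k X (e k m)) = (fun m => map_mx i (q m) *m P).
    by apply: funext => m; apply/row_matrixP => k; rewrite rowK /X crde map_row row_mul.
  by rewrite -BP; apply: (mxtendsM aP qB); exact: mxtends_cst.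
exists e; split.
- move=> k; apply/cauchy_mx; apply: (@mxtends_cauchy _ _ _ aP _ _ _ (row k B)) => r r0.
  have := XeB r r0; apply: filterS => m; apply: le_lt_trans.
  rewrite {2}/mxnorm (bigD1 k) //= /mxnorm big_ord1 ler_wpDr //.
    by apply: sumr_ge0 => ? _; apply: sumr_ge0 => ? _; exact: av_ge0.
  by rewrite le_eqVlt; apply/orP; left; apply/eqP; apply: eq_bigr => l _; rewrite !mxE.
- move=> x /cauchy_mx xC.
  have XPB y : X y = X y *m pinvmx B *m B.
    by rewrite mulmxKpV // eq_row_base /X submxMl.
  have [y xy] := mx_complete aP complete xC.
  have cy : mxtends a (fun m => X (x m) *m pinvmx B) (y *m pinvmx B).
    by apply: (mxtendsM aP xy); exact: mxtends_cst.
  have [c cP] := mx_approx dense (fun m => X (x m) *m pinvmx B).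
  have cl : mxtends a (fun m => map_mx i (c m)) (y *m pinvmx B).
    have := mxtendsB aP cy (mxtendsB aP (mxtends_cst aP 0) cP).
    rewrite subr0 subr0; congr mxtends; apply: funext => m.
    by rewrite sub0r opprK addrC subrK.
  pose c' k m := c m 0 k.
  have cE m : c m = \row_k c' k m by apply/rowP => k; rewrite mxE.
  exists c'.
    by apply/rat_cauchyP; under [fun _ => _]funext do rewrite -cE; exact: mxtends_cauchy cl.
  apply/null_tends; under [fun _ => _]funext do rewrite XB X_sum -cE.
  have yE : y = y *m pinvmx B *m B.
    have -> : y = y *m P.
      apply: (mxtends_unique aP xy).
      have := tendsP xy; congr mxtends; apply: funext => m.
      by rewrite /X -mulmxA PP.
    by rewrite mulmxKpV // eq_row_base submxMl.
  by have := mxtendsB aP xy (mxtendsM aP cl XeB); rewrite -yE subrr.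
- move=> c cC cN; apply/null_row.
  have /rat_cauchyP/(mx_complete aP complete)[l cl] := cC.
  have /null_tends := cN.
  under [fun _ => _]funext do rewrite X_sum.
  move=> h1; have h2 := mxtendsM aP cl XeB.
  have lB := mxtends_unique aP h2 h1.
  suff -> : 0 = l by [].
  have /row_free_inj := row_base_free P.
  by apply; rewrite mul0mx.
Qed.

(** [local_degree] is a choice with default 0: existence of a completion basis excludes the default,
    and the rank lemma makes the choice unique. *)
Lemma local_degree_rank : local_degree v = \rank P.
Proof.
rewrite /local_degree; case: xgetP => [n -> /= [e eP]|h].
  exact: completion_basis_rank eP.
by have := h (\rank P); case; exact: completion_basis_exists.
Qed.

End LocalDegree.

(** The matrix is U U^T, where the columns of U are the unit vectors selected by J and U^T U = 1. *)
Lemma rank_diag_bool (F : fieldType) n (J : pred 'I_n) :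
  \rank (diag_mx (\row_k (J k)%:R) : 'M[F]_n) = #|J|.
Proof.
pose U : 'M[F]_(n, #|J|) := \matrix_(k, j) (k == enum_val j)%:R.
have UU : U^T *m U = 1%:M.
  apply/matrixP => j l; rewrite !mxE (bigD1 (enum_val j)) //= !mxE eqxx mul1r.
  rewrite big1 ?addr0 => [|k kj]; first by rewrite (inj_eq enum_val_inj).
  by rewrite !mxE (negPf kj) mul0r.
have DE : diag_mx (\row_k (J k)%:R) = U *m U^T.
  apply/matrixP => k l; rewrite !mxE.
  have [Jk|Jk] := boolP (J k); last first.
    rewrite mul0rn big1 // => j _; rewrite !mxE; case: eqP => [kj|_]; last by rewrite mul0r.
    by move: Jk; rewrite kj -[J _]/(_ \in J) enum_valP.
  rewrite (bigD1 (enum_rank_in Jk k)) //= big1 => [|j jk].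
    by rewrite !mxE enum_rankK_in // eqxx mul1r addr0 eq_sym.
  rewrite !mxE; case: eqP => [kj|_]; last by rewrite mul0r.
  by case/eqP: jk; apply: enum_val_inj; rewrite enum_rankK_in.
rewrite DE; apply/eqP; rewrite eqn_leq (leq_trans (mxrankM_maxl _ _)) ?rank_leq_col //=.
have E : U^T *m (U *m U^T) *m U = 1%:M by rewrite -mulmxA -(mulmxA U) UU mulmx1 UU.
by rewrite -{1}(mxrank1 F #|J|) -E (leq_trans (mxrankM_maxl _ _)) // mxrankM_maxr.
Qed.

(** * Absolute values and local degrees of K read off its embeddings *)

Section Places.

Variables (R : realType) (K : fieldExtType rat) (F L : fieldType) (a : L -> R).
Variables (iF : {rmorphism rat -> F}) (iota : {rmorphism F -> L}).
Hypothesis aP : is_absval a.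
Let aF x := a (iota x).
Hypothesis complete : forall x : nat -> F,
  (forall e : R, 0 < e -> exists n0 : nat,
    forall k l : nat, (n0 <= k)%N -> (n0 <= l)%N -> aF (x k - x l) < e) ->
  exists l, forall e : R, 0 < e -> \forall k \near \oo, aF (x k - l) < e.
Hypothesis dense : forall (x : F) (e : R), 0 < e -> exists q, aF (iF q - x) < e.
Hypothesis nontrivial : exists q, 0 < aF (iF q) < 1.
Let d := \dim {:K}.
Variable sigma : 'I_d -> {rmorphism K -> L}.
Hypothesis unit_sigma : embmx sigma \in unitmx.

Let i : {rmorphism rat -> L} := iota \o iF.

Definition sigma_abs k (x : K) : R := a (sigma k x).

Lemma sigma_abs_absval k : is_absval (sigma_abs k).
Proof.
split=> [x|x|x y|x y]; rewrite /sigma_abs ?av_ge0 ?rmorphM ?avM ?rmorphD ?av_leD //.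
split=> [/(av_eq0P aP)/eqP|->]; last by rewrite rmorph0 av0.
by rewrite fmorph_eq0 => /eqP.
Qed.

Lemma sigma_abs_rat k q : sigma_abs k q%:A = a (iota (iF q)).
Proof. by congr a; exact: (rat_rmorphism_eq (sigma k \o in_alg K) i). Qed.

Let aFP : is_absval aF.
Proof.
split=> [x|x|x y|x y]; rewrite /aF ?av_ge0 ?rmorphM ?avM ?rmorphD ?av_leD //.
split=> [/(av_eq0P aP)/eqP|->]; last by rewrite rmorph0 av0.
by rewrite fmorph_eq0 => /eqP.
Qed.

Let S : set (K -> R) := [set v | is_absval v /\ forall q, v q%:A = a (iota (iF q))].

Let Sw k : S (sigma_abs k).
Proof. by split; [exact: sigma_abs_absval|exact: sigma_abs_rat]. Qed.

(* An absolute value on K is bounded by the spectral radius max_k |sigma_k x|,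
   since the coordinates of the powers of x are. *)
Lemma absval_le_house v x (r : R) : S v -> 0 <= r ->
  (forall k, sigma_abs k x <= r) -> v x <= r.
Proof.
move=> [vP vu] r0 xr.
pose C := mxnorm a (invmx (embmx sigma)) *+ d * \sum_(l < d) v ((vbasis {:K})`_l).
have C0 : 0 <= C.
  by rewrite mulr_ge0 ?mulrn_wge0 ?mxnorm_ge0 //; apply: sumr_ge0 => l _; exact: av_ge0.
apply: (@pow_le_trick R (v x) r C) => // [|n]; first exact: av_ge0.
rewrite -avX // {1}(crd_sum (x ^+ n)) (le_trans (av_sum vP _ _ _)) //.
rewrite /C mulrAC mulr_sumr; apply: ler_sum => l _.
rewrite -mulr_algl avM // vu ler_wpM2r ?av_ge0 //.
have := le_mxnorm aP (map_mx i (crd (x ^+ n))) 0 l; rewrite mxE => /le_trans; apply.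
rewrite (crd_embmxV i unit_sigma) (le_trans (mxnormM aP _ _)) //.
rewrite [leLHS]mulrC mulrnAl -mulrnAr ler_wpM2l ?mxnorm_ge0 // /mxnorm big_ord1.
apply: (@le_trans _ _ (\sum_(k < d) r ^+ n)); last by rewrite sumr_const card_ord.
apply: ler_sum => k _; rewrite mxE rmorphXn avX //.
by rewrite lerXn2r ?nnegrE ?av_ge0 //; exact: xr.
Qed.

(** If v differed from every [sigma_abs k], independence would give z with v z > 1 and all sigma_abs
    k z < 1, against [absval_le_house]. *)
Lemma places_sigma v : is_absval v -> (forall q, v q%:A = a (iota (iF q))) ->
  exists k, v = sigma_abs k.
Proof.
move=> vP vu; apply: contrapT => /forallNP h.
have [q0 q01] := nontrivial.
have [||||z [vz wz]] := @absval_independence R K S _ q0%:A _ q01 _ v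
    [seq sigma_abs k | k <- enum 'I_d].
- by move=> w [].
- by move=> w [_ ->].
- by [].
- move=> w /mapP[k _ ->]; split; [exact: Sw|exact: h].
have : v z <= 1.
  apply: absval_le_house => // k; rewrite ltW // wz //.
  by apply/mapP; exists k; rewrite ?mem_enum.
by rewrite leNgt vz.
Qed.

Variable k0 : 'I_d.
Let J : pred 'I_d := [pred k | sigma_abs k == sigma_abs k0].
Let rJ : 'rV[L]_d := \row_k (J k)%:R.

(** The indicator of the embeddings inducing the same absolute value as k0 is an idempotent over L.
    Weak approximation gives elements of K close to 1 at that absolute value and close to 0 at the
    others; their coordinates converge to those of the idempotent, which lie in F because F is
    complete. *)
Let idempotent_coords : exists e : 'rV[F]_d, map_mx iota e = rJ *m invmx (embmx sigma).
Proof.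
have [q0 q01] := nontrivial.
have H (n : nat) : exists z, a (sigma k0 (z - 1)) < (n.+1%:R)^-1 /\
    forall k, ~~ J k -> a (sigma k z) < (n.+1%:R)^-1.
  have [|||||z [vz wz]] := @absval_approx1 R K S _ q0%:A _ q01 _ (sigma_abs k0)
    [seq sigma_abs k | k <- enum (predC J)] (n.+1%:R)^-1.
  - by move=> w [].
  - by move=> w [_ ->].
  - exact: Sw.
  - by rewrite invr_gt0.
  - move=> w /mapP[k]; rewrite mem_enum !inE => /eqP kk ->; split; [exact: Sw|].
    by move=> /esym.
  exists z; split=> // k Jk; apply: (wz (sigma_abs k)).
  by apply/mapP; exists k; rewrite ?mem_enum.
have [z zP] := choice H.
have zJ : mxtends a (fun n => \row_k sigma k (z n)) rJ.
  apply: mxtends_entries => j k e e0.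
  have := near_infty_natSinv_lt (PosNum e0); apply: filterS => n /= he.
  rewrite !mxE; apply: lt_trans he.
  have [Jk|Jk] := boolP (J k); last by rewrite subr0; exact: (zP n).2.
  have := (zP n).1; have /eqP/(congr1 (fun f => f (z n - 1))) := Jk.
  by rewrite /sigma_abs rmorphB rmorph1 => ->.
have tz : mxtends a (fun n => map_mx iota (map_mx iF (crd (z n)))) (rJ *m invmx (embmx sigma)).
  have -> : (fun n => map_mx iota (map_mx iF (crd (z n)))) =
            (fun n => (\row_k sigma k (z n)) *m invmx (embmx sigma)).
    by apply: funext => n; rewrite -(crd_embmxV i unit_sigma); apply/matrixP => ? ?; rewrite !mxE.
  by apply: (mxtendsM aP zJ); exact: mxtends_cst.
have mapE m n (A : 'M[F]_(m, n)) : mxnorm aF A = mxnorm a (map_mx iota A).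
  by apply: eq_bigr => ? _; apply: eq_bigr => ? _; rewrite mxE.
have [|e te] := @mx_complete R F aF aFP complete 1 d (fun n => map_mx iF (crd (z n))).
  move=> r r0; have [n0 hn] := mxtends_cauchy aP tz r0.
  exists n0 => k l k1 l1; rewrite mapE map_mxB; exact: hn.
exists e; apply: (mxtends_unique aP _ tz) => r r0.
by have := te r r0; apply: filterS => n; rewrite mapE map_mxB.
Qed.

(** Multiplication by the idempotent is a projector P over F, diagonal in the basis of embeddings.
    On the image of K under P the norm is equivalent to the absolute value at k0, and the rank of P
    counts the embeddings in J. *)
Lemma local_degree_sigma : local_degree (sigma_abs k0) = #|J|.
Proof.
have [e eE] := idempotent_coords.
pose P : 'M[F]_d := \sum_l e 0 l *: map_mx iF (mulmat ((vbasis {:K})`_l)).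
pose D : 'M[L]_d := diag_mx rJ.
pose O := embmx sigma.
have PE : map_mx iota P = O *m D *m invmx O.
  have -> : D = \sum_l iota (e 0 l) *: diag_mx (\row_k sigma k ((vbasis {:K})`_l)).
    apply/matrixP => k l; rewrite !mxE summxE.
    have := congr1 (fun r : 'rV[L]_d => (r *m O) 0 k) eE.
    rewrite mulmxKV // !mxE => <-; rewrite -sumrMnl; apply: eq_bigr => m _.
    by rewrite !mxE mulrnAr.
  rewrite map_mx_sum mulmx_sumr mulmx_suml; apply: eq_bigr => l _.
  rewrite map_mxZ -scalemxAr -scalemxAl; congr (_ *: _).
  by rewrite -(mulmatE i unit_sigma); apply/matrixP => ? ?; rewrite !mxE.
have DD : D *m D = D.
  apply/matrixP => k l; rewrite mul_diag_mx !mxE.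
  by case: (J k); rewrite ?mul0r ?mul0rn ?mul1r.
have PP : P *m P = P.
  apply: (map_mx_inj (f := iota)); rewrite map_mxM PE.
  by rewrite !mulmxA mulmxKV // -(mulmxA O D D) DD.
have rP : \rank P = #|J|.
  rewrite -(mxrank_map iota) PE mxrankMfree ?row_free_unit ?unitmx_inv //.
  rewrite -mxrank_tr trmx_mul mxrankMfree ?row_free_unit ?unitmx_tr //.
  by rewrite mxrank_tr rank_diag_bool.
have mapE m n (A : 'M[F]_(m, n)) : mxnorm aF A = mxnorm a (map_mx iota A).
  by apply: eq_bigr => ? _; apply: eq_bigr => ? _; rewrite mxE.
have XE x : map_mx iota (map_mx iF (crd x) *m P) = (\row_k sigma k x) *m D *m invmx O.
  rewrite map_mxM PE -map_mx_comp -[map_mx _ _]/(map_mx i (crd x)) (crd_embmxV i unit_sigma).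
  by rewrite !mulmxA mulmxKV.
have rDE x k : ((\row_k sigma k x) *m D) 0 k = sigma k x *+ J k.
  by rewrite mul_mx_diag !mxE mulr_natr.
(* One summand of the constant for each direction of the equivalence: [mxnorm a O] bounds the
   absolute value by the norm, the other one bounds the norm by the absolute value. *)
rewrite -rP; apply: (@local_degree_rank R K F aF iF aFP complete dense _ P
    (mxnorm a (invmx O) *+ d + mxnorm a O)).
- exact: sigma_abs_absval.
- exact: sigma_abs_rat.
- exact: PP.
- by rewrite addr_ge0 ?mulrn_wge0 ?mxnorm_ge0.
- move=> x; rewrite mapE XE mulrDl ler_wpDl ?mulr_ge0 ?mulrn_wge0 ?mxnorm_ge0 //.
  have := le_mxnorm aP ((\row_k sigma k x) *m D) 0 k0; rewrite rDE (eqxx _ : J k0) mulr1n => /le_trans; apply.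
  by rewrite -{1}(mulmxKV unit_sigma (_ *m D)) mulrC mxnormM.
- move=> x; rewrite mapE XE (le_trans (mxnormM aP _ _)) // mulrDl ler_wpDr //.
    apply: mulr_ge0; first exact: mxnorm_ge0.
    exact: av_ge0 (sigma_abs_absval k0) _.
  rewrite [leLHS]mulrC mulrnAl -mulrnAr ler_wpM2l ?mxnorm_ge0 //.
  rewrite /mxnorm big_ord1 -[X in _ *+ X](card_ord d) -sumr_const.
  apply: ler_sum => k _; rewrite rDE; have [Jk|Jk] := boolP (J k); last first.
    by rewrite mulr0n (av0 aP); exact: av_ge0 (sigma_abs_absval k0) _.
  by have /eqP/(congr1 (fun f => f x)) := Jk; rewrite mulr1n /sigma_abs => ->.
Qed.

End Places.

(** * Completions and extensions of absolute values *)

(** The proof is bundled with the function so that the type [completion v] carries its field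
    structure without a separate hypothesis. *)
Structure absval_of (R : realType) (k : fieldType) := AbsvalOf {
  absval_fun :> k -> R;
  absval_funP : is_absval absval_fun }.

Section Completion.
Local Open Scope quotient_scope.

Variables (R : realType) (k : fieldType) (v : absval_of R k).
Let vP : is_absval v := absval_funP v.

Definition cauchy_seq (x : nat -> k) : bool :=
  `[< forall e : R, 0 < e -> exists n0 : nat,
      forall m n : nat, (n0 <= m)%N -> (n0 <= n)%N -> v (x m - x n) < e >].

Lemma cauchy_seqP x : reflect (forall e : R, 0 < e -> exists n0 : nat,
      forall m n : nat, (n0 <= m)%N -> (n0 <= n)%N -> v (x m - x n) < e)
  (cauchy_seq x).
Proof. exact: asboolP. Qed.

Lemma cauchy_seq_bounded x : cauchy_seq x -> exists C : R, 0 < C /\ forall n, v (x n) <= C.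
Proof.
move=> /cauchy_seqP /(_ 1 ltr01)[n0 h].
pose C : R := \sum_(n < n0.+1) v (x n) + 1.
have S0 n : 0 <= v (x n) by exact: av_ge0.
have C0 : 0 <= \sum_(n < n0.+1) v (x n) by apply: sumr_ge0.
exists C; split=> [|n]; first by rewrite /C; lra.
have sub m : (m <= n0)%N -> v (x m) <= \sum_(n < n0.+1) v (x n).
  rewrite -ltnS => mn0; rewrite (bigD1 (Ordinal mn0)) //= lerDl.
  by apply: sumr_ge0.
have [nn0|nn0] := leqP n n0; first by rewrite (le_trans (sub _ nn0)) // /C; lra.
have := h n n0 (ltnW nn0) (leqnn _); have := av_sub vP (x n) (x n0).
have := sub n0 (leqnn _); rewrite /C; lra.
Qed.

Fact cauchy_seq_subring : subring_closed (cauchy_seq : {pred nat -> k}).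
Proof.
split=> [|x y|x y].
- by apply/cauchy_seqP => e e0; exists 0 => m n _ _; rewrite /= subrr av0.
- move=> /cauchy_seqP hx /cauchy_seqP hy; apply/cauchy_seqP => e e0.
  have e2 : 0 < e / 2 by lra.
  have [n1 h1] := hx _ e2; have [n2 h2] := hy _ e2.
  exists (maxn n1 n2) => m n; rewrite !geq_max => /andP[m1 m2] /andP[l1 l2].
  have -> : (x - y) m - (x - y) n = (x m - x n) - (y m - y n).
    by rewrite !fctE; ring.
  have := av_leB vP (x m - x n) (y m - y n).
  by have := h1 m n m1 l1; have := h2 m n m2 l2; lra.
- move=> cx cy; have [C [C0 hC]] := cauchy_seq_bounded cx.
  have [D [D0 hD]] := cauchy_seq_bounded cy.
  move/cauchy_seqP: cx => hx; move/cauchy_seqP: cy => hy; apply/cauchy_seqP => e e0.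
  have e1 : 0 < e / (2 * D) by rewrite divr_gt0 // mulr_gt0.
  have e2 : 0 < e / (2 * C) by rewrite divr_gt0 // mulr_gt0.
  have [n1 h1] := hx _ e1; have [n2 h2] := hy _ e2.
  exists (maxn n1 n2) => m n; rewrite !geq_max => /andP[m1 m2] /andP[l1 l2].
  have -> : (x * y) m - (x * y) n = (x m - x n) * y m + x n * (y m - y n).
    by rewrite !fctE; ring.
  rewrite (le_lt_trans (av_leD vP _ _)) // !(avM vP).
  have g1 := h1 m n m1 l1; have g2 := h2 m n m2 l2.
  have a1 : v (x m - x n) * v (y m) <= v (x m - x n) * D by rewrite ler_wpM2l ?av_ge0.
  have a2 : v (x n) * v (y m - y n) <= C * v (y m - y n) by rewrite ler_wpM2r ?av_ge0.
  move: g1 g2; rewrite !ltr_pdivlMr ?mulr_gt0 // => g1 g2.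
  by rewrite (le_lt_trans (lerD a1 a2)) //; lra.
Qed.

HB.instance Definition _ :=
  GRing.isSubringClosed.Build (nat -> k) cauchy_seq cauchy_seq_subring.

Record cseq := CSeq { cseq_val :> nat -> k; cseqP : cseq_val \in cauchy_seq }.

HB.instance Definition _ := [isSub for cseq_val].
HB.instance Definition _ := [Choice of cseq by <:].
HB.instance Definition _ := [SubChoice_isSubComNzRing of cseq by <:].

Definition null_seq (x : cseq) : bool :=
  `[< forall e : R, 0 < e -> \forall n \near \oo, v (x n) < e >].

Fact null_seq_idealr : idealr_closed (null_seq : {pred cseq}).
Proof.
split.
- by apply/asboolP => e e0; near=> n; rewrite /= av0.
- apply/negP => /asboolP /(_ 1 ltr01)[n _ /(_ n (leqnn _))] /=.
  by rewrite (av1 vP) ltxx.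
- move=> x y z /asboolP hy /asboolP hz; apply/asboolP => e e0.
  have [C [C0 hC]] := cauchy_seq_bounded (cseqP x).
  have e1 : 0 < e / (2 * C) by rewrite divr_gt0 // mulr_gt0.
  have e2 : 0 < e / 2 by lra.
  have h1 := hy _ e1; have h2 := hz _ e2; near=> n.
  have g1 : v (y n) < e / (2 * C) by near: n.
  have g2 : v (z n) < e / 2 by near: n.
  have -> : (x * y + z) n = x n * y n + z n by [].
  rewrite (le_lt_trans (av_leD vP _ _)) // (avM vP).
  have : v (x n) * v (y n) <= C * v (y n) by rewrite ler_wpM2r ?av_ge0.
  by move: g1; rewrite ltr_pdivlMr ?mulr_gt0 //; lra.
Unshelve. all: by end_near.
Qed.

HB.instance Definition _ := isIdealr.Build cseq null_seq null_seq_idealr.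

Definition null_ideal : idealr cseq := null_seq.

Definition completion := {ideal_quot null_ideal}.

HB.instance Definition _ := GRing.ComNzRing.on completion.

Let pi (x : cseq) : completion := \pi_{ideal_quot null_ideal} x.

Let piB x y : pi (x - y) = pi x - pi y. Proof. exact: rmorphB. Qed.
Let piD x y : pi (x + y) = pi x + pi y. Proof. exact: rmorphD. Qed.
Let piM x y : pi (x * y) = pi x * pi y. Proof. exact: rmorphM. Qed.
Let pi1 : pi 1 = 1. Proof. exact: rmorph1. Qed.

Let pi_eq0 x : (pi x == 0) = null_seq x.
Proof. by rewrite -[null_seq x]/(x \in null_ideal) -[x in RHS]subr0 Quotient.idealrBE pi_zeror. Qed.

Let pi_repr (q : completion) : pi (repr q) = q.
Proof. by rewrite /pi reprK. Qed.

Let non_null x : ~~ null_seq x -> exists2 c : R, 0 < c & \forall n \near \oo, c <= v (x n).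
Proof.
move=> /asboolPn /existsNP[e /not_implyP[e0 h]].
have e2 : 0 < e / 2 by lra.
exists (e / 2) => //.
have /cauchy_seqP /(_ _ e2)[n0 hn] := cseqP x.
have [n n0n xn] : exists2 n, (n0 <= n)%N & e <= v (x n).
  apply: contrapT => hc; apply: h; exists n0 => // n /= n0n.
  by rewrite ltNge; apply/negP => hh; apply: hc; exists n.
exists n0 => // m /= n0m.
by have := hn n m n0n n0m; have := av_leD vP (x n - x m) (x m); rewrite subrK; lra.
Qed.

Let inverse_ex (q : completion) : exists y : completion, (q != 0 -> y * q = 1) /\ (q = 0 -> y = 0).
Proof.
have [->|q0] := eqVneq q 0; first by exists 0; split=> //; rewrite eqxx.
pose x := repr q.
have /non_null[c c0 hc] : ~~ null_seq x by rewrite -pi_eq0 pi_repr.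
have [n0 _ hn0] := hc.
(* Where x n = 0 the inverse is 0; this can occur only before n0, so it affects neither the Cauchy
   condition nor the class of the product with x. *)
have yc : (fun n => (x n)^-1) \in cauchy_seq.
  apply/cauchy_seqP => e e0.
  have /cauchy_seqP /(_ (e * c ^+ 2))[|n1 hn1] := cseqP x.
    by rewrite mulr_gt0 ?exprn_gt0.
  exists (maxn n0 n1) => m n; rewrite !geq_max => /andP[m1 m2] /andP[l1 l2].
  have xm := hn0 m m1; have xn := hn0 n l1; rewrite /= in xm xn.
  have xm0 : x m != 0 by rewrite -(av_gt0 vP) (lt_le_trans c0).
  have xn0 : x n != 0 by rewrite -(av_gt0 vP) (lt_le_trans c0).
  have -> : (x m)^-1 - (x n)^-1 = (x n - x m) / (x m * x n) by field; rewrite xm0 xn0.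
  rewrite (avM vP) (avV vP) (avM vP) ltr_pdivrMr ?mulr_gt0 ?av_gt0 //.
  by rewrite (lt_le_trans (hn1 n m l2 m2)) // ler_pM2l // expr2; apply: ler_pM => //; exact: ltW.
exists (pi (CSeq yc)); split=> [_|q00]; last by rewrite q00 eqxx in q0.
rewrite -[q]pi_repr -/x -piM.
apply/eqP; rewrite -subr_eq0 -pi1 -piB pi_eq0; apply/asboolP => e e0.
exists n0 => // n /= n0n.
have xn0 : x n != 0 by rewrite -(av_gt0 vP) (lt_le_trans c0) //; exact: hn0.
suff : v ((x n)^-1 * x n - 1) < e by [].
by rewrite mulVf // subrr av0.
Qed.

Definition completion_inv (q : completion) : completion := projT1 (cid (inverse_ex q)).

Fact completion_mulVf (q : completion) : q != 0 -> completion_inv q * q = 1.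
Proof. by rewrite /completion_inv; case: cid => y /= [h _]. Qed.

Fact completion_inv0 : completion_inv 0 = 0.
Proof. by rewrite /completion_inv; case: cid => y /= [_]; exact. Qed.

HB.instance Definition _ :=
  GRing.ComNzRing_isField.Build completion completion_mulVf completion_inv0.

Let cvg_av (x : cseq) : exists l : R, v (x n) @[n --> \oo] --> l.
Proof.
apply/cvg_ex; apply: cauchy_cvg; apply/cauchy_exP => e e0.
have /cauchy_seqP /(_ _ e0)[n0 hn] := cseqP x.
exists (v (x n0)); exists n0 => // n /= n0n; rewrite /ball /=.
have h1 := av_sub vP (x n0) (x n); have h2 := av_sub vP (x n) (x n0).
have := hn n0 n (leqnn _) n0n; have := hn n n0 n0n (leqnn _).
by rewrite ltr_norml; lra.
Qed.

Definition completion_abs (q : completion) : R := limn (fun n => v (repr q n)).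

Let abs_cvg (x : cseq) : v (x n) @[n --> \oo] --> completion_abs (pi x).
Proof.
have /cvg_ex h := cvg_av (repr (pi x)).
have nx : null_seq (x - repr (pi x)).
  by rewrite -pi_eq0 piB pi_repr subrr.
apply/cvgrPdist_lt => e e0.
have e2 : 0 < e / 2 by lra.
have h1 : \forall n \near \oo, `|completion_abs (pi x) - v (repr (pi x) n)| < e / 2.
  by move/cvgrPdist_lt: h; exact.
have /asboolP/(_ _ e2) h2 := nx.
near=> n.
have g1 : `|completion_abs (pi x) - v (repr (pi x) n)| < e / 2 by near: n.
have g2 : v ((x - repr (pi x)) n) < e / 2 by near: n.
have {}g2 : v (x n - repr (pi x) n) < e / 2 by [].
have := av_sub vP (x n) (repr (pi x) n).
have := av_sub vP (repr (pi x) n) (x n); rewrite (avB vP).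
by move: g1 g2; rewrite !ltr_norml; lra.
Unshelve. all: by end_near.
Qed.

Let abs_le (x : cseq) (e : R) : (\forall n \near \oo, v (x n) <= e) -> completion_abs (pi x) <= e.
Proof.
move=> h; have hc := @abs_cvg x; rewrite -(cvg_lim _ hc) //.
by apply: limr_le => //; apply/cvg_ex; exact: cvg_av.
Qed.

Let abs_unique (x : cseq) (l : R) : v (x n) @[n --> \oo] --> l -> completion_abs (pi x) = l.
Proof. by move=> h; apply: cvg_unique (@abs_cvg x) h. Qed.

Lemma completion_absP : is_absval completion_abs.
Proof.
split=> [q|q|q r|q r].
- rewrite -[q]pi_repr -(cvg_lim _ (@abs_cvg (repr q))) //.
  by apply: limr_ge; [by apply/cvg_ex; exact: cvg_av|near=> n; exact: av_ge0].
- rewrite -[q]pi_repr; set x := repr q; split=> [h|/eqP].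
    have hc := @abs_cvg x; rewrite h in hc.
    apply/eqP; rewrite pi_eq0; apply/asboolP => e e0.
    by move/cvgrPdist_lt: hc => /(_ e e0); apply: filterS => n; rewrite sub0r normrN ger0_norm // av_ge0.
  rewrite pi_eq0 => /asboolP h; apply: abs_unique; apply/cvgrPdist_lt => e e0.
  by have := h e e0; apply: filterS => n; rewrite sub0r normrN ger0_norm // av_ge0.
- rewrite -[q]pi_repr -[r]pi_repr -piM; apply: abs_unique.
  under eq_cvg do rewrite (avM vP).
  by apply: cvgM; exact: abs_cvg.
- rewrite -[q]pi_repr -[r]pi_repr -piD.
  rewrite -(cvg_lim _ (@abs_cvg (repr q + repr r))) //.
  have h : (v (repr q n) + v (repr r n)) @[n --> \oo] -->
      completion_abs (pi (repr q)) + completion_abs (pi (repr r)).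
    by apply: cvgD; exact: abs_cvg.
  rewrite -(cvg_lim _ h) //; apply: ler_lim; [by apply/cvg_ex; exact: cvg_av|by apply/cvg_ex; eexists; exact: h|].
  by near=> n; exact: av_leD.
Unshelve. all: by end_near.
Qed.

Lemma completion_ultrametric : ultrametric v -> ultrametric completion_abs.
Proof.
move=> vu q r; apply/ler_addgt0Pr => e e0.
rewrite -[q]pi_repr -[r]pi_repr -piD; apply: abs_le.
have h1 : \forall n \near \oo, v (repr q n) < completion_abs (pi (repr q)) + e.
  have /cvgrPdist_lt/(_ e e0) := @abs_cvg (repr q).
  by apply: filterS => n; rewrite ltr_norml; lra.
have h2 : \forall n \near \oo, v (repr r n) < completion_abs (pi (repr r)) + e.
  have /cvgrPdist_lt/(_ e e0) := @abs_cvg (repr r).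
  by apply: filterS => n; rewrite ltr_norml; lra.
near=> n; apply: (le_trans (vu _ _)).
rewrite ge_max; apply/andP; split.
  by rewrite (le_trans (ltW (near h1 n _))) // lerD2r le_max lexx.
by rewrite (le_trans (ltW (near h2 n _))) // lerD2r le_max lexx orbT.
Unshelve. all: by end_near.
Qed.

Definition completion_const (x : k) : cseq :=
  CSeq (introT (cauchy_seqP (fun=> x)) (fun e e0 => ex_intro _ 0%N (fun m n _ _ =>
    eq_ind_r (fun y => y < e) e0 (eq_trans (congr1 v (subrr x)) (av0 vP))))).

Lemma completion_embedding : exists i : {rmorphism k -> completion},
  [/\ forall x, completion_abs (i x) = v x,
  (forall x, i x = \pi_{ideal_quot null_ideal} (completion_const x)) &
  (forall (q : completion) (e : R), 0 < e -> exists x, completion_abs (i x - q) < e)].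
Proof.
have [|||i iE] := @rmorphism_of k completion (fun x => pi (completion_const x)).
- by move=> x y; rewrite -piB; congr pi; exact: val_inj.
- by rewrite -pi1; congr pi; exact: val_inj.
- by move=> x y; rewrite -piM; congr pi; exact: val_inj.
exists i; split=> [x|x|q e e0]; last 1 first.
- have e2 : 0 < e / 2 by lra.
  have /cauchy_seqP /(_ _ e2)[n0 hn] := cseqP (repr q).
  exists (repr q n0); rewrite iE -[X in _ - X]pi_repr -piB.
  apply: (@le_lt_trans _ _ (e / 2)); last by lra.
  apply: abs_le; exists n0 => // n /= n0n; apply: ltW.
  exact: hn.
- rewrite iE; apply: (abs_unique (x := completion_const x)).
  by rewrite -[X in X @ _]/(cst (v x)); exact: cvg_cst.
- exact: iE.
Qed.

(** Each X n is replaced by an element q n of k at distance less than 1/(n+1). The sequence q is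
    Cauchy, and its class is the limit. *)
Lemma completion_complete (X : nat -> completion) :
  (forall e : R, 0 < e -> exists n0 : nat, forall m n : nat,
     (n0 <= m)%N -> (n0 <= n)%N -> completion_abs (X m - X n) < e) ->
  exists l, forall e : R, 0 < e -> \forall n \near \oo, completion_abs (X n - l) < e.
Proof.
move=> XC; have [i [iabs iE idense]] := completion_embedding.
have aP := completion_absP.
have H (n : nat) : exists x, completion_abs (i x - X n) < n.+1%:R^-1.
  by apply: idense; rewrite invr_gt0.
have [q qP] := choice H.
have qX (e : R) : 0 < e -> \forall n \near \oo, completion_abs (i (q n) - X n) < e.
  move=> e0; have := near_infty_natSinv_lt (PosNum e0).
  by apply: filterS => n /= he; apply: lt_trans he.
have qC : q \in cauchy_seq.
  apply/cauchy_seqP => e e0; have e3 : 0 < e / 3 by lra.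
  have [n0 h0] := XC _ e3; have [n1 _ h1] := qX _ e3.
  exists (maxn n0 n1) => m n; rewrite !geq_max => /andP[m1 m2] /andP[l1 l2].
  rewrite -iabs rmorphB.
  have -> : i (q m) - i (q n) = (i (q m) - X m) + (X m - X n) - (i (q n) - X n) by ring.
  have := av_leB aP ((i (q m) - X m) + (X m - X n)) (i (q n) - X n).
  have := av_leD aP (i (q m) - X m) (X m - X n).
  by have := h0 m n m1 l1; have := h1 m m2; have := h1 n l2; rewrite /=; lra.
have qD (e : R) : 0 < e -> \forall n \near \oo, completion_abs (i (q n) - pi (CSeq qC)) < e.
  move=> e0; have e2 : 0 < e / 2 by lra.
  have /cauchy_seqP /(_ _ e2)[n0 hn] := qC.
  exists n0 => // n /= n0n.
  rewrite iE -/(pi _) -piB.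
  apply: (@le_lt_trans _ _ (e / 2)); last by lra.
  apply: abs_le; exists n0 => // m /= n0m; apply: ltW.
  exact: hn.
exists (pi (CSeq qC)) => e e0; have e2 : 0 < e / 2 by lra.
have h1 := qX _ e2; have h2 := qD _ e2.
near=> n.
have g1 : completion_abs (i (q n) - X n) < e / 2 by near: n.
have g2 : completion_abs (i (q n) - pi (CSeq qC)) < e / 2 by near: n.
have -> : X n - pi (CSeq qC) = (i (q n) - pi (CSeq qC)) - (i (q n) - X n) by ring.
by have := av_leB aP (i (q n) - pi (CSeq qC)) (i (q n) - X n); lra.
Unshelve. all: by end_near.
Qed.

End Completion.

Lemma ultra_sum (R : realType) (F : fieldType) (a : F -> R) (C : R) I (r : seq I)
    (P : pred I) (f : I -> F) :
  is_absval a -> ultrametric a -> 0 <= C -> (forall i, P i -> a (f i) <= C) ->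
  a (\sum_(i <- r | P i) f i) <= C.
Proof.
move=> aP au C0 h; elim/big_rec: _ => [|i x Pi hx]; first by rewrite av0.
by rewrite (le_trans (au _ _)) // ge_max h.
Qed.

Lemma le_mul_eps (R : realType) (c x y : R) : 0 <= x -> 0 <= y ->
  (forall e, 0 < e -> c <= (x + e) * (y + e)) -> c <= x * y.
Proof.
move=> x0 y0 h; rewrite leNgt; apply/negP => cxy.
pose e := Num.min 1 ((c - x * y) / (2 * (x + y + 1))).
have p : 0 < 2 * (x + y + 1) by lra.
have e0 : 0 < e by rewrite lt_min ltr01 divr_gt0 // subr_gt0.
have e1 : e <= 1 by rewrite ge_min lexx.
have e2 : e * (2 * (x + y + 1)) <= c - x * y by rewrite -ler_pdivlMr // ge_min lexx orbT.
by have := h e e0; nra.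
Qed.

(** * Extension of an ultrametric absolute value to a finite extension field *)

Section ExtensionOfAbsoluteValues.

Variables (R : realType) (F : fieldType) (a : F -> R) (E : fieldExtType F).
Hypothesis aP : is_absval a.
Hypothesis au : ultrametric a.
Hypothesis nontrivial : exists q, 0 < a q < 1.

Let d := \dim {:E}.

Definition bounded_mx n (C : R) (A : 'M[F]_n) := forall i j, a (A i j) <= C.

Definition power_bounded (x : E) :=
  exists2 C, 0 <= C & forall n, bounded_mx C (mulmat (x ^+ n)).

Let mulmatM (x y : E) : mulmat (x * y) = mulmat x *m mulmat y.
Proof.
apply/row_matrixP => l; rewrite row_mul !rowK mulrA.
by rewrite crdM.
Qed.

Let mulmatZ (c : F) (x : E) : mulmat (c *: x) = c *: mulmat x.
Proof. by apply/row_matrixP => l; rewrite linearZ /= !rowK -scalerAr crdZ. Qed.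

Let mulmat1 : mulmat (1 : E) = 1%:M.
Proof.
apply/row_matrixP => l; rewrite rowK mulr1 row1.
have -> : (vbasis {:E})`_l = \sum_k (delta_mx 0 l : 'rV[F]_d) 0 k *: (vbasis {:E})`_k.
  rewrite (bigD1 l) //= big1 ?addr0 ?mxE ?eqxx ?scale1r // => k kl.
  by rewrite mxE (negPf kl) andbF scale0r.
exact: crd_lin.
Qed.

Let mulmatD (x y : E) : mulmat (x + y) = mulmat x + mulmat y.
Proof. by apply/row_matrixP => l; rewrite linearD /= !rowK mulrDr crdD. Qed.

Let mulmat_sum n (f : 'I_n -> E) : mulmat (\sum_i f i) = \sum_i mulmat (f i).
Proof.
elim: n f => [|n ih] f; last by rewrite !big_ord_recr /= mulmatD ih.
by rewrite !big_ord0 -[0 in LHS](scale0r 1) mulmatZ scale0r.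
Qed.

Let mulmatMn (x : E) n : mulmat (x *+ n) = mulmat x *+ n.
Proof.
rewrite -scaler_nat mulmatZ scaler_nat //.
Qed.

Let bounded_sum n m (C : R) (A : 'I_n -> 'M[F]_m) : 0 <= C -> (forall i, bounded_mx C (A i)) ->
  bounded_mx C (\sum_i A i).
Proof. by move=> C0 h i j; rewrite summxE; apply: ultra_sum => // k _; exact: h. Qed.

Let boundedMn m (C : R) (A : 'M[F]_m) n : 0 <= C -> bounded_mx C A -> bounded_mx C (A *+ n).
Proof.
move=> C0 h; have := @bounded_sum n m C (fun=> A) C0 (fun=> h).
by rewrite sumr_const card_ord.
Qed.

Let bounded_mul n (C D : R) (A B : 'M[F]_n) : 0 <= C -> 0 <= D ->
  bounded_mx C A -> bounded_mx D B -> bounded_mx (C * D) (A *m B).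
Proof.
move=> C0 D0 h k i j; rewrite mxE; apply: ultra_sum => //; first exact: mulr_ge0.
by move=> l _; rewrite avM // ler_pM // (av_ge0 aP).
Qed.

Let pbM x y : power_bounded x -> power_bounded y -> power_bounded (x * y).
Proof.
move=> [C C0 hC] [D D0 hD]; exists (C * D) => [|n]; first exact: mulr_ge0.
by rewrite exprMn mulmatM; exact: bounded_mul.
Qed.

Let pb_scalar (c : F) : a c <= 1 -> power_bounded c%:A.
Proof.
move=> c1; exists 1 => // n i j; rewrite exprZn expr1n mulmatZ mulmat1 !mxE.
case: (i == j); rewrite ?mulr0 ?(av0 aP) // mulr1 (avX aP) exprn_ile1 // (av_ge0 aP) //.
Qed.

(** In the binomial expansion, products of powers are uniformly bounded, and integer coefficients
    and sums do not enlarge an ultrametric bound. *)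
Let pb_sum n (f : 'I_n -> E) : (forall i, power_bounded (f i)) -> power_bounded (\sum_i f i).
Proof.
elim: n f => [|n ih] f h.
  by rewrite big_ord0 -(scale0r 1); apply: pb_scalar; rewrite av0.
rewrite big_ord_recr /=; have [C C0 hC] := ih (fun i => f (widen_ord (leqnSn n) i)) (fun i => h _).
have [D D0 hD] := h ord_max; exists (C * D) => [|m]; first exact: mulr_ge0.
rewrite exprDn mulmat_sum; apply: bounded_sum => [|i]; first exact: mulr_ge0.
by rewrite mulmatMn; apply: boundedMn; [exact: mulr_ge0|rewrite mulmatM; exact: bounded_mul].
Qed.

Let pbX x n : power_bounded x -> power_bounded (x ^+ n).
Proof. by move=> [C C0 h]; exists C => // m; rewrite -exprM; exact: h. Qed.

Let pb_root x n : (0 < n)%N -> power_bounded (x ^+ n) -> power_bounded x.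
Proof.
move=> n0 [C C0 h].
pose D : R := \sum_(r < n) \sum_i \sum_j a (mulmat (x ^+ r) i j).
have D0 : 0 <= D.
  by apply: sumr_ge0 => r _; apply: sumr_ge0 => i _; apply: sumr_ge0 => j _; exact: av_ge0.
exists (C * D) => [|m]; first exact: mulr_ge0.
rewrite (divn_eq m n) exprD mulnC exprM mulmatM; apply: bounded_mul => // i j.
have rn : (m %% n < n)%N by rewrite ltn_mod.
rewrite /D (bigD1 (Ordinal rn)) //= (bigD1 i) //= (bigD1 j) //= -!addrA lerDl.
rewrite !addr_ge0 //.
- by apply: sumr_ge0 => *; exact: av_ge0.
- by apply: sumr_ge0 => *; apply: sumr_ge0 => *; exact: av_ge0.
- by apply: sumr_ge0 => *; apply: sumr_ge0 => *; apply: sumr_ge0 => *; exact: av_ge0.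
Qed.

Let pb_scalar_le (c : F) : power_bounded (c%:A : E) -> a c <= 1.
Proof.
move=> [C C0 h]; apply: (@pow_le_trick R (a c) 1 C) => //; first exact: av_ge0.
move=> n; rewrite expr1n mulr1; have l0 : 'I_d by apply: (Ordinal (adim_gt0 {:E}%AS)).
have := h n l0 l0; rewrite exprZn expr1n mulmatZ mulmat1 !mxE eqxx mulr1.
by rewrite (avX aP).
Qed.

(* Power boundedness of x / c makes sense only for c in F, so the values of a on F
   are refined by taking n-th roots. *)
Definition radius (x : E) : set R := [set r | 0 <= r /\ exists n (c : F),
  [/\ (0 < n)%N, c != 0, a c <= r ^+ n & power_bounded (c^-1 *: x ^+ n)]].

Let radius_ex x : exists r, radius x r.
Proof.
have [q /andP[q0 q1]] := nontrivial.
pose D : R := \sum_i \sum_j a (mulmat x i j).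
have D0 : 0 <= D by apply: sumr_ge0 => i _; apply: sumr_ge0 => j _; exact: av_ge0.
have Dx : bounded_mx D (mulmat x).
  move=> i j; rewrite /D (bigD1 i) //= (bigD1 j) //= -!addrA lerDl addr_ge0 //.
    by apply: sumr_ge0 => *; exact: av_ge0.
  by apply: sumr_ge0 => *; apply: sumr_ge0 => *; exact: av_ge0.
have qn0 : q != 0 by rewrite -(av_gt0 aP).
have [k _ /(_ k (leqnn _)) /= hk] : \forall k \near \oo, a q ^+ k < (1 + D)^-1.
  by apply: near_expr_lt => //; rewrite ?ltW // invr_gt0; lra.
have qk0 : 0 < a (q ^+ k) by rewrite (av_gt0 aP) expf_neq0.
exists (a (q ^+ k))^-1; split; first by rewrite invr_ge0 ltW.
exists 1%N, (q ^+ k)^-1; split=> //; first by rewrite invr_eq0 expf_neq0.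
  by rewrite expr1 (avV aP).
rewrite invrK expr1.
have b1 : bounded_mx 1 (mulmat (q ^+ k *: x)).
  move=> i j; rewrite mulmatZ mxE (avM aP) (avX aP).
  have := Dx i j; have := av_ge0 aP (mulmat x i j).
  have qk : 0 <= a q ^+ k by rewrite exprn_ge0 // ltW.
  by move: hk; rewrite -[_^-1]mul1r ltr_pdivlMr ?ltr_pwDl //; nra.
exists 1 => // n; elim: n => [|n ih].
  by move=> i j; rewrite expr0 mulmat1 mxE; case: (i == j); rewrite ?(av1 aP) ?(av0 aP).
by rewrite exprS mulmatM -[1]mulr1; exact: bounded_mul.
Qed.

Definition spectral_radius (x : E) : R := inf (radius x).

Let radius_hasinf x : has_inf (radius x).
Proof. by split; [exact: radius_ex|exists 0 => r []]. Qed.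

Let spectral_le x r : radius x r -> spectral_radius x <= r.
Proof. by move=> h; apply: ge_inf => //; exact: (radius_hasinf x).2. Qed.

Let spectral_ge x r : (forall s, radius x s -> r <= s) -> r <= spectral_radius x.
Proof. by move=> h; apply: lb_le_inf; [exact: radius_ex|]. Qed.

Let spectral_near x (e : R) : 0 < e -> exists2 r, radius x r & r < spectral_radius x + e.
Proof. by move=> e0; have [r rx re] := inf_adherent e0 (radius_hasinf x); exists r. Qed.

(** On F only the inequality N <= a is imposed: it survives infima, and it becomes an equality once
    N is multiplicative. *)
Definition power_seminorm (N : E -> R) := [/\ forall x, 0 <= N x, N 1 = 1,
  forall x y, N (x + y) <= Num.max (N x) (N y),
  forall x y, N (x * y) <= N x * N y &
  (forall x n, N x ^+ n <= N (x ^+ n)) /\ forall c : F, N c%:A <= a c].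

Let common_radius x r n (c : F) m : (0 < m)%N ->
  c != 0 -> a c <= r ^+ n -> power_bounded (c^-1 *: x ^+ n) ->
  [/\ c ^+ m != 0, a (c ^+ m) <= r ^+ (n * m) & power_bounded ((c ^+ m)^-1 *: x ^+ (n * m))].
Proof.
move=> m0 c0 cr h; split.
- exact: expf_neq0.
- rewrite (avX aP) exprM; apply: lerXn2r => //; rewrite nnegrE; first exact: av_ge0.
  exact: le_trans (av_ge0 aP _) cr.
- by rewrite exprM -exprVn -exprZn; exact: pbX.
Qed.

(** Both elements are brought to the common exponent nm and scaled by whichever of c and c' has the
    larger absolute value; the terms of the binomial expansion are then power bounded. *)
Let radiusD x y r s : radius x r -> radius y s -> radius (x + y) (Num.max r s).
Proof.
move=> [r0 [n [c [n0 c0 cr hx]]]] [s0 [m [c' [m0 c'0 c's hy]]]].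
have [{c0 cr hx} + {} + {}] := common_radius m0 c0 cr hx.
have [{c'0 c's hy} + {} + {}] := common_radius n0 c'0 c's hy.
rewrite [(m * n)%N]mulnC; move: (c ^+ m) (c' ^+ n) => {c c'} c c' c'0 c's hy c0 cr hx.
split; first by rewrite le_max r0.
exists (n * m)%N, (if a c <= a c' then c' else c); set C := if _ then _ else _.
have C0 : C != 0 by rewrite /C; case: ifP.
have cC : a c <= a C by rewrite /C; case: ifP.
have c'C : a c' <= a C by rewrite /C; case: ifP => // /negbT; rewrite -ltNge => /ltW.
have nm0 : (0 < n * m)%N by rewrite muln_gt0 n0.
split=> //.
  have h1 : r ^+ (n * m) <= Num.max r s ^+ (n * m).
    by apply: lerXn2r; rewrite ?nnegrE ?le_max ?r0 ?lexx.
  have h2 : s ^+ (n * m) <= Num.max r s ^+ (n * m).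
    by apply: lerXn2r; rewrite ?nnegrE ?le_max ?r0 ?s0 ?lexx ?orbT.
  by rewrite /C; case: ifP => _; [exact: le_trans h2|exact: le_trans h1].
have resc (c1 : F) z : c1 != 0 -> a c1 <= a C -> power_bounded (c1^-1 *: z) -> power_bounded (C^-1 *: z).
  move=> c10 c1C h; have -> : C^-1 *: z = (c1 / C)%:A * (c1^-1 *: z).
    by rewrite mulr_algl scalerA; congr (_ *: _); field; rewrite C0 c10.
  apply: pbM => //; apply: pb_scalar.
  by rewrite (avM aP) (avV aP) ler_pdivrMr ?mul1r // (av_gt0 aP).
have {}hx := resc _ _ c0 cC hx; have {}hy := resc _ _ c'0 c'C hy.
rewrite exprDn scaler_sumr; apply: pb_sum => i.
have bin_pb (k : nat) z : power_bounded z -> power_bounded (z *+ k).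
  by move=> h; rewrite -[k]card_ord -sumr_const; apply: pb_sum.
(* x^(nm-i) y^i is in general not a product of powers of X = x^(nm) and Y = y^(nm), but its (nm)-th
   power is. *)
rewrite -scalerMnr; apply: bin_pb; apply: (pb_root nm0).
have swap (z : E) k l : (z ^+ k) ^+ l = (z ^+ l) ^+ k by rewrite -!exprM mulnC.
rewrite exprZn exprMn ![(_ ^+ _) ^+ (n * m)]swap.
set X := x ^+ (n * m) in hx *; set Y := y ^+ (n * m) in hy *.
have -> : C^-1 ^+ (n * m) *: (X ^+ (n * m - i) * Y ^+ i) =
    (C^-1 *: X) ^+ (n * m - i) * (C^-1 *: Y) ^+ i.
  rewrite !exprZn -scalerAl -scalerAr scalerA -exprD subnK //.
  by rewrite -ltnS ltn_ord.
by apply: pbM; exact: pbX.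
Qed.

Let radiusM x y r s : radius x r -> radius y s -> radius (x * y) (r * s).
Proof.
move=> [r0 [n [c [n0 c0 cr hx]]]] [s0 [m [c' [m0 c'0 c's hy]]]].
have [{c0 cr hx} + {} + {}] := common_radius m0 c0 cr hx.
have [{c'0 c's hy} + {} + {}] := common_radius n0 c'0 c's hy.
rewrite [(m * n)%N]mulnC; move: (c ^+ m) (c' ^+ n) => {c c'} c c' c'0 c's hy c0 cr hx.
split; first exact: mulr_ge0.
exists (n * m)%N, (c * c'); split; first by rewrite muln_gt0 n0.
- by rewrite mulf_neq0.
- by rewrite (avM aP) exprMn ler_pM // (av_ge0 aP).
- by rewrite exprMn invfM -scalerA scalerAr scalerAl; exact: pbM.
Qed.

Let spectral_ge0 x : 0 <= spectral_radius x.
Proof. by apply: spectral_ge => r []. Qed.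

Lemma spectral_radius_seminorm : power_seminorm spectral_radius.
Proof.
have algR (c : F) : c != 0 -> radius c%:A (a c).
  move=> c0; split; first exact: av_ge0.
  exists 1%N, c; rewrite !expr1; split=> //.
  by rewrite scalerA mulVf //; apply: pb_scalar; rewrite (av1 aP).
have [q0 /andP[q00 q01]] := nontrivial.
have M x y : spectral_radius (x * y) <= spectral_radius x * spectral_radius y.
  apply: le_mul_eps => // e e0.
  have [r rx rX] := spectral_near x e0; have [s sy sY] := spectral_near y e0.
  apply: le_trans (spectral_le (radiusM rx sy)) _.
  by apply: ler_pM; [case: rx|case: sy|exact: ltW|exact: ltW].
split=> //.
- apply/eqP; rewrite eq_le; apply/andP; split.
    by rewrite -[1 in leLHS](scale1r 1) -(av1 aP); apply/spectral_le/algR; exact: oner_neq0.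
  apply: spectral_ge => r [r0 [n [c [n0 c0 cr]]]].
  rewrite expr1n => /pb_scalar_le; rewrite (avV aP) invf_le1 ?(av_gt0 aP) // => c1.
  rewrite leNgt; apply/negP => r1.
  have := le_trans c1 cr; rewrite leNgt => /negP; apply.
  by rewrite exprn_ilt1 // -lt0n.
- move=> x y; apply/ler_addgt0Pr => e e0.
  have [r rx rX] := spectral_near x e0; have [s sy sY] := spectral_near y e0.
  apply: le_trans (spectral_le (radiusD rx sy)) _.
  rewrite ge_max; apply/andP; split.
    by rewrite (le_trans (ltW rX)) // lerD2r le_max lexx.
  by rewrite (le_trans (ltW sY)) // lerD2r le_max lexx orbT.
- split=> [x m|c].
    have [->|m0] := posnP m.
      rewrite !expr0; apply: spectral_ge => r [r0 [n [c [n0 c0 cr]]]].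
      rewrite expr1n => /pb_scalar_le; rewrite (avV aP) invf_le1 ?(av_gt0 aP) // => c1.
      rewrite leNgt; apply/negP => r1.
      have := le_trans c1 cr; rewrite leNgt => /negP; apply.
      by rewrite exprn_ilt1 // -lt0n.
    apply: spectral_ge => r [r0 [n [c [n0 c0 cr h]]]].
    pose t := r `^ (m%:R^-1).
    have tm : t ^+ m = r.
      by rewrite -powR_mulrn ?powR_ge0 // -powRrM mulVf ?pnatr_eq0 -?lt0n // powRr1.
    rewrite -tm; apply: lerXn2r; rewrite ?nnegrE ?powR_ge0 //.
    apply: spectral_le; split; first exact: powR_ge0.
    exists (m * n)%N, c; split=> //; first by rewrite muln_gt0 m0.
      by rewrite exprM tm.
    by rewrite exprM.
  have [->|c0] := eqVneq c 0; last exact/spectral_le/algR.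
  (* [algR] excludes c = 0. Here spectral_radius 0 <= spectral_radius 0 * a q0 with a q0 < 1 forces
     the value 0. *)
  rewrite (av0 aP) scale0r.
  have q0n : q0 != 0 by rewrite -(av_gt0 aP).
  have := M 0 (q0%:A); rewrite mul0r => h.
  have := spectral_le (algR _ q0n); have := spectral_ge0 0; nra.
Qed.

(** Each axiom is asked only up to passing to a further index, as holds in a family directed
    downwards. It is applied to the decreasing sequence of [seminorm_smoothing] and to a chain in
    Zorn's lemma. *)
Lemma seminorm_inf (T : Type) (s : T -> E -> R) : inhabited T ->
  (forall t x, 0 <= s t x) -> (forall t, s t 1 = 1) ->
  (forall t t' x y, exists t'', s t'' (x + y) <= Num.max (s t x) (s t' y)) ->
  (forall t t' x y, exists t'', s t'' (x * y) <= s t x * s t' y) ->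
  (forall t x n, exists t', s t' x ^+ n <= s t (x ^+ n)) ->
  (forall t (c : F), s t c%:A <= a c) ->
  let N x := inf [set r | exists t, r = s t x] in
  power_seminorm N /\ forall t x, N x <= s t x.
Proof.
move=> [t0] s0 s1 sD sM sX sc N.
have hi x : has_inf [set r | exists t, r = s t x].
  by split; [exists (s t0 x), t0|exists 0 => _ [t ->]].
have Nle t x : N x <= s t x by apply: ge_inf; [exact: (hi x).2|exists t].
have Nge x r : (forall t, r <= s t x) -> r <= N x.
  by move=> h; apply: lb_le_inf; [exact: (hi x).1|move=> _ [t ->]].
have Nnear x (e : R) : 0 < e -> exists t, s t x < N x + e.
  by move=> e0; have [_ [t ->] h] := inf_adherent e0 (hi x); exists t.
have N0 x : 0 <= N x by apply: Nge.
split=> //; split=> //.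
- by apply/eqP; rewrite eq_le -{1}(s1 t0) Nle /=; apply: Nge => t; rewrite s1.
- move=> x y; apply/ler_addgt0Pr => e e0.
  have [t tx] := Nnear x e e0; have [t' ty] := Nnear y e e0.
  have [t'' h] := sD t t' x y; apply: le_trans (Nle t'' _) _.
  apply: le_trans h _; rewrite ge_max; apply/andP; split.
    by rewrite (le_trans (ltW tx)) // lerD2r le_max lexx.
  by rewrite (le_trans (ltW ty)) // lerD2r le_max lexx orbT.
- move=> x y; apply: le_mul_eps => // e e0.
  have [t tx] := Nnear x e e0; have [t' ty] := Nnear y e e0.
  have [t'' h] := sM t t' x y; apply: le_trans (Nle t'' _) _.
  by apply: le_trans h _; apply: ler_pM; rewrite ?s0 //; exact: ltW.
- split=> [x n|c]; last exact: le_trans (Nle t0 _) (sc _ _).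
  apply: Nge => t; have [t' h] := sX t x n; apply: le_trans h.
  by apply: lerXn2r; rewrite ?nnegrE ?N0 ?s0 ?Nle.
Qed.

Let seminormX N x n : power_seminorm N -> N (x ^+ n) = N x ^+ n.
Proof.
move=> [N0 N1 _ NM [NX _]]; apply/eqP; rewrite eq_le NX andbT.
elim: n => [|n ih]; first by rewrite !expr0 N1.
by rewrite !exprS (le_trans (NM _ _)) // ler_wpM2l.
Qed.

(* N' x is the infimum, in fact the limit, of N (x * f ^ n) / N f ^ n. *)
Lemma seminorm_smoothing N f : power_seminorm N -> 0 < N f ->
  exists N', [/\ power_seminorm N', forall x, N' x <= N x & forall x, N' x * N f <= N (x * f)].
Proof.
move=> NP f0; have [N0 N1 ND NM [NX Nc]] := NP.
pose s n x := N (x * f ^+ n) / N f ^+ n.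
have fn n : 0 < N f ^+ n by rewrite exprn_gt0.
have mono n m x : (n <= m)%N -> s m x <= s n x.
  move=> nm; rewrite /s -(subnK nm) addnC exprD [in X in _ / X]exprD mulrA.
  rewrite ler_pdivrMr ?mulr_gt0 // mulrA divfK ?lt0r_neq0 //.
  by rewrite (le_trans (NM _ _)) // seminormX.
have [|||||||NP' Nle] := @seminorm_inf nat s.
- by split; exact: 0%N.
- by move=> n x; rewrite divr_ge0 // ltW.
- by move=> n; rewrite /s mul1r seminormX // divff // lt0r_neq0.
- move=> n m x y; exists (maxn n m).
  apply: le_trans (_ : Num.max (s (maxn n m) x) (s (maxn n m) y) <= _); last first.
    rewrite ge_max; apply/andP; split.
      by rewrite le_max mono ?leq_maxl.
    by rewrite le_max (mono m) ?leq_maxr ?orbT.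
  rewrite /s mulrDl ler_pdivrMr // (le_trans (ND _ _)) //.
  by rewrite maxr_pMl ?(ltW (fn _)) // !divfK ?lt0r_neq0 // ge_max le_max lexx /= le_max lexx orbT.
- move=> n m x y; exists (n + m)%N.
  rewrite /s !exprD ler_pdivrMr ?mulr_gt0 //.
  have -> : x * y * (f ^+ n * f ^+ m) = (x * f ^+ n) * (y * f ^+ m) by ring.
  rewrite (le_trans (NM _ _)) // le_eqVlt; apply/orP; left; apply/eqP.
  by field; rewrite !lt0r_neq0.
- move=> n x m; have [->|m0] := posnP m.
    by exists 0%N; rewrite !expr0 /s mul1r seminormX // divff // lt0r_neq0.
  exists n; apply: le_trans (mono n (n * m)%N _ (leq_pmulr _ m0)).
  rewrite /s expr_div_n -exprM ler_pdivrMr // divfK ?lt0r_neq0 //.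
  by rewrite [in leRHS]exprM -exprMn NX.
- move=> n c; rewrite /s ler_pdivrMr // (le_trans (NM _ _)) // seminormX //.
  by rewrite ler_wpM2r // ltW.
exists (fun x => inf [set r | exists n, r = s n x]); split=> //.
  by move=> x; apply: le_trans (Nle 0%N x) _; rewrite /s !expr0 mulr1 divr1.
by move=> x; rewrite -ler_pdivlMr //; apply: le_trans (Nle 1%N x) _; rewrite /s !expr1.
Qed.

(** A minimal power-multiplicative seminorm equals each of its smoothings, hence N (x f) = N x * N f
    whenever N f > 0. If x is not 0, then 1 = N (x x^-1) <= N x * N x^-1 shows N x > 0, so N is
    multiplicative everywhere. *)
Lemma absval_extension : exists N : E -> R,
  [/\ is_absval N, ultrametric N & forall c : F, N c%:A = a c].
Proof.
pose T := {N : E -> R | power_seminorm N}.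
(* The order is reversed: a maximal element for [leT] is a minimal seminorm. An empty chain is
   bounded by [spectral_radius]. *)
pose leT (N M : T) : bool := `[< forall x, sval M x <= sval N x >].
have [|||Ch tot|[N NP] Nmin] := @Zorn T leT.
- by move=> N; apply/asboolP.
- by move=> N M P /asboolP h1 /asboolP h2; apply/asboolP => x; exact: le_trans (h1 x).
- move=> [N NP] [M MP] /asboolP h1 /asboolP h2; apply: eq_exist => /=.
  by apply: funext => x; apply/eqP; rewrite eq_le h1 h2.
- have [[t0 ct0]|ch0] := pselect (exists t, Ch t); last first.
    exists (exist _ _ spectral_radius_seminorm) => t ct; case: ch0; by exists t.
  have dir (t t' : {t | Ch t}) : exists t'' : {t | Ch t},
      (forall x, sval (sval t'') x <= sval (sval t) x) /\
      forall x, sval (sval t'') x <= sval (sval t') x.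
    case: t t' => [t ct] [t' ct'].
    have [/asboolP h|/asboolP h] := tot _ _ ct ct'.
      by exists (exist _ _ ct').
    by exists (exist _ _ ct).
  have tP (t : {t | Ch t}) : power_seminorm (sval (sval t)) by case: t => [[t tP] ?].
  have [|||||||NP Nle] := @seminorm_inf {t | Ch t} (fun t => sval (sval t)).
  + by split; exists t0.
  + by move=> t; case: (tP t).
  + by move=> t; case: (tP t).
  + move=> t t' x y; have [t'' [h1 h2]] := dir t t'; exists t''.
    have [_ _ ND _ _] := tP t''; apply: le_trans (ND _ _) _.
    rewrite ge_max; apply/andP; split; rewrite le_max.
      by rewrite h1.
    by rewrite h2 orbT.
  + move=> t t' x y; have [t'' [h1 h2]] := dir t t'; exists t''.
    have [N0 _ _ NM _] := tP t''; apply: le_trans (NM _ _) _.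
    exact: ler_pM.
  + by move=> t x n; exists t; have [_ _ _ _ []] := tP t.
  + by move=> t c; have [_ _ _ _ []] := tP t.
  exists (exist _ _ NP) => t ct; apply/asboolP => x /=.
  exact: (Nle (exist _ _ ct)).
exists N; have [N0 N1 ND NM [NX Nc]] := NP.
have NM' x f : 0 < N f -> N (x * f) = N x * N f.
  move=> f0; apply/eqP; rewrite eq_le NM /=.
  have [N' [N'P N'N N'f]] := seminorm_smoothing NP f0.
  have /(congr1 sval)/= E' := Nmin (exist _ _ N'P) (asboolT N'N).
  by have := N'f x; rewrite E'.
have Npos x : x != 0 -> 0 < N x.
  move=> x0; rewrite lt_def N0 andbT; apply/eqP => Nx.
  have := NM x x^-1; rewrite mulfV // N1 Nx mul0r.
  by rewrite leNgt ltr01.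
have N00 : N 0 = 0.
  by apply/eqP; rewrite eq_le N0 andbT -(av0 aP) -[0 in leLHS](scale0r 1) Nc.
split=> //.
- split=> // [x|x y|x y].
  + split=> [/eqP|->] //; apply: contraTeq => /Npos; by rewrite lt_def => /andP[].
  + by have [->|y0] := eqVneq y 0; rewrite ?mulr0 ?N00 ?mulr0 // NM' // Npos.
  + apply: le_trans (ND _ _) _; rewrite ge_max; apply/andP; split.
      by rewrite lerDl.
    by rewrite lerDr.
- move=> c; have [->|c0] := eqVneq c 0; first by rewrite scale0r N00 (av0 aP).
  apply/eqP; rewrite eq_le Nc /=.
  have h : N c%:A * N (c^-1)%:A = 1.
    by rewrite -NM' ?Npos ?scaler_eq0 ?oner_eq0 ?orbF ?invr_eq0 // -scalerAl mul1r scalerA mulfV // scale1r.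
  have ac : 0 < a c by rewrite (av_gt0 aP).
  have := Nc c^-1; rewrite (avV aP) => h2.
  rewrite -[leRHS]mulr1 -(mulfV (lt0r_neq0 ac)) mulrCA -[leLHS]mulr1 -{1}h.
  by rewrite ler_pM2l // ler_wpM2l.
Qed.

End ExtensionOfAbsoluteValues.

(** A nonconstant divisor of least degree is irreducible. *)
Lemma min_factor (F : fieldType) (f : {poly F}) : (1 < size f)%N ->
  exists g : {poly F}, irreducible_poly g /\ g %| f.
Proof.
move=> f1; have ex : exists n, `[< exists g : {poly F}, [/\ (1 < size g)%N, g %| f & size g = n] >].
  by exists (size f); apply/asboolP; exists f.
have [m /asboolP[g [g1 gf gm]] mmin] := ex_minnP ex.
exists g; split=> //; split=> // q q1 qg.
rewrite /eqp qg /=.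
have g0 : g != 0 by rewrite -size_poly_gt0 (ltn_trans _ g1).
have q0 : q != 0 by apply: contraTneq qg => ->; rewrite dvd0p.
have q2 : (1 < size q)%N by rewrite ltn_neqAle eq_sym q1 size_poly_gt0.
have : (m <= size q)%N by apply: mmin; apply/asboolP; exists q; rewrite (dvdp_trans qg).
move=> mq; have : q %= g by rewrite -dvdp_size_eqp // eqn_leq dvdp_leq // gm mq.
by rewrite /eqp => /andP[].
Qed.

Section Splitting.

Variable R : realType.

(** One root is adjoined at a time and the absolute value extended at each step; the induction is on
    a bound n for the degree of what remains, with the field and its absolute value varying. *)
Lemma absval_splitting n (F : fieldType) (a : F -> R) (f : {poly F}) :
  is_absval a -> ultrametric a -> (exists q, 0 < a q < 1) ->
  f != 0 -> (size f <= n.+1)%N ->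
  exists (L : fieldType) (b : L -> R) (iota : {rmorphism F -> L}) (rs : seq L),
    [/\ is_absval b, ultrametric b, forall x, b (iota x) = a x &
        map_poly iota f %= \prod_(z <- rs) ('X - z%:P)].
Proof.
elim: n F a f => [|n ih] F a f aP au nt f0 sf.
  exists F, a, idfun, [::]; split=> //.
  rewrite map_poly_id // big_nil -size_poly_eq1 eqn_leq sf size_poly_gt0 //.
have [f1|f1] := leqP (size f) 1.
  exists F, a, idfun, [::]; split=> //.
  rewrite map_poly_id // big_nil -size_poly_eq1 eqn_leq f1 size_poly_gt0 //.
have [g [gi gf]] := min_factor f1.
have [E _ [z gz _]] := irredp_FAdjoin gi.
have [N [NP Nu Na]] := absval_extension E aP au nt.
have fz : root (map_poly (in_alg E) f) z.
  rewrite -dvdp_XsubCl; apply: dvdp_trans (_ : map_poly (in_alg E) g %| _).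
    by rewrite dvdp_XsubCl.
  by rewrite dvdp_map.
have /factor_theorem[h hE] := fz.
have h0 : h != 0.
  apply: contraNneq f0 => h0; move/eqP: hE; rewrite h0 mul0r.
  by rewrite map_poly_eq0.
have sh : (size h <= n.+1)%N.
  have := congr1 (fun p : {poly E} => size p) hE; rewrite size_map_poly size_mul ?polyXsubC_eq0 //.
  by rewrite size_XsubC addn2 /= => E'; rewrite -ltnS -E'.
have [q /andP[q0 q1]] := nt.
have [|L [b [iota [rs [bP bu bN hrs]]]]] := ih E N h NP Nu _ h0 sh.
  by exists q%:A; rewrite Na q0.
exists L, b, (iota \o in_alg E), (iota z :: rs); split=> //.
  by move=> x; rewrite /= bN Na.
rewrite map_poly_comp hE rmorphM /= map_polyXsubC big_cons mulrC.
by rewrite eqp_mul2l ?polyXsubC_eq0.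
Qed.

End Splitting.

(** * The p-adic absolute value on the rationals *)

Section PadicAbs.

Variable p : nat.
Hypothesis p_prime : prime p.

Let p0 : (p%:R : rat) != 0. Proof. by rewrite pnatr_eq0 -lt0n prime_gt0. Qed.
Let p1 : 1 <= (p%:R : rat). Proof. by rewrite ler1n prime_gt0. Qed.

Lemma padic_abs_frac (n m : int) : n != 0 -> m != 0 ->
  padic_abs p (n%:~R / m%:~R) = p%:R ^ ((logn p `|m|)%:Z - (logn p `|n|)%:Z).
Proof.
move=> n0 m0; rewrite /padic_abs mulf_eq0 invr_eq0 !intr_eq0 (negPf n0) (negPf m0) /=.
set q : rat := n%:~R / m%:~R.
have q0 : numq q != 0 by rewrite numq_eq0 mulf_neq0 ?invr_eq0 ?intr_eq0.
have E : (n * denq q = numq q * m)%R.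
  apply/eqP; rewrite -(eqr_int rat) !intrM; apply/eqP.
  have mr : (m%:~R : rat) != 0 by rewrite intr_eq0.
  have dr : ((denq q)%:~R : rat) != 0 by rewrite intr_eq0 denq_eq0.
  have : (numq q)%:~R / (denq q)%:~R = n%:~R / m%:~R :> rat by rewrite divq_num_den.
  by move/eqP; rewrite eqr_div // => /eqP ->.
have := congr1 (fun z : int => logn p `|z|%N) E.
rewrite !abszM !lognM ?absz_gt0 ?denq_eq0 // => h.
by congr (_ ^ _); lia.
Qed.

Lemma padic_abs0 : padic_abs p 0 = 0. Proof. by rewrite /padic_abs eqxx. Qed.

Lemma padic_abs_gt0 q : q != 0 -> 0 < padic_abs p q.
Proof. by move=> q0; rewrite /padic_abs (negPf q0) exprz_gt0 // ltr0n prime_gt0. Qed.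

Let frac (q : rat) : q != 0 -> exists n m : int, [/\ n != 0, m != 0 & q = n%:~R / m%:~R].
Proof. by move=> q0; exists (numq q), (denq q); rewrite numq_eq0 denq_eq0 divq_num_den. Qed.

Lemma padic_absM x y : padic_abs p (x * y) = padic_abs p x * padic_abs p y.
Proof.
have [->|x0] := eqVneq x 0; first by rewrite mul0r padic_abs0 mul0r.
have [->|y0] := eqVneq y 0; first by rewrite mulr0 padic_abs0 mulr0.
have [n [m [n0 m0 ->]]] := frac x0; have [n' [m' [n'0 m'0 ->]]] := frac y0.
have -> : n%:~R / m%:~R * (n'%:~R / m'%:~R) = (n * n')%:~R / (m * m')%:~R :> rat.
  by rewrite !intrM mulf_div.
rewrite !padic_abs_frac ?mulf_neq0 // !abszM !lognM ?absz_gt0 // -expfzDr //.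
by congr (_ ^ _); lia.
Qed.

(** Over a common denominator this says that a power of p dividing both numerators divides their
    sum. *)
Lemma padic_abs_ultra x y : padic_abs p (x + y) <= Num.max (padic_abs p x) (padic_abs p y).
Proof.
have [->|x0] := eqVneq x 0; first by rewrite add0r le_max lexx orbT.
have [->|y0] := eqVneq y 0; first by rewrite addr0 le_max lexx.
have [->|xy0] := eqVneq (x + y) 0.
  by rewrite padic_abs0 le_max ltW // padic_abs_gt0.
have [n [m [n0 m0 xE]]] := frac x0; have [n' [m' [n'0 m'0 yE]]] := frac y0.
have mr : (m%:~R : rat) != 0 by rewrite intr_eq0.
have m'r : (m'%:~R : rat) != 0 by rewrite intr_eq0.
have xE' : x = (n * m')%:~R / (m * m')%:~R.
  by rewrite xE !intrM; field; rewrite mr m'r.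
have yE' : y = (n' * m)%:~R / (m * m')%:~R.
  by rewrite yE !intrM; field; rewrite mr m'r.
have xyE : x + y = (n * m' + n' * m)%:~R / (m * m')%:~R by rewrite xE' yE' rmorphD mulrDl.
have mm : m * m' != 0 by rewrite mulf_neq0.
have s0 : n * m' + n' * m != 0.
  by apply: contraNneq xy0 => h; rewrite xyE h mul0r.
rewrite xyE xE' yE'.
rewrite !padic_abs_frac ?mulf_neq0 //.
set a : int := n * m'; set b : int := n' * m; set M := logn p _.
have a0 : a != 0 by rewrite mulf_neq0.
have b0 : b != 0 by rewrite mulf_neq0.
have : (minn (logn p `|a|) (logn p `|b|) <= logn p `|(a + b)%R|)%N.
  rewrite -pfactor_dvdn ?absz_gt0 //.
  have : ((p ^ minn (logn p `|a|) (logn p `|b|))%N%:Z %| a + b)%Z.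
    apply: rpredD; rewrite dvdzE /= pfactor_dvdn ?absz_gt0 //.
      exact: geq_minl.
    exact: geq_minr.
  by rewrite dvdzE.
rewrite geq_min le_max => /orP[] h; apply/orP; [left|right];
  by apply: ler_weXz2l; rewrite ?p1 // lerD2l lerN2 lez_nat.
Qed.

Variable R : realType.

Definition padic_real (q : rat) : R := ratr (padic_abs p q).

Lemma padic_real_absval : is_absval padic_real /\ ultrametric padic_real.
Proof.
have u : ultrametric padic_real.
  move=> x y; rewrite /padic_real le_max !ler_rat -le_max; exact: padic_abs_ultra.
have ge0 x : 0 <= padic_real x.
  rewrite ler0q; have [->|x0] := eqVneq x 0; first by rewrite padic_abs0.
  exact/ltW/padic_abs_gt0.
split=> //; split=> // [x|x y|x y].
- split=> [|->]; last by rewrite /padic_real padic_abs0 rmorph0.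
  move/eqP; rewrite fmorph_eq0; apply: contraTeq => /padic_abs_gt0.
  by rewrite lt_def => /andP[].
- by rewrite /padic_real padic_absM rmorphM.
- by apply: le_trans (u x y) _; rewrite ge_max lerDl lerDr !ge0.
Qed.

Lemma padic_real_p : padic_real p%:R = (p%:R)^-1.
Proof.
have p0' : p%:Z != 0 by rewrite -lt0n prime_gt0.
have := padic_abs_frac p0' (oner_neq0 int); rewrite divr1 /padic_real => ->.
by rewrite /= logn1 logn_prime // eqxx sub0r exprN1 fmorphV rmorph_nat.
Qed.

End PadicAbs.

(** Interface to the places of K extending u, which hides the completion and the splitting field. By
    [le_degree], the local degree of a place is the number of embeddings inducing it. *)
Record local_embeddings (R : realType) (K : fieldExtType rat) (u : rat -> R) := LocalEmbeddings {
  le_field : fieldType;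
  le_abs : le_field -> R;
  le_rat : {rmorphism rat -> le_field};
  le_sigma : 'I_(\dim {:K}) -> {rmorphism K -> le_field};
  le_absP : is_absval le_abs;
  le_ratE : forall q, le_abs (le_rat q) = u q;
  le_unit : embmx le_sigma \in unitmx;
  le_places : forall v : K -> R, is_absval v -> (forall q : rat, v q%:A = u q) ->
    exists k, v = sigma_abs le_abs le_sigma k;
  le_degree : forall k0, local_degree (sigma_abs le_abs le_sigma k0) =
    #|[pred k | sigma_abs le_abs le_sigma k == sigma_abs le_abs le_sigma k0]| }.

Arguments le_field {R K u} l.
Arguments le_abs {R K u} l _.
Arguments le_rat {R K u} l.
Arguments le_sigma {R K u} l _.
Arguments le_absP {R K u} l.
Arguments le_unit {R K u} l.

Section Existence.

Variables (R : realType) (K : fieldExtType rat).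

(** F is the completion of Q at p, and the polynomial of [embeddings_exist] is split over an
    extension of F to which the absolute value extends. *)
Lemma padic_embeddings p : prime p ->
  exists le : local_embeddings K (padic_real p R), ultrametric (le_abs le).
Proof.
move=> pp; have [uP uu] := padic_real_absval pp R.
pose v := AbsvalOf uP.
have [iF [iFv _ iFdense]] := completion_embedding v.
have FP := completion_absP v.
have Fu : ultrametric (@completion_abs R _ v) by exact: completion_ultrametric.
have u1 : 0 < padic_real p R p%:R < 1.
  rewrite padic_real_p // invr_gt0 ltr0n prime_gt0 //= invf_lt1 ?ltr0n ?prime_gt0 //.
  by rewrite ltr1n prime_gt1.
have nt : exists q, 0 < completion_abs (v := v) q < 1 by exists (iF p%:R); rewrite iFv.
have [f f0 fE] := embeddings_exist K.
have [L [b [iota [rs [bP bu bi frs]]]]] : exists (L : fieldType) (b : L -> R)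
    (iota : {rmorphism completion v -> L}) (rs : seq L),
    [/\ is_absval b, ultrametric b, forall x, b (iota x) = completion_abs x &
        map_poly iota (map_poly iF f) %= \prod_(z <- rs) ('X - z%:P)].
  by apply: (@absval_splitting R (size f) _ _ _ FP Fu nt); rewrite ?map_poly_eq0 ?size_map_poly.
rewrite -map_poly_comp in frs.
have [sigma sU] := fE L (iota \o iF) rs frs.
have C : forall x : nat -> completion v,
  (forall e : R, 0 < e -> exists n0 : nat,
    forall k l : nat, (n0 <= k)%N -> (n0 <= l)%N -> b (iota (x k - x l)) < e) ->
  exists l, forall e : R, 0 < e -> \forall k \near \oo, b (iota (x k - l)) < e.
  move=> x xC; have [|l lP] := completion_complete (X := x).
    move=> e /xC[n0 h]; exists n0 => m n m0 n0'; rewrite -bi; exact: h.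
  by exists l => e /lP; apply: filterS => n; rewrite bi.
have D : forall (x : completion v) (e : R), 0 < e -> exists q, b (iota (iF q - x)) < e.
  by move=> x e e0; have [q h] := iFdense x e e0; exists q; rewrite bi.
have nt' : exists q, 0 < b (iota (iF q)) < 1 by exists p%:R; rewrite bi iFv.
have bE q : b (iota (iF q)) = padic_real p R q by rewrite bi iFv.
pose le := @LocalEmbeddings R K (padic_real p R) L b (iota \o iF) sigma bP bE sU.
unshelve eexists.
  apply: le => [w wP wu|k0].
    by apply: (places_sigma bP nt' sU wP) => q; rewrite bE.
  exact: (local_degree_sigma bP C D nt' sU).
exact: bu.
Qed.

Lemma real_complete (x : nat -> R) :
  (forall e : R, 0 < e -> exists n0 : nat,
    forall k l : nat, (n0 <= k)%N -> (n0 <= l)%N -> `|x k - x l| < e) ->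
  exists l, forall e : R, 0 < e -> \forall k \near \oo, `|x k - l| < e.
Proof.
move=> xC; have : cvgn x.
  apply: cauchy_cvg; apply/cauchy_exP => e e0.
  have [n0 h] := xC e e0; exists (x n0), n0 => // n /= n0n.
  by rewrite /ball /=; exact: h.
move=> /cvg_ex[l /cvgrPdist_lt h]; exists l => e e0.
by have := h e e0; apply: filterS => n; rewrite distrC.
Qed.

Lemma normc_absval : is_absval (@normc R).
Proof.
split=> [[x y]|x|x y|x y].
- exact: sqrtr_ge0.
- by split=> [/eq0_normc|->] //; rewrite normc0.
- exact: normcM.
- exact: le_normcD.
Qed.

Lemma normc_real (x : R) : normc (real_complex R x) = `|x|.
Proof. by rewrite /= expr0n addr0 sqrtr_sqr. Qed.

(** The same argument with F the real numbers and [R[i]] in place of the splitting field. *)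
Lemma complex_embeddings : exists sigma : 'I_(\dim {:K}) -> {rmorphism K -> R[i]},
  [/\ embmx sigma \in unitmx,
   forall v : K -> R, is_absval v -> (forall q : rat, v q%:A = ratr `|q|) ->
     exists k, v = sigma_abs (@normc R) sigma k,
   forall k (q : rat), sigma_abs (@normc R) sigma k q%:A = ratr `|q| &
   forall k0, local_degree (sigma_abs (@normc R) sigma k0) =
    #|[pred k | sigma_abs (@normc R) sigma k == sigma_abs (@normc R) sigma k0]| ].
Proof.
have [f f0 fE] := embeddings_exist K.
pose iF : {rmorphism rat -> R} := ratr.
pose iota : {rmorphism R -> R[i]} := real_complex R.
have [rs frs] := closed_field_poly_normal (map_poly (iota \o iF) f).
have [|sigma sU] := fE _ (iota \o iF) rs.
  by rewrite frs eqp_scale // lead_coef_eq0 map_poly_eq0.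
have aE x : normc (iota x) = `|x| by exact: normc_real.
have C : forall x : nat -> R,
  (forall e : R, 0 < e -> exists n0 : nat,
    forall k l : nat, (n0 <= k)%N -> (n0 <= l)%N -> normc (iota (x k - x l)) < e) ->
  exists l, forall e : R, 0 < e -> \forall k \near \oo, normc (iota (x k - l)) < e.
  move=> x xC; have [|l lP] := @real_complete x.
    by move=> e /xC[n0 h]; exists n0 => m n m0 n0'; rewrite -aE; exact: h.
  by exists l => e /lP; apply: filterS => n; rewrite aE.
have D : forall (x : R) (e : R), 0 < e -> exists q, normc (iota (iF q - x)) < e.
  move=> x e e0; have [|q hq] := @rat_in_itvoo R x (x + e); first by rewrite ltrDl.
  have /andP[h1 h2] : x < ratr q < x + e by move: hq; rewrite in_itv.
  exists q.
  by rewrite aE ltr_norml; apply/andP; split; rewrite /iF /=; lra.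
have bE q : normc (iota (iF q)) = ratr `|q|.
  by rewrite -[LHS]/(normc (real_complex R (ratr q))) normc_real ratr_norm.
have nt : exists q, 0 < normc (iota (iF q)) < 1.
  by exists 2^-1; rewrite bE gtr0_norm ?invr_gt0 // fmorphV rmorph_nat; lra.
exists sigma; split=> //.
- by move=> v vP vu; apply: (places_sigma normc_absval nt sU vP) => q; rewrite bE.
- by move=> k q; rewrite (sigma_abs_rat (normc (R:=R)) iF iota).
- by move=> k0; exact: (local_degree_sigma normc_absval C D nt sU).
Qed.

End Existence.

(** * Determinants *)

Lemma det_mxdiag (F : comNzRingType) p (p_ : 'I_p -> nat) (B : forall i, 'M[F]_(p_ i)) :
  \det (\mxdiag_i B i) = \prod_i \det (B i).
Proof.
elim: p p_ B => [|p ih] p_ B.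
  by move: (\mxdiag_i B i); rewrite !big_ord0 => M; rewrite det_mx00.
rewrite [RHS]big_ord_recl -ih mxdiag_recl.
by case: _ / mxsize_recl; rewrite ?castmx_id det_ublock.
Qed.

Section CauchyBinet.

Variable F : fieldType.

Definition minor_rows N J (k : 'I_('C(N, J))) : J.-tuple 'I_N :=
  enum_val (cast_ord (esym (card_ltn_sorted_tuples J N)) k).

Lemma grassmannE N J (X : 'M[F]_(N, J)) k :
  grassmann X 0 k = \det (rowsub (tnth (minor_rows k)) X).
Proof. by rewrite mxE. Qed.

Lemma minor_rows_sorted N J k : sorted ltn (map val (@minor_rows N J k)).
Proof. by have := enum_valP (cast_ord (esym (card_ltn_sorted_tuples J N)) k); rewrite inE. Qed.

Lemma minor_rows_inj N J : injective (@minor_rows N J).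
Proof. by move=> k l /enum_val_inj/cast_ord_inj. Qed.

Lemma minor_rows_surj N J (t : J.-tuple 'I_N) : sorted ltn (map val t) ->
  exists k, minor_rows k = t.
Proof.
move=> ts; have tin : t \in [set t : J.-tuple 'I_N | sorted ltn (map val t)]%SET by rewrite inE.
exists (cast_ord (card_ltn_sorted_tuples J N) (enum_rank_in tin t)).
by rewrite /minor_rows cast_ordK enum_rankK_in.
Qed.

Lemma minor_rows_uniq N J (k : 'I_('C(N, J))) : uniq (minor_rows k).
Proof.
rewrite -(map_inj_uniq val_inj); apply: sorted_uniq (minor_rows_sorted k).
  by move=> x y z; apply: ltn_trans.
by move=> x; rewrite /= ltnn.
Qed.

Lemma minor_rows_perm N J (f : {ffun 'I_J -> 'I_N}) : injective f ->
  exists k (s : 'S_J), forall i, f i = tnth (minor_rows k) (s i).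
Proof.
move=> fi; pose t := [tuple f i | i < J].
have tu : uniq t by rewrite map_inj_uniq // enum_uniq.
pose leI (x y : 'I_N) := (x <= y)%N.
have srt : sorted ltn (map val (sort leI t)).
  rewrite ltn_sorted_uniq_leq map_inj_uniq ?sort_uniq ?tu /=; last exact: val_inj.
  by rewrite sorted_map; apply: sort_sorted => x y; exact: leq_total.
have [k kE] := @minor_rows_surj N J (sort_tuple leI t) srt.
have pe : perm_eq t (minor_rows k) by rewrite kE perm_sym perm_sort.
have /tuple_permP[s sE] := pe.
exists k, s => i; have := congr1 (fun u : J.-tuple 'I_N => tnth u i) (val_inj sE).
by rewrite !tnth_mktuple.
Qed.

(** A repeated row gives 0; distinct rows are, up to a permutation, an increasing choice. *)
Lemma det_rowsub_minor N J (X : 'M[F]_(N, J)) (f : 'I_J -> 'I_N) :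
  \det (rowsub f X) = 0 \/
  exists k (e : bool), \det (rowsub f X) = (-1) ^+ e * grassmann X 0 k.
Proof.
have [/injectiveP fi|/injectivePn[i [j ij fij]]] := boolP (injectiveb f); last first.
  left; apply: (determinant_alternate ij) => l; by rewrite !mxE fij.
right; have [|k [s sE]] := @minor_rows_perm N J [ffun i => f i].
  by move=> i j; rewrite !ffunE; exact: fi.
exists k, (odd_perm s); rewrite grassmannE -det_perm -det_mulmx -row_permE.
by congr (\det _); apply/matrixP => i j; rewrite !mxE -sE ffunE.
Qed.

(** Expanding the products gives a sum over all maps f from J to N. Non-injective maps contribute 0,
    and an injective one is uniquely an increasing tuple composed with a permutation; the sum over
    permutations is the minor of A. *)
Lemma cauchy_binet N J (A : 'M[F]_(J, N)) (B : 'M[F]_(N, J)) :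
  \det (A *m B) = \sum_k grassmann A^T 0 k * grassmann B 0 k.
Proof.
pose G (f : {ffun 'I_J -> 'I_N}) := (\prod_i A i (f i)) * \det (rowsub f B).
have -> : \det (A *m B) = \sum_f G f.
  rewrite /determinant; under [RHS]eq_bigr => f _ do rewrite /G big_distrr /=.
  rewrite [RHS]exchange_big /=; apply: eq_bigr => s _.
  under eq_bigr => i _ do rewrite mxE.
  rewrite bigA_distr_bigA big_distrr /=; apply: eq_bigr => f _.
  rewrite mulrCA; congr (_ * _); rewrite -big_split /=; apply: eq_bigr => i _.
  by rewrite mxE.
pose h (p : 'I_('C(N, J)) * 'S_J) : {ffun 'I_J -> 'I_N} := [ffun i => tnth (minor_rows p.1) (p.2 i)].
have tinj k : injective (tnth (@minor_rows N J k)) by apply/tuple_uniqP; exact: minor_rows_uniq.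
have hinj : injective h.
  move=> [k s] [k' s'] hh.
  have hi i : tnth (minor_rows k) (s i) = tnth (minor_rows k') (s' i).
    by have := congr1 (fun f : {ffun 'I_J -> 'I_N} => f i) hh; rewrite !ffunE.
  have kk : k = k'.
    apply: minor_rows_inj; apply: val_inj; apply: (inj_map val_inj).
    apply: (irr_sorted_eq ltn_trans ltnn) => [||x]; try exact: minor_rows_sorted.
    apply/mapP/mapP => -[y /tnthP[i ->] ->].
      exists (tnth (minor_rows k) i) => //.
      by rewrite -(permKV s i) hi mem_tnth.
    exists (tnth (minor_rows k') i) => //.
    by rewrite -(permKV s' i) -hi mem_tnth.
  by rewrite -kk in hi *; congr (_, _); apply/permP => i; apply: (tinj k).
have -> : \sum_f G f = \sum_(f in h @: [set: _]%SET) G f.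
  rewrite [RHS]big_mkcond /=; apply: eq_bigr => f _; case: ifPn => // fh.
  have [/injectiveP fi|/injectivePn[i [j ij fij]]] := boolP (injectiveb f).
    case/negP: fh; have [k [s sE]] := minor_rows_perm fi.
    by apply/imsetP; exists (k, s); rewrite ?inE //; apply/ffunP => i; rewrite ffunE.
  rewrite /G [X in _ * X](determinant_alternate ij) ?mulr0 // => l; by rewrite !mxE fij.
rewrite big_imset /=; last by move=> p q _ _; exact: hinj.
rewrite (eq_bigl xpredT) => [|p]; last by rewrite inE.
rewrite -(pair_big xpredT xpredT (fun k s => G (h (k, s)))) /=.
apply: eq_bigr => k _; rewrite !grassmannE -det_tr big_distrl /=.
apply: eq_bigr => s _; rewrite /G.
have -> : \det (rowsub (h (k, s)) B) = (-1) ^+ s * \det (rowsub (tnth (minor_rows k)) B).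
  rewrite -det_perm -det_mulmx -row_permE; congr (\det _); apply/matrixP => i j.
  by rewrite !mxE ffunE.
rewrite mulrA; congr (_ * _); rewrite mulrC; congr (_ * _); apply: eq_bigr => i _.
by rewrite !mxE ffunE.
Qed.

Lemma grassmann_neq0 N J (X : 'M[F]_(N, J)) : \rank X = J -> grassmann X != 0.
Proof.
move=> rX; have rf : row_full X by rewrite /row_full rX.
pose f := fullrankfun rf.
have dn0 : \det (rowsub f X) != 0.
  rewrite -unitfE -unitmxE -row_full_unit /row_full.
  have := mxrank_fullrowsub rf; by move->.
have [d0|[k [e dE]]] := det_rowsub_minor X f; first by rewrite d0 eqxx in dn0.
by apply/rV0Pn; exists k; apply: contraNneq dn0 => g0; rewrite dE g0 mulr0.
Qed.

End CauchyBinet.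

Lemma map_grassmann (F L : fieldType) (s : {rmorphism F -> L}) N J (X : 'M[F]_(N, J)) :
  grassmann (map_mx s X) = map_mx s (grassmann X).
Proof.
apply/rowP => k; rewrite [RHS]mxE !grassmannE -det_map_mx; congr (\det _).
by apply/matrixP => i j; rewrite !mxE.
Qed.

(** * Cholesky factorization and Hadamard's inequality *)

Section Cholesky.

Variable R : rcfType.

Lemma cholesky n (G : 'M[R]_n) : G^T = G ->
  (forall x : 'rV[R]_n, x != 0 -> 0 < (x *m G *m x^T) 0 0) ->
  exists2 L : 'M[R]_n, G = L *m L^T & is_trig_mx L.
Proof.
elim: n G => [|n ih] G GT Gp.
  by exists 0; [apply/matrixP => -[]|apply/is_trig_mxP => -[]].
rewrite -[n.+1]/(1 + n)%N in G GT Gp *.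
have [a [b [G' GE]]] : exists (a : R) (b : 'cV[R]_n) (G' : 'M[R]_n),
    G = block_mx a%:M b^T b G' /\ G'^T = G'.
  exists (ulsubmx G 0 0), (dlsubmx G), (drsubmx G).
  have := GT; rewrite -{1 2}(submxK G) tr_block_mx => /eq_block_mx[_ h1 _ h3].
  by rewrite -mx11_scalar h1 submxK h3.
case: GE => GE G'T.
have a0 : 0 < a.
  have := Gp (row_mx 1%:M 0); rewrite GE tr_row_mx !mul_row_block mul_row_col.
  rewrite !mul1mx !mul0mx !addr0 trmx0 trmx1 mulmx0 addr0 mulmx1 mxE eqxx mulr1n; apply.
  apply/negP => /eqP/(congr1 lsubmx); rewrite row_mxKl => /matrixP/(_ 0 0).
  by rewrite !mxE /= => /eqP; rewrite oner_eq0.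
pose S := G' - a^-1 *: (b *m b^T).
have ST : S^T = S by rewrite /S linearB linearZ /= trmx_mul trmxK G'T.
have Sp (x : 'rV[R]_n) : x != 0 -> 0 < (x *m S *m x^T) 0 0.
  (* This y minimizes the form at (y, x), and the minimum is the value at x of the Schur complement
     S. *)
  move=> x0; pose y : 'rV[R]_1 := - a^-1 *: (x *m b).
  have := Gp (row_mx y x); rewrite GE tr_row_mx mul_row_block mul_row_col => h.
  have : row_mx y x != 0.
    by apply: contraNneq x0 => /(congr1 rsubmx); rewrite row_mxKr linear0 => ->.
  move=> /h; congr (0 < _ _ _).
  have -> : y *m a%:M + x *m b = 0.
    by rewrite mul_mx_scalar /y scalerA mulrN mulfV ?lt0r_neq0 // scaleN1r addNr.
  rewrite mul0mx add0r /S mulmxBr; congr (_ *m _).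
  by rewrite /y -scalemxAl addrC scaleNr -scalemxAr mulmxA.
have [L SE Lt] := ih S ST Sp.
pose q := Num.sqrt a.
have q0 : 0 < q by rewrite sqrtr_gt0.
have qq : q * q = a by rewrite -expr2 sqr_sqrtr // ltW.
exists (block_mx q%:M 0 (q^-1 *: b) L); last first.
  by rewrite is_trig_block_mx // eqxx Lt scalar_mx_is_trig.
rewrite tr_block_mx mulmx_block trmx0 !mulmx0 !mul0mx !addr0 GE.
rewrite tr_scalar_mx -scalar_mxM qq linearZ /= mul_scalar_mx mul_mx_scalar !scalerA.
rewrite mulfV ?lt0r_neq0 // !scale1r -scalemxAr -scalemxAl scalerA -invfM qq -SE.
by rewrite addrC /S subrK.
Qed.

(** In G = L L^T with L triangular, det G is the product of the (L i i)^2, and G i i is a sum of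
    squares containing (L i i)^2. *)
Lemma hadamard n (G : 'M[R]_n) : G^T = G ->
  (forall x : 'rV[R]_n, x != 0 -> 0 < (x *m G *m x^T) 0 0) ->
  0 < \det G /\ \det G <= \prod_i G i i.
Proof.
move=> GT Gp; have [L GE Lt] := cholesky GT Gp.
have dE : \det G = \prod_i (L i i) ^+ 2.
  rewrite GE det_mulmx det_tr det_trig // -big_split /=.
  by apply: eq_bigr => i _; rewrite expr2.
have Lu : \det G != 0.
  apply/negP => /det0P[x x0 xG]; have := Gp x x0; rewrite xG mul0mx mxE ltxx //.
split.
  by rewrite lt_def Lu dE; apply: prodr_ge0 => i _; exact: sqr_ge0.
rewrite dE; apply: ler_prod => i _; rewrite sqr_ge0 /= GE mxE (bigD1 i) //= !mxE.
by rewrite -expr2 lerDl; apply: sumr_ge0 => j _; rewrite mxE -expr2 sqr_ge0.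
Qed.

End Cholesky.

(** * Lattice points *)

Lemma common_denominator m n (A : 'M[rat]_(m, n)) :
  exists (c : int) (B : 'M[int]_(m, n)), c != 0 /\ map_mx intr B = c%:~R *: A.
Proof.
pose c := \prod_i \prod_j denq (A i j).
have c0 : c != 0.
  by apply/prodf_neq0 => i _; apply/prodf_neq0 => j _; rewrite denq_eq0.
have ex i j : exists z : int, z%:~R = c%:~R * A i j.
  have [z cE] : exists z, c = denq (A i j) * z.
    by rewrite /c (bigD1 i) //= (bigD1 j) //= -mulrA; eexists.
  by exists (numq (A i j) * z); rewrite cE !intrM numqE; ring.
have [f fP] := choice (fun p : 'I_m * 'I_n => ex p.1 p.2).
exists c, (\matrix_(i, j) f (i, j)); split=> //.
by apply/matrixP => i j; rewrite !mxE (fP (i, j)).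
Qed.

Lemma map_intr_unit n (U : 'M[int]_n) : U \in unitmx -> map_mx (intr : int -> rat) U \in unitmx.
Proof. by rewrite !unitmxE => h; rewrite det_map_mx rmorph_unit. Qed.

Lemma map_intr_inj m n : injective (fun A : 'M[int]_(m, n) => map_mx (intr : int -> rat) A).
Proof.
by move=> A B /matrixP AB; apply/matrixP => i j; have := AB i j; rewrite !mxE => /intr_inj.
Qed.

(* The integral points of the row space of A form the lattice Z^k B, which is a
   direct summand of Z^n: D is a left inverse of B on it. *)
Lemma integral_points_basis m n (A : 'M[rat]_(m, n)) :
  exists (B : 'M[int]_(\rank A, n)) (D : 'M[int]_(n, \rank A)),
    [/\ B *m D = 1%:M, (map_mx intr B <= A)%MS &
     forall x : 'rV[rat]_n, (x <= A)%MS -> x = x *m map_mx intr D *m map_mx intr B].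
Proof.
have [c [A' [c0 A'E]]] := common_denominator A.
have [L Lu [U Uu [d _ SE]]] := int_Smith_normal_form A'.
set D0 := \matrix_(i, j) _ in SE.
(* J indexes the nonzero elementary divisors. Over Q they may be replaced by 1, so the rows of U
   indexed by J span the row space of A; being rows of a unimodular matrix, they form the basis. *)
pose J := [set j : 'I_n | (j < m)%N && (d`_j != 0)]%SET.
pose E0 : 'M[rat]_n := \matrix_(i, j) ((i == j) && (i \in J))%:R.
have Lr := map_intr_unit Lu; have Ur := map_intr_unit Uu.
pose D' : 'M[rat]_(m, n) := map_mx intr D0.
have AE : (A :=: D' *m map_mx intr U)%MS.
  have cq : (c%:~R : rat) != 0 by rewrite intr_eq0.
  apply: eqmx_trans (eqmx_sym (eqmx_scale A cq)) _.
  rewrite -A'E SE !map_mxM -mulmxA.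
  by apply: eqmxMfull; rewrite row_full_unit.
have D'E i j : D' i j = (d`_i)%:~R *+ (i == j :> nat).
  by rewrite !mxE rmorphMn.
have D'J j : j \notin J -> forall i, D' i j = 0.
  rewrite inE negb_and => jJ i; rewrite D'E; case: eqP => [ij|//].
  by move: jJ; rewrite -ij ltn_ord /= negbK => /eqP ->.
have ED : (E0 <= D')%MS.
  apply/row_subP => j; have [jJ|jJ] := boolP (j \in J); last first.
    have -> : row j E0 = 0 by apply/rowP => k; rewrite !mxE (negPf jJ) andbF.
    exact: sub0mx.
  have := jJ; rewrite inE => /andP[jm dj].
  have dq : ((d`_j)%:~R : rat) != 0 by rewrite intr_eq0.
  have -> : row j E0 = (d`_j)%:~R^-1 *: row (Ordinal jm) D'.
    apply/rowP => k; rewrite [RHS]mxE [X in _ * X]mxE D'E !mxE jJ andbT /= val_eqE.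
    by case: eqP => _; rewrite ?mulr0 // mulr1n mulVf.
  by rewrite scalemx_sub // row_sub.
have DE : (D' <= E0)%MS.
  have -> : D' = D' *m E0.
    apply/matrixP => i j; rewrite [RHS]mxE (bigD1 j) //= big1 ?addr0 => [|k kj].
      rewrite [E0 j j]mxE eqxx /=; have [jJ|jJ] := boolP (j \in J); first by rewrite mulr1.
      by rewrite D'J // mul0r.
    by rewrite [E0 k j]mxE (negPf kj) mulr0.
  exact: submxMl.
have rJ : \rank A = #|J|.
  rewrite AE mxrankMfree ?row_free_unit //.
  have -> : \rank D' = \rank E0 by apply/eqP; rewrite eqn_leq !mxrankS.
  pose U' : 'M[rat]_(n, #|J|) := \matrix_(k, j) (k == enum_val j)%:R.
  have UU : U'^T *m U' = 1%:M.
    apply/matrixP => j l; rewrite !mxE (bigD1 (enum_val j)) //= !mxE eqxx mul1r.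
    rewrite big1 ?addr0 => [|k kj]; first by rewrite (inj_eq enum_val_inj).
    by rewrite !mxE (negPf kj) mul0r.
  have E0U : E0 *m U' = U'.
    apply/matrixP => k j; rewrite mxE (bigD1 k) //= !mxE eqxx big1 ?addr0 => [|l lk].
      rewrite /=; case: eqP => [->|_]; last by rewrite mulr0.
      by rewrite enum_valP mulr1.
    by rewrite !mxE eq_sym (negPf lk) mul0r.
  have E0UU : E0 = U' *m U'^T.
    apply/matrixP => k l; rewrite !mxE; have [kJ|kJ] := boolP (k \in J); last first.
      rewrite andbF big1 // => j _; rewrite !mxE; case: eqP => [kj|]; last by rewrite mul0r.
      by move: kJ; rewrite kj enum_valP.
    rewrite (bigD1 (enum_rank_in kJ k)) //= big1 => [|j jk].
      by rewrite !mxE enum_rankK_in // eqxx mul1r addr0 eq_sym andbT.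
    rewrite !mxE; case: eqP => [kj|_]; last by rewrite mul0r.
    by case/eqP: jk; apply: enum_val_inj; rewrite enum_rankK_in.
  apply/eqP; rewrite eqn_leq {1}E0UU (leq_trans (mxrankM_maxl _ _)) ?rank_leq_col //=.
  by rewrite -{1}(mxrank1 rat #|J|) -UU -E0U mulmxA (leq_trans (mxrankM_maxl _ _)) // mxrankM_maxr.
pose f (i : 'I_(\rank A)) : 'I_n := enum_val (cast_ord rJ i).
have fi : injective f by move=> i j /enum_val_inj/cast_ord_inj.
have fJ i : f i \in J by exact: enum_valP.
pose E : 'M[int]_(\rank A, n) := \matrix_(i, j) (j == f i)%:R.
have EE : E *m E^T = 1%:M.
  apply/matrixP => i j; rewrite !mxE (bigD1 (f i)) //= !mxE eqxx mul1r.
  rewrite big1 ?addr0 => [|k kj]; first by rewrite (inj_eq fi).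
  by rewrite !mxE (negPf kj) mul0r.
exists (E *m U), (invmx U *m E^T); split.
- by rewrite -mulmxA (mulmxA U) mulmxV // mul1mx EE.
- rewrite AE map_mxM submxMr //; apply: submx_trans ED.
  apply/row_subP => i; have -> : row i (map_mx intr E) = row (f i) E0.
    by apply/rowP => j; rewrite !mxE fJ andbT eq_sym; case: eqP.
  exact: row_sub.
- move=> x; rewrite AE => /submxP[y ->]; rewrite !map_mxM !mulmxA.
  congr (_ *m _); rewrite -[y *m D' *m _ *m _]mulmxA -map_mxM mulmxV // map_mx1 mulmx1.
  have -> : y *m D' *m map_mx intr E^T *m map_mx intr E = y *m D' *m (map_mx intr (E^T *m E)).
    by rewrite map_mxM !mulmxA.
  apply/rowP => j; rewrite [RHS]mxE; have [jJ|jJ] := boolP (j \in J); last first.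
    rewrite [LHS]mxE big1 => [|i _]; last by rewrite D'J // mulr0.
    rewrite big1 // => k _; rewrite [X in _ * X](_ : _ = 0) ?mulr0 // !mxE.
    rewrite big1 // => i _; rewrite !mxE.
    have /negPf -> : j != f i by apply: contraNneq jJ => ->.
    by rewrite mulr0.
  have [i0 ji0] : exists i0, j = f i0.
    exists (cast_ord (esym rJ) (enum_rank_in jJ j)).
    by rewrite /f cast_ordKV enum_rankK_in.
  rewrite (bigD1 j) //= big1 ?addr0 => [|k kj]; last first.
    rewrite [X in _ * X](_ : _ = 0) ?mulr0 // !mxE big1 // => i _.
    rewrite !mxE; case: eqP => [ki|]; last by rewrite mul0r.
    by rewrite -ki eq_sym (negPf kj) mulr0.
  rewrite [X in _ * X](_ : _ = 1) ?mulr1 // !mxE (bigD1 i0) //= !mxE ji0 eqxx.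
  rewrite big1 ?addr0 // => i ii0; rewrite !mxE (inj_eq fi) eq_sym (negPf ii0) mul0r //.
Qed.

(** In the Smith form L D U of A, the class of p is given by the residues of the coordinates of p
    U^-1 modulo the elementary divisors, whose product is |det A|. *)
Lemma lattice_classes r (A : 'M[int]_r) : \det A != 0 ->
  exists (T : finType) (cl : 'rV[int]_r -> T), #|T| = `|\det A|%N /\
    forall p q, cl p = cl q -> exists z : 'rV[int]_r, p - q = z *m A.
Proof.
move=> dA; have [L Lu [U Uu [d _ SE]]] := int_Smith_normal_form A.
set D := \matrix_(i, j) _ in SE.
pose e (i : 'I_r) : int := d`_i.
have DE : D = diag_mx (\row_i e i) by apply/matrixP => i j; rewrite !mxE val_eqE.
have u1 (V : 'M[int]_r) : V \in unitmx -> `|\det V|%N = 1%N.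
  by rewrite unitmxE => /orP[] /eqP ->.
have dd : `|\det A|%N = (\prod_i `|e i|)%N.
  rewrite SE !det_mulmx !abszM (u1 L Lu) (u1 U Uu) mul1n muln1 DE det_diag.
  by rewrite (big_morph absz abszM absz1); apply: eq_bigr => i _; rewrite mxE.
have d0 (i : 'I_r) : e i != 0.
  apply: contraNneq dA => di; rewrite -absz_eq0 dd (bigD1 i) //= di mul0n //.
pose T := {dffun forall i : 'I_r, 'I_(`|e i|)}.
have lt i (y : int) : (`|(y %% e i)%Z| < `|e i|)%N.
  by have := ltz_mod y (d0 i); rewrite -ltz_nat gez0_abs ?modz_ge0 // abszE.
pose cl (p : 'rV[int]_r) : T := [ffun i => Ordinal (lt i ((p *m invmx U) 0 i))].
exists T, cl; split.
  by rewrite card_dep_ffun foldrE big_map big_enum /= dd; apply: eq_bigr => i _; rewrite card_ord.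
move=> p q pq.
have md i : ((p *m invmx U) ord0 i = (q *m invmx U) ord0 i %[mod e i])%Z.
  have := congr1 (fun f : T => val (f i)) pq; rewrite !ffunE /= => h.
  by rewrite -[LHS]gez0_abs ?modz_ge0 // h gez0_abs ?modz_ge0.
have dv i : exists z, ((p - q) *m invmx U) 0 i = z * e i.
  have /eqP := md i; rewrite eqz_mod_dvd => /dvdzP[z zE]; exists z.
  by rewrite mulmxBl -zE !mxE.
have [w wE] := choice dv.
exists ((\row_i w i) *m invmx L).
rewrite SE DE !mulmxA mulmxKV // -[LHS](mulmxKV Uu); congr (_ *m _).
by apply/rowP => i; rewrite wE mul_mx_diag !mxE.
Qed.

(** Some fibre has at least the average size; the product form avoids a division. *)
Lemma pigeonhole (G T : finType) (f : G -> T) : (0 < #|G|)%N ->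
  exists t, (#|G| <= #|T| * #|[pred g | f g == t]|)%N.
Proof.
move=> G0; apply: contrapT => /forallNP h.
have : (#|G| * #|T| < #|T| * #|G|)%N; last by rewrite mulnC ltnn.
have [g _] : exists g : G, g \in G by apply/card_gt0P.
have hs : (\sum_(t : T) #|T| * #|[pred g | f g == t]| < \sum_(t : T) #|G|)%N.
  have lt t : (#|T| * #|[pred g | f g == t]| < #|G|)%N by rewrite ltnNge; apply/negP; exact: h.
  rewrite (bigD1 (f g)) //= [X in (_ < X)%N](bigD1 (f g)) //= -addSn leq_add //.
  by apply: leq_sum => t _; exact: ltnW.
move: hs; rewrite sum_nat_const -big_distrr /= mulnC.
suff -> : (\sum_t #|[pred g | f g == t]| = #|G|)%N by rewrite mulnC.
rewrite -sum1_card (partition_big f xpredT) //=; apply: eq_bigr => t _.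
by rewrite -sum1_card; apply: eq_bigl => x; rewrite !inE.
Qed.

(** In a Z-basis of the integral points of the subspace there are [\rank A] coordinates, and two
    points with the same coordinates modulo M differ by M times an integral point. *)
Lemma count_mod m n (A : 'M[rat]_(m, n)) k (M : nat) (S : seq 'rV[int]_n) : uniq S ->
  (\rank A <= k)%N -> (0 < M)%N ->
  (forall x, x \in S -> (map_mx intr x <= A)%MS) ->
  (forall x y z, x \in S -> y \in S -> x - y = M%:Z *: z -> x = y) -> (size S <= M ^ k)%N.
Proof.
move=> uS rk M0 SA SM; have [B [D [_ _ BD]]] := integral_points_basis A.
apply: (@leq_trans (M ^ \rank A)); last by rewrite leq_pexp2l.
have lt (y : int) : (`|(y %% M%:Z)%Z| < M)%N.
  by rewrite -ltz_nat gez0_abs ?modz_ge0 ?ltz_pmod // -lt0n.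
pose key (x : 'rV[int]_n) : {ffun 'I_(\rank A) -> 'I_M} := [ffun i => Ordinal (lt ((x *m D) 0 i))].
have -> : (M ^ \rank A)%N = #|{ffun 'I_(\rank A) -> 'I_M}| by rewrite card_ffun !card_ord.
rewrite -(size_map key) cardE; apply: uniq_leq_size; last by move=> f _; rewrite mem_enum.
rewrite map_inj_in_uniq // => x y xS yS xy.
have md i : ((x *m D) ord0 i = (y *m D) ord0 i %[mod M%:Z])%Z.
  have := congr1 (fun f : {ffun 'I_(\rank A) -> 'I_M} => val (f i)) xy; rewrite !ffunE /= => h.
  have M0' : M%:Z != 0 by rewrite -lt0n.
  by rewrite -[LHS]gez0_abs ?modz_ge0 // h gez0_abs ?modz_ge0.
have dv i : exists z, ((x - y) *m D) 0 i = M%:Z * z.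
  have /eqP := md i; rewrite eqz_mod_dvd => /dvdzP[z zE]; exists z.
  by rewrite mulmxBl mulrC -zE !mxE.
have [w wE] := choice dv.
apply: (SM x y ((\row_i w i) *m B)) => //.
have E z : z \in S -> z = z *m D *m B.
  by move=> /SA/BD h; apply: map_intr_inj; rewrite !map_mxM.
rewrite (E x xS) (E y yS) -!mulmxBl scalemxAl; congr (_ *m _).
by apply/rowP => i; rewrite wE !mxE.
Qed.

(** If S spans, V is chosen with |det V| maximal among r-tuples from S. By Cramer the coordinates of
    any x in S with respect to V are ratios of such determinants, hence lie in [-1, 1]. So x is
    determined by its class modulo the rows of V and by the floors of its coordinates, which take
    three values. *)
Lemma count_span r (S : seq 'rV[int]_r) : uniq S ->
  (exists V : 'M[int]_r, [/\ forall i, row i V \in S, \det V != 0 &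
     (size S <= 3 ^ r * `|\det V|)%N]) \/
  (exists A : 'M[rat]_r, (\rank A < r)%N /\ forall x, x \in S -> (map_mx intr x <= A)%MS).
Proof.
move=> uS; pose Vf (f : {ffun 'I_r -> 'I_(size S)}) : 'M[int]_r := \matrix_i S`_(f i).
have VfS f i : row i (Vf f) \in S by rewrite rowK mem_nth.
have [f0 f00|allz] := pickP (fun f => \det (Vf f) != 0); last first.
  right; pose Q : 'M[rat]_(size S, r) := \matrix_i map_mx intr S`_i.
  exists (<<Q>>)%MS; rewrite genmxE; split; last first.
    move=> x xS; rewrite genmxE.
    have xi : (index x S < size S)%N by rewrite index_mem.
    have -> : map_mx intr x = row (Ordinal xi) Q by rewrite rowK nth_index.
    exact: row_sub.
  rewrite ltn_neqAle rank_leq_col andbT; apply/negP => /eqP rQ.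
  have rf : row_full Q by rewrite /row_full rQ.
  have := mxrank_fullrowsub rf; set g := fullrankfun rf => rg.
  have /negP := negbT (allz [ffun i => g i]); apply.
  rewrite -(intr_eq0 rat) -det_map_mx -unitfE -unitmxE -row_full_unit /row_full.
  rewrite -[X in _ == X]rg; apply/eqP; congr mxrank.
  by apply/matrixP => i j; rewrite !mxE ffunE.
left; have [f fn0 fmax] : exists2 f, \det (Vf f) != 0 &
    forall g, (`|\det (Vf g)| <= `|\det (Vf f)|)%N.
  case: (arg_maxnP (P := xpredT) (fun g => `|\det (Vf g)|%N) (i0 := f0)) => // f _ fm.
  exists f => [|g]; last exact: fm.
  by rewrite -absz_gt0 (leq_trans _ (fm f0 isT)) // absz_gt0.
exists (Vf f); split=> //; set V := Vf f in fn0 fmax *.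
have [T [cl [cT clP]]] := lattice_classes fn0.
pose Vr : 'M[rat]_r := map_mx intr V.
have Vu : Vr \in unitmx by rewrite unitmxE unitfE det_map_mx intr_eq0.
pose t (x : 'rV[int]_r) : 'rV[rat]_r := map_mx intr x *m invmx Vr.
have tV x : t x *m Vr = map_mx intr x by rewrite mulmxKV.
have t1 x j : x \in S -> `|t x 0 j| <= 1.
  move=> xS.
  pose W : 'M[int]_r := \matrix_i (if i == j then x else row i V).
  have xi : (index x S < size S)%N by rewrite index_mem.
  have WE : W = Vf [ffun i => if i == j then Ordinal xi else f i].
    apply/row_matrixP => i; rewrite !rowK ffunE; case: eqP => _ //=.
    by rewrite nth_index.
  have dW : (x *m \adj V) 0 j = \det W.
    rewrite (expand_det_row W j) mxE; apply: eq_bigr => l _; rewrite !mxE eqxx; congr (_ * _).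
    rewrite /cofactor; congr (_ * \det _); apply/matrixP => k k'; rewrite !mxE.
    by rewrite eq_sym (negPf (neq_lift _ _)) !mxE.
  have tE : t x 0 j = (\det W)%:~R / (\det V)%:~R.
    have -> : t x = (\det V)%:~R^-1 *: map_mx intr (x *m \adj V).
      rewrite /t /invmx Vu det_map_mx -scalemxAr -map_mx_adj map_mxM //.
    by rewrite !mxE -dW mulrC !mxE.
  rewrite tE normrM normfV ler_pdivrMr ?normr_gt0 ?intr_eq0 // mul1r.
  rewrite -!intr_norm ler_int -!abszE lez_nat WE; exact: fmax.
(* The floor is -1, 0 or 1; the shift makes it an element of ['I_3]. *)
pose fj (x : 'rV[int]_r) j : int := Num.floor (t x 0 j) + 1.
have fl x j : x \in S -> (`|fj x j| < 3)%N.
  move=> /(t1 _ j); rewrite ler_norml => /andP[h1 h2].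
  have f1 : -1 <= Num.floor (t x 0 j) by rewrite floor_ge_int rmorphN.
  have f2 : Num.floor (t x 0 j) < 2.
    by rewrite floor_lt_int (le_lt_trans h2).
  by rewrite /fj; move: f1 f2; clear; lia.
pose key (x : 'rV[int]_r) : T * {ffun 'I_r -> 'I_3} :=
  (cl x, [ffun j => Ordinal (ltn_pmod `|fj x j| (isT : 0 < 3)%N)]).
have kE x j : nat_of_ord ((key x).2 j) = (`|fj x j| %% 3)%N by rewrite ffunE.
have k1 x : (key x).1 = cl x by [].
have tB x y z : x - y = z *m V -> t x - t y = map_mx intr z.
  by move=> zE; rewrite /t -mulmxBl -map_mxB zE map_mxM mulmxK.
have fjE x j : fj x j = Num.floor (t x 0 j) + 1 by [].
clearbody key fj t.
have kinj : {in S &, injective key}.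
  move=> x y xS yS kxy.
  have [z zE] : exists z, x - y = z *m V by apply: clP; rewrite -!k1 kxy.
  have {kxy} xy := congr1 snd kxy.
  have fxy j : Num.floor (t x 0 j) = Num.floor (t y 0 j).
    have : nat_of_ord ((key x).2 j) = nat_of_ord ((key y).2 j) by rewrite xy.
    rewrite !kE (modn_small (fl _ _ xS)) (modn_small (fl _ _ yS)) !fjE.
    have := t1 x j xS; have := t1 y j yS; rewrite !ler_norml => /andP[h1 _] /andP[h2 _].
    have f1 : -1 <= Num.floor (t x 0 j) by rewrite floor_ge_int rmorphN.
    have f2 : -1 <= Num.floor (t y 0 j) by rewrite floor_ge_int rmorphN.
    by move: f1 f2; clear; lia.
  have tz := tB _ _ _ zE.
  (* Equal floors make the coordinates differ by less than 1, equal classes make them differ by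
     integers. *)
  have z0 : z = 0.
    apply/rowP => j; rewrite [RHS]mxE.
    have := congr1 (fun u : 'rV[rat]_r => u 0 j) tz.
    rewrite [LHS]mxE [(- t y) 0 j]mxE [RHS]mxE => tzj.
    have := floor_itv (t x 0 j); have := floor_itv (t y 0 j); rewrite fxy.
    rewrite rmorphD /=; move: tzj.
    move: (t x 0 j) (t y 0 j) (Num.floor _)%:~R => a1 a2 a3 zE1 /andP[b1 b2] /andP[c1 c2].
    have d1 : (z 0 j)%:~R < (1 : rat) by rewrite -zE1; clear -b1 c2; lra.
    have d2 : (-1 : rat) < (z 0 j)%:~R by rewrite -zE1; clear -b2 c1; lra.
    have : z 0 j < 1 by rewrite -(ltr_int rat).
    have : -1 < z 0 j by rewrite -(ltr_int rat) rmorphN.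
    by move=> h1 h2; apply/eqP; rewrite eq_le -ltzD1 add0r h2 -[0](addNr 1) lezD1 h1.
  by apply/eqP; rewrite -subr_eq0 zE z0 mul0mx.
have -> : (3 ^ r * `|\det V|)%N = #|{: T * {ffun 'I_r -> 'I_3}}|.
  by rewrite card_prod cT card_ffun !card_ord mulnC.
rewrite -(size_map key) cardE; apply: uniq_leq_size; first by rewrite (map_inj_in_uniq kinj).
by move=> g _; rewrite mem_enum.
Qed.

Section LowerCount.

Variable R : realType.

Lemma det_le_row_sums n (A : 'M[R]_n) : `|\det A| <= \prod_i \sum_j `|A i j|.
Proof.
rewrite bigA_distr_bigA /= (le_trans (ler_norm_sum _ _ _)) //.
pose G (f : {ffun 'I_n -> 'I_n}) : R := \prod_i `|A i (f i)|.
have -> : \sum_(s : 'S_n) `|(-1) ^+ s * \prod_i A i (s i)| = \sum_(f in (fun s : 'S_n => [ffun i => s i]) @: [set: _]%SET) G f.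
  rewrite big_imset /=; last first.
    move=> s s' _ _ ss; apply/permP => i.
    by have := congr1 (fun f : {ffun 'I_n -> 'I_n} => f i) ss; rewrite !ffunE.
  apply: eq_big => [s|s _]; first by rewrite inE.
  by rewrite normrM normr_sign mul1r normr_prod; apply: eq_bigr => i _; rewrite ffunE.
rewrite big_mkcond /=; apply: ler_sum => f _; case: ifP => // _.
exact: prodr_ge0.
Qed.

(** n L is rounded down to an integer matrix A. Among the integer vectors of a large cube,
    pigeonhole modulo Z^r A finds many in one class; their differences from a fixed one have the
    form z A, and z L is close to z A / n. *)
Lemma lower_count r (L : 'M[R]_r) (t : R) : L \in unitmx -> 0 < t ->
  exists S : seq 'rV[int]_r, [/\ uniq S,
    forall z, z \in S -> forall j, `|(map_mx intr z *m L) 0 j| <= t &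
    (t / 2) ^+ r <= `|\det L| * (size S)%:R].
Proof.
move=> Lu t0; pose C : R := \sum_i \sum_j `|invmx L i j|.
have C0 : 0 <= C by apply: sumr_ge0 => i _; apply: sumr_ge0.
(* With this n the entries of E = M - 1 in any row or column have absolute sum at most 1/4. Hence M
   is invertible, its inverse expands the maximum norm by at most 4/3, and |det M| <= (5/4)^r. *)
pose n := (Num.trunc (4 * r%:R * C)).+1.
have nP : 4 * r%:R * C < n%:R by exact: truncnS_gt.
have n0 : 0 < n%:R :> R by rewrite ltr0n.
pose A : 'M[int]_r := \matrix_(i, j) Num.floor (n%:R * L i j).
pose M : 'M[R]_r := invmx L *m (n%:R^-1 *: map_mx intr A).
pose E := M - 1%:M.
have EM : 1%:M + E = M by rewrite /E addrC subrK.
have Ele i j : `|E i j| <= C / n%:R.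
  have -> : E = invmx L *m (n%:R^-1 *: map_mx intr A - L) by rewrite mulmxBr mulVmx.
  rewrite mxE (le_trans (ler_norm_sum _ _ _)) // /C [X in _ <= X / _](bigD1 i) //= [leRHS]mulrDl ler_wpDr //.
    by apply: divr_ge0; [apply: sumr_ge0 => *; exact: sumr_ge0|exact: ltW].
  rewrite mulr_suml; apply: ler_sum => k _; rewrite normrM ler_wpM2l // !mxE.
  have -> : n%:R^-1 * (Num.floor (n%:R * L k j))%:~R - L k j =
     - ((n%:R * L k j - (Num.floor (n%:R * L k j))%:~R) / n%:R) by field; rewrite lt0r_neq0.
  rewrite normrN normrM normfV [`|n%:R|]ger0_norm ?(ltW n0) // ler_pdivrMr // mulVf ?lt0r_neq0 //.
  have /andP[h1 h2] := floor_itv (n%:R * L k j).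
  by move: h2; rewrite rmorphD /= ger0_norm; lra.
have rCn : r%:R * (C / n%:R) <= 4^-1.
  by rewrite mulrA ler_pdivrMr //; lra.
have invM (y : 'rV[R]_r) (s : R) : 0 <= s -> (forall j, `|(y *m M) 0 j| <= s) ->
    forall j, `|y 0 j| <= 4 / 3 * s.
  move=> s0 hy j; pose j0 := [arg max_(j0 > j) `|y 0 j0|]%O.
  have jm k : `|y 0 k| <= `|y 0 j0| by rewrite /j0; case: arg_maxP => // i _; apply.
  apply: le_trans (jm j) _.
  have : `|y 0 j0| <= s + `|y 0 j0| / 4.
    have -> : y 0 j0 = (y *m M) 0 j0 - (y *m E) 0 j0.
      by rewrite -EM mulmxDr mulmx1 mxE addrK.
    rewrite (le_trans (ler_normB _ _)) // lerD // mxE (le_trans (ler_norm_sum _ _ _)) //.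
    have -> : (y *m M) 0 j0 - \sum_k y 0 k * E k j0 = y 0 j0.
      by rewrite -EM mulmxDr mulmx1 mxE [in X in _ + X - _]mxE addrK.
    apply: (@le_trans _ _ (\sum_(k < r) `|y 0 j0| * (C / n%:R))).
      by apply: ler_sum => k _; rewrite normrM ler_pM.
    rewrite sumr_const card_ord -mulrnAr -mulr_natl ler_wpM2l //.
  by lra.
have Mn0 : \det M != 0.
  apply/negP => /det0P[y y0 yM]; case/negP: y0; apply/eqP/rowP => j; rewrite [RHS]mxE.
  have := invM y 0 (lexx _); rewrite yM => /(_ _ j); rewrite mulr0 normr_le0 => h.
  by apply/eqP; apply: h => k; rewrite mxE normr0.
have dA : (\det A)%:~R = n%:R ^+ r * (\det L * \det M) :> R.
  rewrite -det_mulmx /M mulKVmx // detZ mulrA -exprMn mulfV ?lt0r_neq0 // expr1n mul1r.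
  by rewrite det_map_mx.
have A0 : \det A != 0.
  have dL : \det L != 0 by rewrite -unitfE -unitmxE.
  by rewrite -(intr_eq0 R) dA mulf_neq0 ?mulf_neq0 // expf_neq0 // lt0r_neq0.
have [T [cl [cT clP]]] := lattice_classes A0.
(* 3/4 compensates the expansion 4/3 of [invM]; the loss 5/4 from det M is then affordable because
   (3/4) / (5/4) exceeds 1/2. *)
pose t' := 3 / 4 * t.
have t'0 : 0 < t' by rewrite /t'; lra.
(* Entries range over 0, ..., m - 1: there are m > n t' of them, and they differ by at most m - 1 <=
   n t'. *)
pose m := (Num.trunc (n%:R * t')).+1.
have mP : n%:R * t' < m%:R by exact: truncnS_gt.
have nt0 : 0 <= n%:R * t' by rewrite mulr_ge0 // ltW.
have mP' : m%:R - 1 <= n%:R * t'.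
  by rewrite /m -natr1 addrK truncn_le.
pose row_of (g : {ffun 'I_r -> 'I_m}) : 'rV[int]_r := \row_j (g j : nat)%:Z.
have rinj : injective row_of.
  move=> g g' gg; apply/ffunP => j; apply: val_inj.
  by have := congr1 (fun u : 'rV[int]_r => u 0 j) gg; rewrite !mxE => -[].
have G0 : (0 < #|{ffun 'I_r -> 'I_m}|)%N by rewrite card_ffun !card_ord expn_gt0.
have [c hc] := pigeonhole (fun g : {ffun 'I_r -> 'I_m} => cl (row_of g)) G0.
rewrite cT card_ffun !card_ord in hc.
have [g0 g0c] : exists g0, g0 \in [pred g | cl (row_of g) == c].
  apply/card_gt0P; move: hc; rewrite lt0n; apply: contraTneq => ->.
  by rewrite muln0 -ltnNge expn_gt0.
have zex g : exists z : 'rV[int]_r, cl (row_of g) == c -> row_of g - row_of g0 = z *m A.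
  have [/eqP gc|_] := boolP (cl (row_of g) == c); last by exists 0.
  have [|z zE] := clP (row_of g) (row_of g0); last by exists z.
  by move: g0c; rewrite inE gc => /eqP.
have [z zP] := choice zex.
exists [seq z g | g <- enum [pred g | cl (row_of g) == c]]; split.
- rewrite map_inj_in_uniq ?enum_uniq // => g g'; rewrite !mem_enum !inE => gc g'c zz.
  have := zP g gc; rewrite zz -(zP g' g'c) => /addIr; exact: rinj.
- move=> u /mapP[g]; rewrite mem_enum inE => gc -> j.
  have -> : t = 4 / 3 * t' by rewrite /t'; field.
  apply: invM; first exact: ltW.
  move=> k; rewrite /M mulmxA mulmxK // -scalemxAr -map_mxM -(zP g gc) !mxE.
  rewrite normrM normfV [`|n%:R|]ger0_norm ?(ltW n0) // mulrC ler_pdivrMr //.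
  have a1 : ((g k : nat)%:R : R) <= m%:R - 1.
    by rewrite lerBrDr natr1 ler_nat.
  have a2 : ((g0 k : nat)%:R : R) <= m%:R - 1.
    by rewrite lerBrDr natr1 ler_nat.
  have b1 : 0 <= ((g k : nat)%:R : R) by [].
  have b2 : 0 <= ((g0 k : nat)%:R : R) by [].
  by rewrite rmorphB /= ler_norml mulrC; apply/andP; split; lra.
- rewrite size_map -cardE; set sz := #|_| in hc *.
  have h1 : (n%:R * t') ^+ r <= n%:R ^+ r * (`|\det L| * `|\det M|) * sz%:R.
    have -> : n%:R ^+ r * (`|\det L| * `|\det M|) = `|\det A|%N%:R.
      rewrite -[RHS]/((`|\det A|%N : int)%:~R) abszE intr_norm dA normrM normrX normrM.
      by rewrite [`|n%:R|]ger0_norm // ltW.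
    rewrite -natrM (le_trans _ (_ : (m ^ r)%:R <= _)) ?ler_nat // natrX.
    by rewrite lerXn2r ?nnegrE // ltW.
  have h2 : `|\det M| <= (5 / 4) ^+ r.
    apply: le_trans (det_le_row_sums M) _.
    rewrite -[X in _ ^+ X](card_ord r) -prodr_const; apply: ler_prod => i _.
    rewrite sumr_ge0 //= -EM.
    apply: (@le_trans _ _ (\sum_j (`|(1%:M : 'M[R]_r) i j| + C / n%:R))).
      by apply: ler_sum => j _; rewrite mxE (le_trans (ler_normD _ _)) // lerD2l.
    rewrite big_split /= sumr_const card_ord -mulr_natl (bigD1 i) //= big1 => [|j ji].
      by rewrite mxE eqxx normr1; lra.
    by rewrite mxE eq_sym (negPf ji) normr0.
  have h3 : t' ^+ r <= `|\det L| * `|\det M| * sz%:R.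
    by move: h1; rewrite exprMn -[leRHS]mulrA ler_pM2l // exprn_gt0.
  have e : t / 2 = t / 2 * (5 / 4) / (5 / 4) by field.
  have p54 : 0 < (5 / 4 : R) ^+ r by rewrite exprn_gt0 //; lra.
  rewrite e expr_div_n ler_pdivrMr //.
  apply: le_trans (_ : t' ^+ r <= _).
    by apply: lerXn2r; rewrite ?nnegrE /t'; lra.
  apply: le_trans h3 _; rewrite mulrAC ler_wpM2l // mulr_ge0 //.
Qed.

End LowerCount.

(** * Algebraic integers and the discriminant *)

Section UltrametricIntegers.

Variables (R : realType) (L : fieldType) (a : L -> R).
Hypothesis aP : is_absval a.
Hypothesis au : ultrametric a.

Lemma ultra_int (z : int) : a z%:~R <= 1.
Proof.
have nat1 n : a n%:R <= 1.
  elim: n => [|n ih]; first by rewrite (av0 aP).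
  by rewrite -natr1 (le_trans (au _ _)) // ge_max ih (av1 aP) lexx.
by case: z => n; rewrite ?NegzE ?rmorphN ?(avN aP) /= -?pmulrn.
Qed.

(** If |x| > 1, the leading term has absolute value |x|^n, while all lower terms are bounded by
    |x|^(n-1). *)
Lemma ultra_root_le1 (p : {poly L}) x : p \is monic -> (forall i, a p`_i <= 1) ->
  root p x -> a x <= 1.
Proof.
move=> pm pi; rewrite /root horner_coef => /eqP px.
rewrite leNgt; apply/negP => x1.
have p0 : (0 < size p)%N by rewrite size_poly_gt0 monic_neq0.
case E : (size p) p0 => [//|n] _; move: px; rewrite E big_ord_recr /=.
have -> : p`_n = 1 by move/monicP: pm; rewrite /lead_coef E.
rewrite mul1r addrC => /eqP; rewrite addr_eq0 => /eqP xn.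
have n0 : (0 < n)%N.
  rewrite lt0n; apply/negP => /eqP n0; move: xn; rewrite n0 big_ord0 oppr0 expr0 => /eqP.
  by rewrite oner_eq0.
have x0 : 0 < a x by rewrite (lt_trans _ x1).
have : a x ^+ n <= a x ^+ n.-1.
  rewrite -[leLHS](avX aP) xn (avN aP); apply: (ultra_sum _ aP au) => [|i _].
    by rewrite exprn_ge0 // ltW.
  rewrite (avM aP) (avX aP) -[leRHS]mul1r; apply: ler_pM => //; rewrite ?(av_ge0 aP) ?exprn_ge0 ?(ltW x0) //.
  by apply: ler_weXn2l; [exact: ltW|rewrite -ltnS prednK].
by case: n n0 {xn E} => // n _; rewrite /= exprS ger_pMl ?exprn_gt0 // leNgt x1.
Qed.

Lemma ultra_det_le1 n (A : 'M[L]_n) : (forall i j, a (A i j) <= 1) -> a (\det A) <= 1.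
Proof.
move=> A1; apply: (ultra_sum _ aP au) => // s _.
rewrite (avM aP) (av_sign aP) mul1r (av_prod aP).
by apply: prodr_ile1 => i _; rewrite (av_ge0 aP) A1.
Qed.

Lemma ultra_mul_le n m p (A : 'M[L]_(n, m)) (B : 'M[L]_(m, p)) (C D : R) :
  0 <= C -> 0 <= D -> (forall i j, a (A i j) <= C) -> (forall i j, a (B i j) <= D) ->
  forall i j, a ((A *m B) i j) <= C * D.
Proof.
move=> C0 D0 A1 B1 i j; rewrite mxE; apply: (ultra_sum _ aP au) => [|k _]; first exact: mulr_ge0.
by rewrite (avM aP) ler_pM ?av_ge0.
Qed.

Lemma ultra_prod_XsubC n (x : 'I_n -> L) : (forall k, a (x k) <= 1) ->
  forall i, a (\prod_k ('X - (x k)%:P))`_i <= 1.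
Proof.
elim: n x => [|n ih] x x1 i.
  by rewrite big_ord0 coef1; case: eqP; rewrite ?(av1 aP) ?(av0 aP).
rewrite big_ord_recl mulrBl coefB coefXM coefCM.
have h j : a (\prod_(k < n) ('X - (x (lift ord0 k))%:P))`_j <= 1 by exact: ih.
rewrite (le_trans (au _ _)) // ge_max (avN aP); apply/andP; split.
  by case: eqP; rewrite ?(av0 aP).
by rewrite (avM aP) mulr_ile1 // (av_ge0 aP).
Qed.

(** In each product of the expansion one factor is exchanged at a time, the others being bounded by
    1. *)
Lemma ultra_det_perturb n (A B : 'M[L]_n) (e : R) : 0 <= e ->
  (forall i j, a (A i j) <= 1) -> (forall i j, a (B i j) <= 1) ->
  (forall i j, a (A i j - B i j) <= e) -> a (\det A - \det B) <= e.
Proof.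
move=> e0 A1 B1 AB; rewrite /determinant -sumrB.
apply: (ultra_sum _ aP au) => // s _; rewrite -mulrBr (avM aP) (av_sign aP) mul1r.
elim: (index_enum _) => [|i r ih]; first by rewrite !big_nil subrr (av0 aP).
rewrite !big_cons; set P := \prod_(j <- r) A _ _ in ih *; set Q := \prod_(j <- r) B _ _ in ih *.
have -> : A i (s i) * P - B i (s i) * Q = (A i (s i) - B i (s i)) * P + B i (s i) * (P - Q) by ring.
have P1 : a P <= 1 by rewrite /P (av_prod aP); apply: prodr_ile1 => j _; rewrite (av_ge0 aP) A1.
rewrite (le_trans (au _ _)) // ge_max !(avM aP); apply/andP; split.
  by rewrite -[e]mulr1 ler_pM ?av_ge0.
by rewrite -[e]mul1r ler_pM ?av_ge0.
Qed.

End UltrametricIntegers.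

Lemma det_set_row (F : comNzRingType) n (u : 'rV[F]_n) j :
  \det (\matrix_k (if k == j then u else delta_mx 0 k)) = u 0 j.
Proof.
set Q := \matrix_k _; rewrite (expand_det_col Q j) (bigD1 j) //= big1 ?addr0 => [|k kj]; last first.
  by rewrite !mxE (negPf kj) !mxE eqxx eq_sym (negPf kj) mul0r.
rewrite !mxE eqxx /cofactor addnn -signr_odd odd_double expr0 mul1r.
have -> : row' j (col' j Q) = 1%:M.
  apply/matrixP => k l; rewrite !mxE eq_sym (negPf (neq_lift _ _)) !mxE eqxx /=.
  by rewrite (inj_eq lift_inj) eq_sym.
by rewrite det1 mulr1.
Qed.

Lemma padic_abs_le1_denq p (q : rat) : prime p -> padic_abs p q <= 1 -> ~~ (p %| `|denq q|)%N.
Proof.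
move=> pp; have [->|q0] := eqVneq q 0.
  by rewrite dvdn1; case: eqP pp => // ->.
rewrite /padic_abs (negPf q0) => h; apply/negP => pd.
have c : coprime `|numq q| `|denq q| := coprime_num_den q.
have pn : logn p `|numq q| = 0%N.
  apply/eqP; rewrite -leqn0 leqNgt; apply/negP => l0.
  have : (p %| `|numq q|)%N by apply: contraLR l0 => pn; rewrite lognE pp (negPf pn) andbF.
  move=> pn; have : (p %| gcdn `|numq q| `|denq q|)%N by rewrite dvdn_gcd pn.
  by rewrite (eqP c) dvdn1 => /eqP p1; rewrite p1 in pp.
have ld : (0 < logn p `|denq q|)%N by rewrite logn_gt0 mem_primes pp pd absz_gt0 denq_eq0.
move: h; rewrite pn subr0 -exprnP => hp; have : 1 < (p%:R : rat) ^+ logn p `|denq q|.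
  by rewrite exprn_egt1 ?ltr1n ?prime_gt1 // -lt0n.
by rewrite ltNge hp.
Qed.

Lemma padic_le1_int (q : rat) : (forall p, prime p -> padic_abs p q <= 1) -> exists z : int, q = z%:~R.
Proof.
move=> h; exists (numq q).
suff d1 : denq q = 1 by rewrite -{1}[q]divq_num_den d1 divr1.
have dp := denq_gt0 q.
have [dd|d1] := leqP `|denq q|%N 1; first by move: dd dp; clear; lia.
have pp := pdiv_prime d1.
by have := padic_abs_le1_denq pp (h _ pp); rewrite pdiv_dvd.
Qed.

Section NumberField.

Variables (R : realType) (K : fieldExtType rat).
Let d := \dim {:K}.
Let b := vbasis {:K}.

Lemma algint_int (z : int) : algebraic_integer (z%:~R : K).
Proof. exact: (integral_id (intr : {rmorphism int -> K})). Qed.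

Lemma algintD (x y : K) : algebraic_integer x -> algebraic_integer y -> algebraic_integer (x + y).
Proof. exact: (integral_add (RtoK := (intr : {rmorphism int -> K}))). Qed.

Lemma algintB (x y : K) : algebraic_integer x -> algebraic_integer y -> algebraic_integer (x - y).
Proof. exact: (integral_sub (RtoK := (intr : {rmorphism int -> K}))). Qed.

Lemma algintM (x y : K) : algebraic_integer x -> algebraic_integer y -> algebraic_integer (x * y).
Proof. exact: (integral_mul (RtoK := (intr : {rmorphism int -> K}))). Qed.

Lemma algint_sum I (r : seq I) (P : pred I) (f : I -> K) :
  (forall i, P i -> algebraic_integer (f i)) -> algebraic_integer (\sum_(i <- r | P i) f i).
Proof.
move=> h; elim/big_rec: _ => [|i x Pi hx]; first exact: (algint_int 0).
exact: algintD (h i Pi) hx.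
Qed.

(** n is the product of the denominators of the coefficients of the characteristic polynomial of x.
    The last clause is what [local_algint] needs to stay prime to p. *)
Lemma algint_scale (x : K) : exists n : nat, (0 < n)%N /\ algebraic_integer (n%:R * x) /\
  forall p, prime p -> (forall i, padic_abs p (char_poly (mulmat x))`_i <= 1) -> ~~ (p %| n)%N.
Proof.
have [sigma [unit_sigma _ _ _]] := @complex_embeddings R K.
set f := char_poly (mulmat x).
have fm : f \is monic by exact: char_poly_monic.
have sf : size f = d.+1 by exact: size_char_poly.
pose n := (\prod_(i < d.+1) `|denq f`_i|)%N.
have n0 : (0 < n)%N by rewrite prodn_gt0 // => i; rewrite absz_gt0 denq_eq0.
exists n; split=> //; split; last first.
  move=> p pp fp; apply/negP; rewrite /n.
  have : forall i : 'I_d.+1, ~~ (p %| `|denq f`_i|)%N by move=> i; apply: padic_abs_le1_denq.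
  move=> h; rewrite Euclid_dvd_prod // big_has => /hasP[i _]; exact/negP.
(* This is the characteristic polynomial of n x; the factor n^(d-i) clears the denominator of every
   coefficient below the leading one. *)
pose g : {poly rat} := \poly_(i < d.+1) (n%:R ^+ (d - i) * f`_i).
have fd : f`_d = 1 by move/monicP: fm; rewrite /lead_coef sf.
have gd : g`_d = 1 by rewrite coef_poly ltnSn subnn expr0 mul1r fd.
have sg : size g = d.+1.
  by apply/eqP; rewrite eqn_leq size_poly /= ltnNge; apply/negP => /leq_sizeP/(_ d (leqnn _))/eqP; rewrite gd oner_eq0.
have gm : map_poly (in_alg K) g \is monic.
  by rewrite monicE lead_coef_map /lead_coef sg gd rmorph1.
apply: (integral_root_monic (RtoK := (intr : {rmorphism int -> K})) gm).
  have := char_poly_mulmat_root (L := R[i]) (real_complex R \o ratr) unit_sigma x.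
  rewrite -/f /root !horner_coef !size_map_poly sf sg => /eqP fx; apply/eqP.
  
  transitivity (n%:R ^+ d * \sum_(i < d.+1) (map_poly (in_alg K) f)`_i * x ^+ i); last by rewrite fx mulr0.
  rewrite mulr_sumr; apply: eq_bigr => i _.
  have fE : in_alg K (n%:R ^+ (d - i) * f`_i) = n%:R ^+ (d - i) * in_alg K f`_i.
    by rewrite rmorphM rmorphXn rmorph_nat.
  have -> x' : (map_poly (in_alg K) g)`_x' = in_alg K g`_x' by rewrite coef_map.
  have -> x' : (map_poly (in_alg K) f)`_x' = in_alg K f`_x' by rewrite coef_map.
  rewrite [g`_i](_ : _ = n%:R ^+ (d - i) * f`_i); last by rewrite coef_poly ltn_ord.
  rewrite fE exprMn.
  have -> : (n%:R : K) ^+ d = n%:R ^+ (d - i) * n%:R ^+ i by rewrite -exprD subnK // -ltnS ltn_ord.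
  move: (in_alg K f`_i) => y; rewrite -!mulrA; congr (_ * _); rewrite mulrCA; congr (_ * _).
apply/integral_poly => i; rewrite coef_map coef_poly.
case: ifP => [id|_]; last by rewrite /= scale0r; exact: (algint_int 0).
suff [z zE] : exists z : int, n%:R ^+ (d - i) * f`_i = z%:~R.
  by have h := algint_int z; rewrite -(rmorph_int (in_alg K)) -zE in h; exact: h.
move: id; rewrite ltnS leq_eqVlt => /orP[/eqP->|id].
  by exists 1; rewrite fd subnn mulr1.
have i1 : (i < d.+1)%N by rewrite ltnS ltnW.
have [m nE] : exists m : nat, n = (`|denq f`_i| * m)%N.
  by rewrite /n (bigD1 (Ordinal i1)) //=; eexists.
exists (n%:Z ^+ (d - i).-1 * m%:Z * numq f`_i).
have nR : (n%:R : rat) = (denq f`_i)%:~R * m%:R.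
  rewrite nE natrM; congr (_ * _).
  by rewrite -[LHS]/((`|denq f`_i|%N : int)%:~R) gtz0_abs // denq_gt0.
rewrite -{1}(prednK (_ : 0 < d - i)%N) ?subn_gt0 // exprSr.
rewrite !intrM rmorphXn /= numqE -!pmulrn.
rewrite {2}nR -!mulrA; congr (_ * _).
by rewrite mulrC -mulrA.
Qed.

Section AtPrime.

Variables (p : nat) (le : local_embeddings K (padic_real p R)).
Hypothesis p_prime : prime p.
Hypothesis lu : ultrametric (le_abs le).

Let a := le_abs le.
Let aP := le_absP le.
Let s := le_sigma le.
Let i := le_rat le.

Lemma le_rat_padic q : a (i q) = ratr (padic_abs p q). Proof. exact: le_ratE. Qed.

Lemma le_ratE1 q : (a (i q) <= 1) = (padic_abs p q <= 1).
Proof. by rewrite le_rat_padic -(ler_rat R) rmorph1. Qed.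

Lemma algint_le1 (x : K) k : algebraic_integer x -> a (s k x) <= 1.
Proof.
move=> [q qm qx]; apply: (@ultra_root_le1 R _ a aP lu (map_poly intr q)).
- by rewrite monic_map.
- by move=> j; rewrite coef_map; exact: (ultra_int aP lu).
- have -> : map_poly intr q = map_poly (s k) (map_poly intr q).
    by rewrite -map_poly_comp; apply: eq_map_poly => z; rewrite /= rmorph_int.
  by rewrite fmorph_root.
Qed.

(** The coefficients of the characteristic polynomial are, up to sign, the elementary symmetric
    functions of the sigma k x, hence p-integral. *)
Lemma local_algint (x : K) : (forall k, a (s k x) <= 1) ->
  exists n : nat, (0 < n)%N /\ ~~ (p %| n)%N /\ algebraic_integer (n%:R * x).
Proof.
move=> x1; have [n [n0 [nx np]]] := algint_scale x; exists n; split=> //; split=> //.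
apply: np => // j; rewrite -le_ratE1.
have := ultra_prod_XsubC aP lu x1 j.
by rewrite -(char_poly_sigma i (le_unit le)) coef_map.
Qed.

End AtPrime.

Lemma trace_algint (x : K) : algebraic_integer x -> exists z : int, field_trace x = z%:~R.
Proof.
move=> xi; apply: padic_le1_int => p pp; have [le lu] := padic_embeddings R K pp.
rewrite -(le_ratE1 le) (trace_sigma (le_rat le) (le_unit le)).
by apply: (ultra_sum _ (le_absP le) lu) => // k _; exact: algint_le1.
Qed.

Definition crdmx (c : 'I_d -> K) : 'M[rat]_d := \matrix_l crd (c l).

Definition trace_form (c : 'I_d -> K) : 'M[rat]_d := \matrix_(j, l) field_trace (c j * c l).

Lemma det_trace_form_int c : (forall l, algebraic_integer (c l)) ->
  exists z : int, \det (trace_form c) = z%:~R.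
Proof.
move=> ci; have hz j : exists z : int, field_trace (c j.1 * c j.2) = z%:~R.
  by apply: trace_algint; exact: algintM.
have [z zE] := choice hz; exists (\det (\matrix_(j, l) z (j, l))).
by rewrite -det_map_mx; congr (\det _); apply/matrixP => j l; rewrite !mxE (zE (j, l)).
Qed.

Lemma trace_form_sigma (L : fieldType) (i : {rmorphism rat -> L})
    (sigma : 'I_d -> {rmorphism K -> L}) (c : 'I_d -> K) : embmx sigma \in unitmx ->
  map_mx i (trace_form c) = (\matrix_(l, k) sigma k (c l)) *m (\matrix_(l, k) sigma k (c l))^T.
Proof.
move=> su; apply/matrixP => j l; rewrite !mxE (trace_sigma i su).
by apply: eq_bigr => k _; rewrite !mxE rmorphM.
Qed.

Lemma sigma_crdmx (L : fieldType) (i : {rmorphism rat -> L})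
    (sigma : 'I_d -> {rmorphism K -> L}) (c : 'I_d -> K) :
  (\matrix_(l, k) sigma k (c l)) = map_mx i (crdmx c) *m embmx sigma.
Proof.
apply/row_matrixP => l; rewrite row_mul -map_row rowK (crd_embmx i).
by apply/rowP => k; rewrite !mxE.
Qed.

Lemma trace_form_crdmx c : \det (trace_form c) = \det (crdmx c) ^+ 2 * \det (trace_form (fun l => b`_l)).
Proof.
have [sigma [su _ _ _]] := @complex_embeddings R K.
pose i : {rmorphism rat -> R[i]} := real_complex R \o ratr.
apply: (fmorph_inj i); rewrite rmorphM rmorphXn -!det_map_mx !(trace_form_sigma i _ su).
rewrite (sigma_crdmx i) !trmx_mul !det_mulmx !det_tr det_map_mx /=.
by rewrite -/(embmx sigma); ring.
Qed.

Lemma trace_form_neq0 c : crdmx c \in unitmx -> \det (trace_form c) != 0.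
Proof.
move=> cu; have [sigma [su _ _ _]] := @complex_embeddings R K.
pose i : {rmorphism rat -> R[i]} := real_complex R \o ratr.
rewrite -(fmorph_eq0 i) -det_map_mx (trace_form_sigma i _ su) (sigma_crdmx i).
set S := _ *m embmx _; have : S \in unitmx by rewrite unitmx_mul map_unitmx cu su.
move: S => S; rewrite unitmxE unitfE => S0.
by rewrite det_mulmx det_tr mulf_neq0.
Qed.

Lemma crdmx_basis (c : d.-tuple K) : basis_of {:K} c = (crdmx (fun l => c`_l) \in unitmx).
Proof.
rewrite basisEfree subvf size_tuple leqnn /= andbT.
apply/idP/idP => [/freeP cf|cu].
  rewrite -row_free_unit; apply: inj_row_free => u uc; apply/rowP => l; rewrite [RHS]mxE.
  apply: (cf (fun l => u 0 l)); apply: crd_inj; rewrite crd0 crd_bigsum -[RHS]uc.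
  apply/rowP => k; rewrite summxE !mxE; apply: eq_bigr => j _.
  by rewrite crdZ !mxE.
apply/freeP => u uc l.
have : (\row_l u l) *m crdmx (fun l => c`_l) = 0.
  have uc0 : crd (\sum_l u l *: c`_l) = 0 by rewrite uc crd0.
  rewrite -[RHS]uc0 crd_bigsum; apply/rowP => k; rewrite summxE !mxE.
  by apply: eq_bigr => j _; rewrite crdZ !mxE.
move/(canRL (mulmxK cu)); rewrite mul0mx => /rowP/(_ l).
by rewrite !mxE.
Qed.

Lemma crd_crdmx (c : 'I_d -> K) (x : K) : crdmx c \in unitmx ->
  x = \sum_l (crd x *m invmx (crdmx c)) 0 l *: c l.
Proof.
move=> cu; apply: crd_inj; rewrite crd_bigsum -{1}[crd x](mulmxKV cu).
by apply/rowP => k; rewrite summxE !mxE; apply: eq_bigr => j _; rewrite crdZ !mxE.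
Qed.

(** Among the bases made of algebraic integers, one with discriminant of least absolute value is
    taken. If an integral x had a coordinate with fractional part e in (0, 1), exchanging the
    corresponding basis vector would multiply the discriminant by e^2 < 1. *)
Lemma integral_basis_exists : exists c : d.-tuple K, integral_basis c.
Proof.
pose P (n : nat) := `[< exists c : 'I_d -> K, [/\ forall l, algebraic_integer (c l),
   crdmx c \in unitmx & `|numq (\det (trace_form c))|%N = n] >].
have exP : exists n, P n.
  have [f fP] := choice (fun l : 'I_d => algint_scale b`_l).
  eexists; apply/asboolP; exists (fun l => (f l)%:R * b`_l); split=> // [l|].
    by have [_ []] := fP l.
  have -> : crdmx (fun l => (f l)%:R * b`_l) = diag_mx (\row_l (f l)%:R).
    apply/row_matrixP => l; rewrite rowK -[_ * b`_l]/(_ * _).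
    have -> : (f l)%:R * b`_l = \sum_k (delta_mx 0 l : 'rV[rat]_d) 0 k *: ((f l)%:R *: b`_k).
      rewrite (bigD1 l) //= big1 ?addr0 => [|k kl].
        by rewrite mxE !eqxx scale1r scaler_nat mulr_natl.
      by rewrite mxE (negPf kl) andbF scale0r.
    under eq_bigr do rewrite scalerA.
    have -> : \sum_k ((delta_mx 0 l : 'rV[rat]_d) 0 k * (f l)%:R) *: b`_k =
      \sum_k ((f l)%:R *: (delta_mx 0 l : 'rV[rat]_d)) 0 k *: b`_k.
      by apply: eq_bigr => k _; rewrite [in RHS]mxE mulrC.
    rewrite crd_lin; apply/rowP => k; rewrite !mxE eqxx /= eq_sym.
    by case: eqP => [->|]; rewrite ?mulr1 ?mulr0.
  rewrite unitmxE det_diag unitfE; apply/prodf_neq0 => l _; rewrite mxE pnatr_eq0 -lt0n.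
  by have [] := fP l.
have [n /asboolP[c [ci cu cn]] nmin] := ex_minnP exP.
have [D DE] := det_trace_form_int ci.
have D0 : D != 0 by rewrite -(intr_eq0 rat) -DE trace_form_neq0.
exists [tuple c l | l < d]; split.
  rewrite crdmx_basis; congr (_ \in unitmx) : cu; apply/row_matrixP => l.
  by rewrite !rowK -tnth_nth tnth_mktuple.
have cE (l : 'I_d) : [tuple c l | l < d]`_l = c l by rewrite -tnth_nth tnth_mktuple.
move=> x; split=> [xi|[z ->]]; last first.
  apply: algint_sum => l _; rewrite -mulrzl; apply: algintM; first exact: algint_int.
  by rewrite cE.
pose q := crd x *m invmx (crdmx c).
have qint l : exists z : int, q 0 l = z%:~R.
  pose fl : int := Num.floor (q 0 l); pose e := q 0 l - fl%:~R.
  have /andP[h1 h2] := floor_itv (q 0 l).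
  have e0 : 0 <= e by rewrite subr_ge0.
  have e1 : e < 1 by move: h2; rewrite rmorphD /= /e; lra.
  have [ez|en0] := eqVneq e 0; first by exists fl; apply/eqP; rewrite -subr_eq0; apply/eqP.
  pose c' k := if k == l then x - fl%:~R * c l else c k.
  pose Q : 'M[rat]_d := \matrix_k (if k == l then q - fl%:~R *: delta_mx 0 l else delta_mx 0 k).
  have QE : crdmx c' = Q *m crdmx c.
    apply/row_matrixP => k; rewrite row_mul !rowK /c'; case: eqP => _.
      rewrite crdB mulmxBl /q mulmxKV // -scalemxAl -rowE rowK.
      congr (_ - _); rewrite -crdZ; congr crd.
      by rewrite scaler_int mulrzl.
    by rewrite -rowE rowK.
  have dQ : \det Q = e.
    clear QE; clearbody q.
    by rewrite det_set_row !mxE !eqxx mulr1.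
  have c'u : crdmx c' \in unitmx by rewrite QE unitmx_mul cu andbT unitmxE dQ unitfE.
  have c'i k : algebraic_integer (c' k).
    rewrite /c'; case: ifP => // _; apply: algintB => //; apply: algintM => //.
    exact: algint_int.
  have dE' : \det (trace_form c') = e ^+ 2 * D%:~R.
    by rewrite trace_form_crdmx QE det_mulmx dQ exprMn -mulrA -trace_form_crdmx DE.
  have [D' D'E] := det_trace_form_int c'i.
  have : (n <= `|numq (\det (trace_form c'))|)%N.
    by apply: nmin; apply/asboolP; exists c'.
  rewrite -cn DE D'E !numq_int -lez_nat !abszE -(ler_int rat) !intr_norm -D'E dE'.
  rewrite normrM -ler_pdivrMr ?normr_gt0 ?intr_eq0 // divff ?normr_eq0 ?intr_eq0 //.
  rewrite ger0_norm ?sqr_ge0 // leNgt expr_lt1 // e1 //.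
have [z zE] := choice qint.
exists (finfun z); rewrite {1}(crd_crdmx x cu); apply: eq_bigr => l _.
by rewrite -/q zE cE ffunE scaler_int.
Qed.

Lemma discriminantE : exists c : 'I_d -> K, [/\ crdmx c \in unitmx,
  forall x, algebraic_integer x <-> exists z : 'rV[int]_d, crd x *m invmx (crdmx c) = map_mx intr z &
  discriminant K = \det (trace_form c)].
Proof.
rewrite /discriminant; case: xgetP => [D -> /= [c [cb ci] DE]|h]; last first.
  have [c cb] := integral_basis_exists.
  by case: (h (\det (\matrix_(i < d, j < d) field_trace (c`_i * c`_j)))); exists c.
exists (fun l => c`_l); have cu : crdmx (fun l => c`_l) \in unitmx by rewrite -crdmx_basis.
split=> // x; rewrite ci; split=> [[z xE]|[z zE]].
  exists (\row_l z l); rewrite xE crd_bigsum; apply: (canLR (mulmxK cu)).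
  apply/rowP => k; rewrite summxE !mxE.
  by apply: eq_bigr => l _; rewrite -scaler_int crdZ !mxE.
exists (finfun (fun l => z 0 l)); rewrite {1}(crd_crdmx x cu).
by apply: eq_bigr => l _; rewrite zE mxE ffunE scaler_int.
Qed.

End NumberField.

(** * The trace form of a lattice compared with the p-parts of its Grassmann coordinates *)

Section TraceGram.

Variables (R : realType) (K : fieldExtType rat).
Let d := \dim {:K}.

(** Gram matrix of the columns of C for the bilinear form Tr(x^T y) on K^J. Without complex
    conjugation it is rational, so it makes sense at every prime; its determinant is tau. *)
Definition trace_gram J r (C : 'M[K]_(J, r)) : 'M[rat]_r :=
  \matrix_(j, l) field_trace ((C^T *m C) j l).

Section Embeddings.

Variables (L : fieldType) (i : {rmorphism rat -> L}) (s : 'I_d -> {rmorphism K -> L}).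
Hypothesis s_unit : embmx s \in unitmx.

Lemma trace_gram_sigma J r (C : 'M[K]_(J, r)) : map_mx i (trace_gram C) =
  (\mxcol_k map_mx (s k) C)^T *m (\mxcol_k map_mx (s k) C).
Proof.
rewrite tr_mxcol mul_mxrow_mxcol; apply/matrixP => j l.
rewrite [LHS]mxE [X in i X]mxE (trace_sigma i s_unit) summxE; apply: eq_bigr => k _.
by rewrite map_trmx -map_mxM [RHS]mxE.
Qed.

(** The matrices G k are free, so that a different J x J submatrix of s k X can be inserted for each
    embedding. *)
Lemma trace_gram_det J r (C : 'M[K]_(J, r)) (er : (\sum_(k < d) J)%N = r) (G : 'I_d -> 'M[L]_J) :
  i (\det (trace_gram C)) * (\prod_k \det (G k)) ^+ 2 =
  \det (castmx (er, erefl r) (\mxcol_k (G k *m map_mx (s k) C))) ^+ 2.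
Proof.
case: r / er in C *; rewrite castmx_id.
have -> : \mxcol_k (G k *m map_mx (s k) C) = \mxdiag_k G k *m \mxcol_k map_mx (s k) C.
  by rewrite mul_mxdiag_mxcol.
rewrite det_mulmx det_mxdiag exprMn mulrC; congr (_ * _).
by rewrite -det_map_mx trace_gram_sigma det_mulmx det_tr.
Qed.

Lemma trace_gram_mulmx J r q (C : 'M[K]_(J, r)) (Z : 'M[rat]_(r, q)) :
  trace_gram (C *m map_mx (in_alg K) Z) = Z^T *m trace_gram C *m Z.
Proof.
apply: (map_mx_inj (f := i)); rewrite !map_mxM -map_trmx !trace_gram_sigma.
have -> : \mxcol_k map_mx (s k) (C *m map_mx (in_alg K) Z) = (\mxcol_k map_mx (s k) C) *m map_mx i Z.
  rewrite mxcol_mul; apply: eq_mxcol => k; rewrite map_mxM; congr (_ *m _).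
  by apply/matrixP => j l; rewrite !mxE; exact: (rat_rmorphism_eq (s k \o in_alg K) i).
by rewrite trmx_mul !mulmxA.
Qed.

End Embeddings.

(** The columns are copies of c along each coordinate axis: a Z-basis of O^J when c is an integral
    basis. *)
Lemma trace_gram_blocks J (c : 'I_d -> K) :
  trace_gram (\mxrow_(j < J) \matrix_(t < J, l < d) ((t == j)%:R * c l)) =
  \mxdiag_(j < J) trace_form c.
Proof.
apply/matrixP => x y; rewrite [LHS]mxE tr_mxrow mul_mxcol_mxrow [RHS]mxE [in LHS]mxE.
move: (tagnat.sig1 x) (tagnat.sig1 y) (tagnat.sig2 x) (tagnat.sig2 y) => j j' l l'.
rewrite mxE (bigD1 j) //= big1 ?addr0 => [|t tj]; last first.
  by rewrite !mxE (negPf tj) !mul0r.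
rewrite !mxE eqxx mul1r; case: eqP => [jj|_].
  by rewrite conform_mx_id mxE mul1r.
rewrite mul0r mulr0 mxE /field_trace big1 // => k _.
by rewrite mul0r raddf0.
Qed.

Lemma det_trace_gram_blocks J (c : 'I_d -> K) :
  \det (trace_gram (\mxrow_(j < J) \matrix_(t < J, l < d) ((t == j)%:R * c l))) =
  \det (trace_form c) ^+ J.
Proof. by rewrite trace_gram_blocks det_mxdiag prodr_const card_ord. Qed.

(** Q takes the absolute value itself as argument, so embeddings inducing the same place receive the
    same index. Weak approximation relies on this, since it prescribes one target per place. *)
Lemma max_coordinates n (g : 'rV[K]_n) : g != 0 ->
  exists Q : (K -> R) -> 'I_n, forall v, is_absval v ->
    0 < v (g 0 (Q v)) /\ forall j, v (g 0 j) <= v (g 0 (Q v)).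
Proof.
move=> /rV0Pn[j0 gj0].
exists (fun v => [arg max_(j > j0) v (g 0 j)]%O) => v vP.
case: arg_maxP => // j _ jmax; split=> [|k]; last exact: jmax.
by apply: lt_le_trans (jmax j0 isT); rewrite (av_gt0 vP).
Qed.

(** The p-part of the height of g, raised to the power d: a place v is counted once for each
    embedding inducing it, that is d_v times. *)
Definition content (L : fieldType) (a : L -> R) (s : 'I_d -> {rmorphism K -> L}) n (g : 'rV[K]_n) : R :=
  \prod_k \big[Num.max/0]_j a (s k (g 0 j)).

Lemma bigmax_attained n (f : 'I_n -> R) j0 : (forall j, 0 <= f j <= f j0) ->
  \big[Num.max/0]_j f j = f j0.
Proof.
move=> h; apply/le_anti; rewrite le_bigmax andbT.
have h1 j : 0 <= f j by have /andP[] := h j.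
by apply: bigmax_le => [|j _] //; have /andP[] := h j.
Qed.

Section AtPrime.

Variables (p : nat) (le : local_embeddings K (padic_real p R)).
Hypothesis p_prime : prime p.
Hypothesis lu : ultrametric (le_abs le).
Let a := le_abs le.
Let aP := le_absP le.
Let s := le_sigma le.
Let i := le_rat le.
Let vk k : K -> R := sigma_abs a s k.

Lemma content_max n (g : 'rV[K]_n) (Q : (K -> R) -> 'I_n) :
  (forall v, is_absval v -> 0 < v (g 0 (Q v)) /\ forall j, v (g 0 j) <= v (g 0 (Q v))) ->
  content a s g = \prod_k a (s k (g 0 (Q (vk k)))).
Proof.
move=> h; apply: eq_bigr => k _; apply: bigmax_attained => j.
have [_ hk] := h _ (sigma_abs_absval aP s k).
by rewrite (av_ge0 aP) hk.
Qed.

(* Clearing s_k C by the maximal minor X_Q of s_k X turns it into a submatrix of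
   s_k (X C), which has integral entries. *)
Lemma trace_gram_content_le1 N J r (X : 'M[K]_(N, J)) (C : 'M[K]_(J, r)) :
  (\sum_(k < d) J)%N = r -> \rank X = J ->
  (forall t l, algebraic_integer ((X *m C) t l)) ->
  padic_real p R (\det (trace_gram C)) * content a s (grassmann X) ^+ 2 <= 1.
Proof.
move=> er rX XC.
have gX := grassmann_neq0 rX.
have [Q QP] := max_coordinates gX.
rewrite (content_max QP) -(le_ratE le) -/i -(av_prod aP) -(avX aP) -(avM aP).
pose G k : 'M[le_field le]_J := map_mx (s k) (rowsub (tnth (minor_rows (Q (vk k)))) X).
have -> : \prod_k s k (grassmann X 0 (Q (vk k))) = \prod_k \det (G k).
  by apply: eq_bigr => k _; rewrite grassmannE /G det_map_mx.
rewrite (trace_gram_det i (le_unit le) C er) (avX aP) expr_le1 ?(av_ge0 aP) //.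
apply: (ultra_det_le1 aP lu) => x y; rewrite castmxE /= !mxE cast_ord_id.
move: (tagnat.sig1 _) (tagnat.sig2 _) => k t.
have E : (G k *m map_mx (s k) C) t y = s k ((X *m C) (tnth (minor_rows (Q (vk k))) t) y).
  rewrite /G -map_mxM mxE; congr (s k _); rewrite !mxE.
  by apply: eq_bigr => l _; rewrite !mxE.
have h : a (s k ((X *m C) (tnth (minor_rows (Q (vk k))) t) y)) <= 1 by exact: algint_le1.
by rewrite -E [X in a X]mxE in h.
Qed.

(** By Cramer each entry of X A^-1 is 0 or, up to sign, the quotient of a maximal minor of X by the
    largest one. *)
Lemma rowsub_cramer N J (X : 'M[K]_(N, J)) (v : K -> R) Q : is_absval v ->
  0 < v (grassmann X 0 Q) -> (forall k, v (grassmann X 0 k) <= v (grassmann X 0 Q)) ->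
  forall t j, v ((X *m invmx (rowsub (tnth (minor_rows Q)) X)) t j) <= 1.
Proof.
move=> vP gQ gmax t j; set A := rowsub _ X.
have dA : \det A = grassmann X 0 Q by rewrite grassmannE.
have A0 : \det A != 0 by rewrite dA -(av_gt0 vP).
have Au : A \in unitmx by rewrite unitmxE unitfE.
pose u := row t X *m invmx A.
have -> : (X *m invmx A) t j = u 0 j by rewrite /u -row_mul [RHS]mxE.
have uA : u *m A = row t X by rewrite mulmxKV.
clearbody u.
have E : (\matrix_k (if k == j then u else delta_mx 0 k)) *m A =
    rowsub (fun k => if k == j then t else tnth (minor_rows Q) k) X.
  apply/row_matrixP => k; rewrite row_mul rowK; case: eqP => kj.
    by rewrite uA; apply/rowP => l; rewrite !mxE kj eqxx.
  by rewrite -rowE; apply/rowP => l; rewrite !mxE; case: eqP kj.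
have := congr1 (fun B => v (\det B)) E; rewrite /= det_mulmx det_set_row (avM vP) dA.
have [->|[k [e ->]]] := det_rowsub_minor X (fun k => if k == j then t else tnth (minor_rows Q) k).
  by move/eqP; rewrite (av0 vP) mulf_eq0 (gt_eqF gQ) orbF => /eqP ->; exact: ler01.
by rewrite (avM vP) (av_sign vP) mul1r => h; rewrite -(ler_pM2r gQ) mul1r h gmax.
Qed.

Lemma padic_real_int_le1 (z : int) : padic_real p R z%:~R <= 1.
Proof. by rewrite -(le_ratE le) rmorph_int; exact: (ultra_int aP lu). Qed.

Lemma padic_real_nat n : (0 < n)%N -> ~~ (p %| n)%N -> padic_real p R n%:R = 1.
Proof.
move=> n0 pn; rewrite /padic_real /padic_abs pnatr_eq0 -[_ == _]negbK -lt0n n0 /=.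
rewrite -[n%:R]/((n : int)%:~R : rat) numq_int denq_int /= logn1.
by rewrite lognE (negPf pn) !andbF subrr expr0z rmorph1.
Qed.

Lemma padic_realM (x y : rat) : padic_real p R (x * y) = padic_real p R x * padic_real p R y.
Proof. by rewrite /padic_real (padic_absM p_prime) rmorphM. Qed.

(* X XQ^-1 W has p-integral entries for the block matrix W of copies of an integral
   basis. Weak approximation at the places above p gives C' over K close to
   XQ^-1 W, so that C' = C Z up to a factor prime to p. *)
Lemma trace_gram_content_ge N J r (c : 'I_d -> K) (X : 'M[K]_(N, J)) (C : 'M[K]_(J, r)) :
  (\sum_(k < d) J)%N = r -> \rank X = J -> crdmx c \in unitmx ->
  (forall l, algebraic_integer (c l)) ->
  (forall y : 'cV[K]_J, (forall t, algebraic_integer ((X *m y) t 0)) ->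
     exists z : 'cV[int]_r, y = C *m map_mx intr z) ->
  padic_real p R (\det (trace_form c)) ^+ J <=
  padic_real p R (\det (trace_gram C)) * content a s (grassmann X) ^+ 2.
Proof.
move=> er rX cu ci Cgen.
have er' : (\sum_(j < J) d)%N = r by rewrite -er !sum_nat_const !card_ord mulnC.
case: r / er' in C Cgen er *.
have gX := grassmann_neq0 rX.
have [Q QP] := max_coordinates gX.
pose XQ (v : K -> R) : 'M[K]_J := rowsub (tnth (minor_rows (Q v))) X.
pose W : 'M[K]_(J, \sum_(j < J) d) := \mxrow_(j < J) \matrix_(t < J, l < d) ((t == j)%:R * c l).
have Wi t l : algebraic_integer (W t l).
  rewrite /W !mxE; case: eqP => _; rewrite ?mul1r ?mul0r //; exact: (algint_int _ 0).
(* The stacked determinant for W with G k = 1; its square has the p-adic absolute value of det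
   (trace_form c)^J. *)
pose detB : le_field le := \det (castmx (er, erefl _) (\mxcol_k (1%:M *m map_mx (s k) W))).
have detBE : a detB ^+ 2 = padic_real p R (\det (trace_form c)) ^+ J.
  rewrite -(avX aP) -(trace_gram_det i (le_unit le) W er).
  have -> : \prod_(k < d) \det (1%:M : 'M[le_field le]_J) = 1 by rewrite big1 // => k _; exact: det1.
  rewrite expr1n mulr1 det_trace_gram_blocks rmorphXn (avX aP); congr (_ ^+ _).
  exact: le_ratE.
have detB0 : 0 < a detB.
  have : 0 < a detB ^+ 2.
    rewrite detBE exprn_gt0 // -(le_ratE le) (av_gt0 aP) fmorph_eq0.
    exact: (trace_form_neq0 R).
  by rewrite exprn_even_gt0 //= lt_neqAle eq_sym (av_ge0 aP) andbT.
pose Mx : R := 1 + \sum_k \sum_t \sum_j a (s k (X t j)).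
have XM k t j : a (s k (X t j)) <= Mx.
  rewrite /Mx (bigD1 k) //= (bigD1 t) //= (bigD1 j) //= addrCA -!addrA lerDl.
  by rewrite !addr_ge0 ?sumr_ge0 // => *; rewrite ?sumr_ge0 // => *; rewrite ?sumr_ge0 // => *; exact: (av_ge0 aP).
have Mx0 : 0 < Mx.
  rewrite /Mx ltr_pwDl // !sumr_ge0 // => *; rewrite ?sumr_ge0 // => *.
  by rewrite ?sumr_ge0 // => *; exact: (av_ge0 aP).
(* A perturbation of size e < |detB| cannot make the determinant smaller than |detB|, by the
   ultrametric inequality. The bound 1 keeps the entries of X C' integral above p. *)
pose e := Num.min 1 (a detB / 2).
have e0 : 0 < e by rewrite lt_min ltr01 divr_gt0.
have zex (jl : 'I_J * 'I_(\sum_(j < J) d)) : exists zz, forall k,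
    a (s k (zz - (invmx (XQ (vk k)) *m W) jl.1 jl.2)) < e / Mx.
  pose S := [set v : K -> R | is_absval v /\ v p%:R%:A = p%:R^-1].
  have SP v : S v -> is_absval v by case.
  have u01 : 0 < (p%:R^-1 : R) < 1.
    by rewrite invr_gt0 ltr0n prime_gt0 //= invf_lt1 ?ltr0n ?prime_gt0 // ltr1n prime_gt1.
  have Su0 v : S v -> v p%:R%:A = p%:R^-1 by case.
  have wsS v : v \in undup [seq vk k | k <- enum 'I_d] -> S v.
    rewrite mem_undup => /mapP[k _ ->]; split; first exact: sigma_abs_absval.
    rewrite -(padic_real_p p_prime) -(le_ratE le) /vk /sigma_abs; congr a.
    exact: (rat_rmorphism_eq (s k \o in_alg K) i).
  have [zz zzP] := weak_approximation SP u01 Su0 (fun v => (invmx (XQ v) *m W) jl.1 jl.2)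
    (divr_gt0 e0 Mx0) wsS (undup_uniq _).
  exists zz => k; apply: (zzP (vk k)).
  by rewrite mem_undup; apply/mapP; exists k; rewrite ?mem_enum.
have [z zP] := choice zex.
pose C' : 'M[K]_(J, \sum_(j < J) d) := \matrix_(t, l) z (t, l).
pose T k := X *m invmx (XQ (vk k)) *m W.
have T1 k t l : a (s k (T k t l)) <= 1.
  have [h1 h2] := QP _ (sigma_abs_absval aP s k).
  have := rowsub_cramer (sigma_abs_absval aP s k) h1 h2.
  rewrite -/(vk k) -/(XQ _) => h.
  have := @ultra_mul_le R _ a aP lu _ _ _ (map_mx (s k) (X *m invmx (XQ (vk k)))) (map_mx (s k) W) 1 1 ler01 ler01.
  rewrite -map_mxM mulr1 => h'; have := h' _ _ t l; rewrite [(map_mx _ _) t l]mxE; apply.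
    by move=> t' j; rewrite mxE; exact: h.
  by move=> j l'; rewrite mxE; apply: (algint_le1 lu); exact: Wi.
have TC k t l : a (s k ((X *m C') t l) - s k (T k t l)) <= e.
  have -> : s k ((X *m C') t l) - s k (T k t l) =
      (map_mx (s k) X *m map_mx (s k) (C' - invmx (XQ (vk k)) *m W)) t l.
    by rewrite -map_mxM mulmxBr mulmxA [RHS]mxE -rmorphB; congr (s k _); rewrite !mxE.
  have -> : e = Mx * (e / Mx) by rewrite mulrC divfK ?gt_eqF.
  apply: (ultra_mul_le aP lu); [exact: ltW|exact: ltW (divr_gt0 e0 Mx0)| |].
    by move=> t' j; rewrite mxE; exact: XM.
  by move=> j l'; rewrite mxE ltW //; have := zP (j, l') k; rewrite /C' !mxE.
have XC1 k t l : a (s k ((X *m C') t l)) <= 1.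
  have -> : s k ((X *m C') t l) = (s k ((X *m C') t l) - s k (T k t l)) + s k (T k t l) by rewrite subrK.
  rewrite (le_trans (lu _ _)) // ge_max T1 andbT (le_trans (TC _ _ _)) //.
  by rewrite /e ge_min lexx.
(* The entries of X C' are integral above p; an integer m prime to p makes them integral everywhere,
   so that C generates m C'. *)
have [n nP] := choice (fun tl : 'I_N * 'I_(\sum_(j < J) d) => local_algint p_prime lu (fun k => XC1 k tl.1 tl.2)).
pose m := (\prod_tl n tl)%N.
have m0 : (0 < m)%N by rewrite prodn_gt0 // => tl; have [] := nP tl.
have pm : ~~ (p %| m)%N.
  by rewrite Euclid_dvd_prod // big_has; apply/hasPn => tl _; have [_ []] := nP tl.
have mC t l : algebraic_integer ((X *m (m%:R *: C')) t l).
  rewrite -scalemxAr mxE /m (bigD1 (t, l)) //= mulnC natrM -mulrA; apply: algintM => //.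
    by rewrite pmulrn; exact: algint_int.
  by have [_ []] := nP (t, l).
have Zex l : exists z : 'cV[int]_(\sum_(j < J) d), col l (m%:R *: C') = C *m map_mx intr z.
  apply: Cgen => t; suff -> : (X *m col l (m%:R *: C')) t 0 = (X *m (m%:R *: C')) t l by [].
  by rewrite [LHS]mxE [RHS]mxE; apply: eq_bigr => j _; rewrite [X in _ * X]mxE.
have [Z ZP] := choice Zex.
pose ZM : 'M[int]_(\sum_(j < J) d) := \matrix_(j, l) Z l j 0.
have CZ : m%:R *: C' = C *m map_mx (in_alg K) (map_mx intr ZM).
  apply/matrixP => t l; have := congr1 (fun y : 'cV[K]_J => y t 0) (ZP l).
  rewrite [X in X = _ -> _]mxE => ->; rewrite [LHS]mxE [RHS]mxE; apply: eq_bigr => j _.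
  rewrite /ZM !mxE; congr (_ * _); exact: (esym (rmorph_int (in_alg K) _)).
have Cm : m%:R *: C' = C' *m map_mx (in_alg K) (m%:R%:M).
  by rewrite map_scalar_mx mul_mx_scalar rmorph_nat.
(* From m C' = C Z the determinants differ by (det Z)^2, an integer, and by a power of m, a p-adic
   unit. *)
have tC : padic_real p R (\det (trace_gram C')) <= padic_real p R (\det (trace_gram C)).
  have := congr1 (fun B => padic_real p R (\det (trace_gram B))) Cm.
  rewrite /= {1}CZ !(trace_gram_mulmx i (le_unit le)) !det_mulmx !det_tr !padic_realM.
  rewrite det_scalar -natrX padic_real_nat ?expn_gt0 ?m0 //; last first.
    by rewrite Euclid_dvdX // (negPf pm).
  rewrite mul1r mulr1 => <-; rewrite det_map_mx.
  have h1 := padic_real_int_le1 (\det ZM).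
  have h0 q : 0 <= padic_real p R q by rewrite -(le_ratE le) (av_ge0 aP).
  by rewrite mulrAC -[leRHS]mul1r ler_wpM2r // mulr_ile1.
rewrite -detBE; apply: (le_trans (y := padic_real p R (\det (trace_gram C')) * content a s (grassmann X) ^+ 2)); last first.
  by apply: ler_wpM2r tC; rewrite exprn_ge0 // prodr_ge0 // => k _; rewrite bigmax_ge_id.
rewrite (content_max QP) -(le_ratE le) -/i -(av_prod aP) -(avX aP) -(avM aP).
pose G k : 'M[le_field le]_J := map_mx (s k) (XQ (vk k)).
have -> : \prod_k s k (grassmann X 0 (Q (vk k))) = \prod_k \det (G k).
  by apply: eq_bigr => k _; rewrite grassmannE /G det_map_mx.
rewrite (trace_gram_det i (le_unit le) C' er) (avX aP) ler_sqr ?nnegrE ?(av_ge0 aP) //.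
set detA := \det _.
suff dAB : a (detA - detB) <= e.
  have eB : e < a detB.
    have h : a detB / 2 < a detB by rewrite ltr_pdivrMr // ltr_pMr // ltr1n.
    by apply: le_lt_trans h; rewrite /e ge_min lexx orbT.
  rewrite leNgt; apply/negP => AB.
  have := lu (detB - detA) detA; rewrite subrK (avB aP) leNgt => /negP; apply.
  by rewrite gt_max AB andbT (le_lt_trans dAB).
have AE k t y : (G k *m map_mx (s k) C') t y = s k ((X *m C') (tnth (minor_rows (Q (vk k))) t) y).
  by rewrite /G -map_mxM mxE /XQ mul_rowsub_mx [X in s k X]mxE.
have XQu k : XQ (vk k) \in unitmx.
  have [h1 _] := QP _ (sigma_abs_absval aP s k).
  by rewrite unitmxE unitfE -grassmannE -(av_gt0 (sigma_abs_absval aP s k)).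
have BE k t y : (1%:M *m map_mx (s k) W) t y = s k (T k (tnth (minor_rows (Q (vk k))) t) y).
  rewrite mul1mx mxE; congr (s k _).
  (* The rows of X XQ^-1 selected by Q form the identity matrix. *)
  have -> : W = rowsub (tnth (minor_rows (Q (vk k)))) (T k).
    by rewrite /T -!mul_rowsub_mx -/(XQ _) mulmxV // mul1mx.
  by rewrite [LHS]mxE.
rewrite /detA /detB; apply: (ultra_det_perturb aP lu (ltW e0)) => x y;
  rewrite ?castmxE ?[(\mxcol_k _) _ _]mxE ?cast_ord_id ?AE ?BE //.
Qed.

End AtPrime.
End TraceGram.

(** * Heights *)

Section Places.

Variables (R : realType) (K : fieldExtType rat).
Let d := \dim {:K}.

Lemma absolute_valueP (v : K -> R) : absolute_value v <-> is_absval v.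
Proof. by split=> -[]; split. Qed.

Definition places_over p : set (K -> R) :=
  [set v | absolute_value v /\ forall q, v q%:A = padic_real p R q].

Lemma places_over_range p (le : local_embeddings K (padic_real p R)) :
  places_over p = range (sigma_abs (le_abs le) (le_sigma le)).
Proof.
apply/seteqP; split=> [v [/absolute_valueP vP vq]|_ [k _ <-]].
  by have [k ->] := le_places le vP vq; exists k.
split=> [|q]; first by apply/absolute_valueP; exact: (sigma_abs_absval (le_absP le)).
rewrite -(le_ratE le) /sigma_abs; congr (le_abs le).
exact: (rat_rmorphism_eq (le_sigma le k \o in_alg K) (le_rat le)).
Qed.

Lemma range_seq (vk : 'I_d -> K -> R) : range vk = [set` undup [seq vk k | k <- enum 'I_d]].
Proof.
apply/seteqP; split=> [_ [k _ <-]|v] /=; rewrite mem_undup.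
  by apply/mapP; exists k; rewrite ?mem_enum.
by case/mapP=> k _ ->; exists k.
Qed.

Lemma finite_range (vk : 'I_d -> K -> R) : finite_set (range vk).
Proof. by rewrite range_seq; exact: finite_seq. Qed.

(** The exponent [local_degree v] is the multiplicity of v in the list of the vk k. *)
Lemma fsbig_places (vk : 'I_d -> K -> R) (f : (K -> R) -> R) :
  (forall k0, local_degree (vk k0) = #|[pred k | vk k == vk k0]|) ->
  \big[*%R/1]_(v \in range vk) f v ^+ local_degree v = \prod_k f (vk k).
Proof.
move=> deg; rewrite range_seq -fsbig_seq ?undup_uniq //.
set r := [seq vk k | k <- enum 'I_d].
have -> : \prod_k f (vk k) = \big[*%R/1]_(v <- r) f v by rewrite big_map big_enum.
have -> : \big[*%R/1]_(v <- undup r) f v ^+ local_degree v =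
    \big[*%R/1]_(v <- undup r) iterop (count_mem v r) *%R (f v) 1.
  apply: eq_big_seq => v; rewrite mem_undup => /mapP[k _ ->].
  rewrite deg -[RHS]/(f (vk k) ^+ count_mem (vk k) r); congr (_ ^+ _).
  by rewrite cardE size_filter count_map enumT; apply: eq_count => k'; rewrite /= inE.
exact: big_undup_iterop_count.
Qed.

Lemma finite_places_over p : prime p -> finite_set (places_over p).
Proof.
by move=> pp; have [le _] := padic_embeddings R K pp; rewrite (places_over_range le); exact: finite_range.
Qed.

(** Finite truncations of [finite_places]; a product over all finite places is evaluated on one
    outside of which every factor is 1. *)
Let below B : set (K -> R) := [set v | exists2 p, prime p && (p < B)%N & places_over p v].

Let belowS B : below B.+1 = below B `|` (if prime B then places_over B else set0).
Proof.
apply/seteqP; split=> [v [p /andP[pp]]|v [[p /andP[pp pB] vp]|]].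
- rewrite ltnS leq_eqVlt => /orP[/eqP <-|pB] vp; [right|left]; first by rewrite pp.
  by exists p => //; rewrite pp.
- by exists p => //; rewrite pp ltnS ltnW.
by case: ifP => // Bp vB; exists B => //; rewrite Bp ltnS leqnn.
Qed.

Let below_finite B : finite_set (below B).
Proof.
elim: B => [|B ih].
  by rewrite (_ : below 0 = set0) // -subset0 => v [p]; rewrite ltn0 andbF.
by rewrite belowS finite_setU; split=> //; case: ifP => // /finite_places_over.
Qed.

Let below_disjoint B : prime B -> below B `&` places_over B `<=` set0.
Proof.
move=> pB v [[p /andP[pp p_B] [_ vp]] [_ vB]].
have := vp p%:R; rewrite vB (padic_real_p pp) padic_real_nat ?prime_gt0 //; last first.
  by rewrite gtnNdvd // prime_gt0.
move/(congr1 GRing.inv); rewrite invr1 invrK => /eqP; rewrite eq_sym pnatr_eq1 => /eqP p1.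
by move: pp; rewrite p1.
Qed.

Let fsbig_below B (f : (K -> R) -> R) :
  \big[*%R/1]_(v \in below B) f v =
  \prod_(p < B | prime p) \big[*%R/1]_(v \in places_over p) f v.
Proof.
elim: B => [|B ih].
  rewrite big_ord0 (_ : below 0 = set0) ?fsbig_set0 // -subset0 => v [p].
  by rewrite ltn0 andbF.
rewrite [RHS]big_mkcond big_ord_recr -big_mkcond /= -ih belowS; case: ifP => pB.
  by rewrite fsbigU0 //; [exact: finite_places_over|exact: below_disjoint].
by rewrite setU0 mulr1.
Qed.

Lemma fsbig_finite_places B (f : (K -> R) -> R) :
  (forall p v, prime p -> (B <= p)%N -> places_over p v -> f v = 1) ->
  \big[*%R/1]_(v \in finite_places R K) f v =
  \prod_(p < B | prime p) \big[*%R/1]_(v \in places_over p) f v.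
Proof.
move=> f1; rewrite -fsbig_below; apply/esym/fsbig_widen.
  by move=> v [p /andP[pp _] [va vq]]; split=> //; exists p.
move=> v [[va [p pp vq]] vB] /=; apply: (f1 p) => //.
by rewrite leqNgt; apply/negP => pB; apply: vB; exists p => //; rewrite pp.
Qed.

Lemma fsbig_all_places B (f : (K -> R) -> R) : finite_set (infinite_places R K) ->
  (forall p v, prime p -> (B <= p)%N -> places_over p v -> f v = 1) ->
  \big[*%R/1]_(v \in places R K) f v =
  \big[*%R/1]_(v \in infinite_places R K) f v * \big[*%R/1]_(v \in finite_places R K) f v.
Proof.
move=> If f1; rewrite (fsbig_finite_places f1) -fsbig_below -fsbigU0; [|exact: If|exact: below_finite|]; last first.
  move=> v [[_ vi] [p /andP[pp _] [_ vp]]].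
  have := vp p%:R; rewrite vi (padic_real_p pp) normr_nat rmorph_nat => h.
  have : (1 : R) < p%:R by rewrite ltr1n prime_gt1.
  have : (p%:R : R)^-1 < 1 by rewrite invf_lt1 ?ltr0n ?prime_gt0 // ltr1n prime_gt1.
  by rewrite -h => h1 h2; have := lt_trans h1 h2; rewrite ltxx.
apply/esym/fsbig_widen.
  move=> v [vi|[p /andP[pp _] [va vq]]]; [by left|right; split=> //; by exists p].
move=> v [[vi|[va [p pp vq]]] vB] /=; first by case: vB; left.
apply: (f1 p) => //; rewrite leqNgt; apply/negP => pB; apply: vB; right.
by exists p => //; rewrite pp.
Qed.

(** Some multiple n x is an algebraic integer, so |x| <= 1 above every prime greater than n; the
    same for x^-1 gives equality. *)
Lemma abs_one_outside (x : K) : x != 0 -> exists B, forall p v, prime p -> (B <= p)%N ->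
  places_over p v -> v x = 1.
Proof.
have h1 (y : K) : exists B, forall p v, prime p -> (B <= p)%N -> places_over p v -> v y <= 1.
  have [n [n0 [ny _]]] := algint_scale R y; exists n.+1 => p v pp pn vp.
  have [le lu] := padic_embeddings R K pp; move: (vp); rewrite (places_over_range le) => -[k _ vE].
  have := algint_le1 lu k ny.
  rewrite rmorphM (avM (le_absP le)) rmorph_nat.
  have -> : (n%:R : le_field le) = le_rat le n%:R by rewrite rmorph_nat.
  rewrite le_ratE padic_real_nat ?mul1r ?gtnNdvd //.
  by rewrite -[le_abs _ _]/(sigma_abs (le_abs le) (le_sigma le) k y) vE.
move=> x0; have [B1 hB1] := h1 x; have [B2 hB2] := h1 x^-1.
exists (maxn B1 B2) => p v pp; rewrite geq_max => /andP[b1 b2] vp.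
have vP : is_absval v by apply/absolute_valueP; have [] := vp.
have le1 := hB1 p v pp b1 vp; have := hB2 p v pp b2 vp; rewrite (avV vP) => ge1.
apply/le_anti; rewrite le1 /=; rewrite invf_le1 // in ge1.
by rewrite (av_gt0 vP).
Qed.

Lemma max_abs_one_outside n (g : 'rV[K]_n) : g != 0 -> exists B, forall p v, prime p ->
  (B <= p)%N -> places_over p v -> \big[Num.max/0]_j v (g 0 j) = 1.
Proof.
move=> g0; have [Q QP] := max_coordinates R g0.
have hB j : exists B, g 0 j != 0 -> forall p v, prime p -> (B <= p)%N -> places_over p v -> v (g 0 j) = 1.
  have [gj0|gj0] := eqVneq (g 0 j) 0; first by exists 0%N.
  by have [B BP] := abs_one_outside gj0; exists B.
have [B BP] := choice hB; exists (\max_j B j)%N => p v pp pB vp.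
have vP : is_absval v by apply/absolute_valueP; have [] := vp.
have [h0 hm] := QP v vP; rewrite (bigmax_attained (j0 := Q v)) => [|j]; last by rewrite (av_ge0 vP) hm.
apply: (BP _ _ p) => //; first by rewrite -(av_gt0 vP).
by apply: leq_trans pB; exact: (leq_bigmax (F := B)).
Qed.

Lemma powR_exprn (x : R) m n : 0 <= x -> (0 < n)%N -> (x `^ (m%:R / n%:R)) ^+ n = x ^+ m.
Proof.
move=> x0 n0; rewrite -powR_mulrn ?powR_ge0 // -powRrM divfK ?pnatr_eq0 -?lt0n //.
by rewrite powR_mulrn.
Qed.

Let d_gt0 : (0 < d)%N. Proof. exact: (adim_gt0 {:K}%AS). Qed.

(** The d-th power turns the real exponent d_v/d into the integer d_v. *)
Lemma local_height_exp n (g : 'rV[K]_n) (v : K -> R) : is_absval v -> g != 0 ->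
  local_height v g ^+ d = (\big[Num.max/0]_j v (g 0 j)) ^+ local_degree v.
Proof.
move=> vP g0; have [Q QP] := max_coordinates R g0; have [h0 hm] := QP v vP.
have -> : local_height v g = normalized_abs v (g 0 (Q v)).
  apply: bigmax_attained => j; rewrite /normalized_abs powR_ge0 /=.
  by rewrite ge0_ler_powR ?nnegrE ?(av_ge0 vP) ?hm ?divr_ge0 ?ler0n.
rewrite /normalized_abs powR_exprn ?(av_ge0 vP) // (bigmax_attained (j0 := Q v)) // => j.
by rewrite (av_ge0 vP) hm.
Qed.

Lemma local_height_ge0 n (g : 'rV[K]_n) (v : K -> R) : 0 <= local_height v g.
Proof. exact: bigmax_ge_id. Qed.

Lemma local_height_one_outside n (g : 'rV[K]_n) : g != 0 -> exists B, forall p v, prime p ->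
  (B <= p)%N -> places_over p v -> local_height v g = 1.
Proof.
move=> g0; have [B BP] := max_abs_one_outside g0; exists B => p v pp pB vp.
have vP : is_absval v by apply/absolute_valueP; have [] := vp.
apply/eqP; rewrite -(pexpr_eq1 d_gt0 (local_height_ge0 g v)).
by rewrite (local_height_exp vP g0) (BP p) // expr1n.
Qed.

Definition pcontent p n (g : 'rV[K]_n) : R :=
  \big[*%R/1]_(v \in places_over p) (\big[Num.max/0]_j v (g 0 j)) ^+ local_degree v.

Lemma pcontentE p (le : local_embeddings K (padic_real p R)) n (g : 'rV[K]_n) :
  pcontent p g = content (le_abs le) (le_sigma le) g.
Proof.
rewrite /pcontent (places_over_range le).
by rewrite (fsbig_places (fun v => \big[Num.max/0]_j v (g 0 j))) //; exact: le_degree.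
Qed.

Lemma fsbig_prod_exp (A : set (K -> R)) (f g : (K -> R) -> R) n : finite_set A ->
  (forall v, A v -> f v ^+ n = g v) ->
  (\big[*%R/1]_(v \in A) f v) ^+ n = \big[*%R/1]_(v \in A) g v.
Proof.
move=> Af fg; rewrite !fsbig_finite // -prodrXl; apply: eq_big_seq => v.
by rewrite in_fset_set // inE => /fg.
Qed.

(** Every B beyond B0 is allowed, so that several truncated products can be compared at a common
    B. *)
Lemma finite_local_heights n (g : 'rV[K]_n) : g != 0 -> exists B0, forall B, (B0 <= B)%N ->
  (\big[*%R/1]_(v \in finite_places R K) local_height v g) ^+ d =
  \prod_(p < B | prime p) pcontent p g.
Proof.
move=> g0; have [B0 BP] := local_height_one_outside g0; exists B0 => B BB.
rewrite (fsbig_finite_places (B := B)) => [|p v pp pB vp]; last first.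
  by apply: (BP p) => //; exact: leq_trans pB.
rewrite -prodrXl; apply: eq_bigr => p pp; apply: fsbig_prod_exp.
  exact: finite_places_over.
by move=> v [/absolute_valueP vP _]; exact: local_height_exp.
Qed.

Section Infinite.

Variable s : 'I_d -> {rmorphism K -> R[i]}.
Hypothesis s_unit : embmx s \in unitmx.
Let vk k : K -> R := sigma_abs (@normc R) s k.
Hypothesis s_places : forall v : K -> R, is_absval v -> (forall q : rat, v q%:A = ratr `|q|) ->
  exists k, v = vk k.
Hypothesis s_rat : forall k (q : rat), vk k q%:A = ratr `|q|.
Hypothesis s_degree : forall k0, local_degree (vk k0) = #|[pred k | vk k == vk k0]|.

Lemma infinite_places_range : infinite_places R K = range vk.
Proof.
apply/seteqP; split=> [v [/absolute_valueP vP vq]|_ [k _ <-]].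
  by have [k ->] := s_places vP vq; exists k.
by split=> //; apply/absolute_valueP; exact: (sigma_abs_absval (normc_absval R)).
Qed.

Lemma height_exp n (x : 'rV[K]_n) : x != 0 -> exists B0, forall B, (B0 <= B)%N ->
  height R x ^+ d = (\prod_k \big[Num.max/0]_j normc (s k (x 0 j))) * \prod_(p < B | prime p) pcontent p x.
Proof.
move=> x0; have [B1 hB1] := finite_local_heights x0.
have [B2 hB2] := local_height_one_outside x0.
exists (maxn B1 B2) => B; rewrite geq_max => /andP[b1 b2].
have If : finite_set (infinite_places R K) by rewrite infinite_places_range; exact: finite_range.
rewrite /height (negPf x0) (fsbig_all_places (B := B)) // => [|p v pp pB]; last first.
  by apply: hB2 => //; exact: leq_trans pB.
rewrite exprMn (hB1 B) //; congr (_ * _).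
rewrite (fsbig_prod_exp (g := fun v => (\big[Num.max/0]_j v (x 0 j)) ^+ local_degree v)) //.
  by rewrite infinite_places_range (fsbig_places (fun v => \big[Num.max/0]_j v (x 0 j))).
by move=> v [/absolute_valueP vP _]; exact: local_height_exp.
Qed.

Definition arch_norm2 n (g : 'rV[K]_n) : R := \prod_k \sum_j normc (s k (g 0 j)) ^+ 2.

(** The power is 2d rather than d because the archimedean factor carries the exponent d_v/(2d). *)
Lemma height2_exp n (g : 'rV[K]_n) : g != 0 -> exists B0, forall B, (B0 <= B)%N ->
  height2 R g ^+ (2 * d) = arch_norm2 g * (\prod_(p < B | prime p) pcontent p g) ^+ 2.
Proof.
move=> g0; have [B0 hB0] := finite_local_heights g0; exists B0 => B /hB0 hB.
rewrite /height2 (negPf g0) exprMn mulrC [in X in _ * X]mulnC [in X in _ * X]exprM hB; congr (_ * _).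
rewrite (fsbig_prod_exp (g := fun v => (\sum_j v (g 0 j) ^+ 2) ^+ local_degree v)).
- by rewrite infinite_places_range (fsbig_places (fun v => \sum_j v (g 0 j) ^+ 2)).
- by rewrite infinite_places_range; exact: finite_range.
move=> v [/absolute_valueP vP _]; rewrite /local_height2 -natrM powR_exprn ?muln_gt0 //.
by rewrite sumr_ge0 // => j _; rewrite exprn_ge0 // (av_ge0 vP).
Qed.

Lemma prod_logn n B : (0 < n < B)%N -> \prod_(p < B | prime p) (p%:R : R) ^+ logn p n = n%:R.
Proof.
case: B => [|B] /andP[n0 nB]; first by [].
under eq_bigr do rewrite -natrX; rewrite -natr_prod; congr (_%:R).
rewrite -[RHS](partnT n0) (widen_partn _ (_ : n <= B)%N) // big_mkord big_mkcond /=.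
by apply: eq_bigr => p _; case: ifP => // pp; rewrite lognE pp.
Qed.

Lemma padic_product_formula (q : rat) : q != 0 -> exists B0, forall B, (B0 <= B)%N ->
  \prod_(p < B | prime p) padic_real p R q = (ratr `|q|)^-1.
Proof.
move=> q0; exists (maxn `|numq q| `|denq q|).+1 => B.
rewrite gtn_max => /andP[nB dB].
have n0 : (0 < `|numq q|)%N by rewrite absz_gt0 numq_eq0.
have d0 : (0 < `|denq q|)%N by rewrite absz_gt0 denq_eq0.
transitivity ((`|denq q|%N)%:R / (`|numq q|%N)%:R : R).
  rewrite -(prod_logn (n := `|denq q|) (B := B)) ?d0 // -(prod_logn (n := `|numq q|) (B := B)) ?n0 //.
  rewrite -prodf_div; apply: eq_bigr => p pp.
  rewrite /padic_real /padic_abs (negPf q0) fmorphXz rmorph_nat expfzDr ?pnatr_eq0 -?lt0n ?prime_gt0 //.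
  by rewrite -exprnN.
rewrite -{3}[q]divq_num_den normrM normfV rmorphM fmorphV invfM invrK mulrC.
by rewrite -!intr_norm -!abszE !rmorph_int.
Qed.

Lemma prime_prod_le (f g : nat -> R) B : (forall p, prime p -> 0 <= f p <= g p) ->
  \prod_(p < B | prime p) f p <= \prod_(p < B | prime p) g p.
Proof. by move=> h; apply: ler_prod => p; exact: h. Qed.

Lemma arch_norm2_ge0 n (g : 'rV[K]_n) : 0 <= arch_norm2 g.
Proof.
by apply: prodr_ge0 => k _; apply: sumr_ge0 => j _; rewrite exprn_ge0 // (av_ge0 (normc_absval R)).
Qed.

Lemma padic_real_ge0 p q : prime p -> 0 <= padic_real p R q.
Proof. by move=> pp; have [uP _] := padic_real_absval pp R; exact: (av_ge0 uP). Qed.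

Lemma content_ge0 (L : fieldType) (a : L -> R) (t : 'I_d -> {rmorphism K -> L}) n (g : 'rV[K]_n) :
  0 <= content a t g.
Proof. by apply: prodr_ge0 => k _; exact: bigmax_ge_id. Qed.

(** The bounds of [trace_gram_content_le1] are multiplied over the primes, and the product formula
    turns the product of the |tau|_p into 1/|tau|. *)
Lemma height2_le_trace_gram N J r (X : 'M[K]_(N, J)) (C : 'M[K]_(J, r)) :
  (\sum_(k < d) J)%N = r -> \rank X = J ->
  (forall t l, algebraic_integer ((X *m C) t l)) -> \det (trace_gram C) != 0 ->
  height2 R (grassmann X) ^+ (2 * d) <= ratr `|\det (trace_gram C)| * arch_norm2 (grassmann X).
Proof.
move=> er rX XC t0.
have gX := grassmann_neq0 rX.
have [B1 hB1] := height2_exp gX; have [B2 hB2] := padic_product_formula t0.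
rewrite (hB1 (maxn B1 B2)) ?leq_maxl // mulrC ler_wpM2r ?arch_norm2_ge0 //.
have h : \prod_(p < maxn B1 B2 | prime p)
    (padic_real p R (\det (trace_gram C)) * pcontent p (grassmann X) ^+ 2) <= 1.
  apply: prodr_ile1 => p pp; have [le lu] := padic_embeddings R K pp.
  by rewrite mulr_ge0 ?padic_real_ge0 ?sqr_ge0 // (pcontentE le) trace_gram_content_le1.
rewrite big_split /= prodrXl hB2 ?leq_maxr // in h.
have q0 : 0 < (ratr `|\det (trace_gram C)| : R) by rewrite ltr0q normr_gt0.
rewrite -(ler_pM2l (_ : 0 < (ratr `|\det (trace_gram C)| : R)^-1)) ?invr_gt0 // mulrA mulVf ?gt_eqF // mul1r in h *.
Qed.

(** The product of the bounds of [trace_gram_content_ge]. The exponent J of the discriminant comes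
    from the J copies of c with which C is compared. *)
Lemma trace_gram_le_height2 N J r (c : 'I_d -> K) (X : 'M[K]_(N, J)) (C : 'M[K]_(J, r)) :
  (\sum_(k < d) J)%N = r -> \rank X = J -> crdmx c \in unitmx ->
  (forall l, algebraic_integer (c l)) ->
  (forall y : 'cV[K]_J, (forall t, algebraic_integer ((X *m y) t 0)) ->
     exists z : 'cV[int]_r, y = C *m map_mx intr z) ->
  \det (trace_gram C) != 0 /\
  ratr `|\det (trace_gram C)| * arch_norm2 (grassmann X) <=
  ratr `|\det (trace_form c)| ^+ J * height2 R (grassmann X) ^+ (2 * d).
Proof.
move=> er rX cu ci Cgen.
have local p : prime p -> 0 < padic_real p R (\det (trace_form c)) ^+ J <=
    padic_real p R (\det (trace_gram C)) * pcontent p (grassmann X) ^+ 2.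
  move=> pp; have [le lu] := padic_embeddings R K pp; rewrite (pcontentE le).
  rewrite (trace_gram_content_ge pp lu er rX cu ci Cgen) andbT exprn_gt0 //.
  have [uP _] := padic_real_absval pp R; rewrite (av_gt0 uP).
  exact: (trace_form_neq0 R).
have gX := grassmann_neq0 rX.
(* The local lower bound is positive, so a single prime is enough; 2 is taken. *)
have t0 : \det (trace_gram C) != 0.
  have /andP[h1 h2] := local 2%N isT; have := lt_le_trans h1 h2; apply: contraTneq => ->.
  by rewrite /padic_real padic_abs0 rmorph0 mul0r ltxx.
split=> //.
have D0 := trace_form_neq0 R cu.
have [B1 hB1] := height2_exp gX; have [B2 hB2] := padic_product_formula t0.
have [B3 hB3] := padic_product_formula D0.
pose B := maxn B1 (maxn B2 B3).
rewrite (hB1 B) ?leq_maxl // mulrCA mulrC ler_wpM2l ?arch_norm2_ge0 //.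
have := @prime_prod_le (fun p => padic_real p R (\det (trace_form c)) ^+ J)
   (fun p => padic_real p R (\det (trace_gram C)) * pcontent p (grassmann X) ^+ 2) B.
rewrite big_split /= !prodrXl hB2 ?hB3 ?leq_max ?leqnn ?orbT // => h.
have q0 : 0 < (ratr `|\det (trace_gram C)| : R) by rewrite ltr0q normr_gt0.
have D1 : 0 < (ratr `|\det (trace_form c)| : R) by rewrite ltr0q normr_gt0.
have {}h := h (fun p pp => andb_true_intro (conj (ltW (proj1 (andP (local p pp)))) (proj2 (andP (local p pp))))).
rewrite -ler_pdivrMl ?exprn_gt0 // -exprVn mulrC -ler_pdivlMl //.
Qed.

(** The norm q of a nonzero coordinate bounds the archimedean part and every p-part from below, and
    the product formula makes these bounds cancel. *)
Lemma height2_ge1 n (g : 'rV[K]_n) : g != 0 -> 1 <= height2 R g.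
Proof.
move=> g0; have /rV0Pn[j gj0] := g0.
pose i : {rmorphism rat -> R[i]} := real_complex R \o ratr.
pose q := \det (mulmat (g 0 j)).
have q0 : q != 0.
  rewrite -(fmorph_eq0 i) (norm_sigma i s_unit); apply/prodf_neq0 => k _.
  by rewrite fmorph_eq0.
have qE : \prod_k normc (s k (g 0 j)) = ratr `|q|.
  rewrite -(av_prod (normc_absval R)) -(norm_sigma i s_unit) -/q.
  by rewrite -[i q]/(real_complex R (ratr q)) normc_real ratr_norm.
have [B1 hB1] := height2_exp g0; have [B2 hB2] := padic_product_formula q0.
have h0 : 0 <= height2 R g.
  rewrite /height2 (negPf g0) mulr_ge0 //; apply: prodr_ge0 => v _; first exact: local_height_ge0.
  exact: powR_ge0.
have dd : (0 < 2 * d)%N by rewrite muln_gt0.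
rewrite -(ler_pXn2r dd) ?nnegrE // expr1n (hB1 (maxn B1 B2)) ?leq_maxl //.
have q1 : 0 < (ratr `|q| : R) by rewrite ltr0q normr_gt0.
have E : 1 = ratr `|q| ^+ 2 * ((ratr `|q|)^-1) ^+ 2 :> R by rewrite -exprMn divff ?expr1n ?gt_eqF.
rewrite [leLHS]E; apply: ler_pM; rewrite ?exprn_ge0 ?invr_ge0 ?(ltW q1) //.
  rewrite -qE -prodrXl; apply: ler_prod => k _; rewrite sqr_ge0 /=.
  by rewrite (bigD1 j) //= lerDl sumr_ge0 // => l _; rewrite sqr_ge0.
rewrite -(hB2 (maxn B1 B2)) ?leq_maxr // ler_sqr ?nnegrE.
- apply: ler_prod => p pp; rewrite padic_real_ge0 //=.
  have [le lu] := padic_embeddings R K pp; rewrite (pcontentE le).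
  rewrite -(le_ratE le) (norm_sigma (le_rat le) (le_unit le)) (av_prod (le_absP le)).
  by apply: ler_prod => k _; rewrite (av_ge0 (le_absP le)) /=; exact: le_bigmax.
- by apply: prodr_ge0 => p pp; exact: padic_real_ge0.
apply: prodr_ge0 => p pp; have [le lu] := padic_embeddings R K pp.
by rewrite (pcontentE le) content_ge0.
Qed.

Lemma height_le n (x : 'rV[K]_n) (B : R) : 0 <= B -> (forall j, algebraic_integer (x 0 j)) ->
  (forall k j, normc (s k (x 0 j)) <= B) -> height R x <= B.
Proof.
move=> B0 xi xB; have [->|x0] := eqVneq x 0; first by rewrite /height eqxx.
have h0 : 0 <= height R x.
  by rewrite /height (negPf x0) prodr_ge0 // => v _; exact: local_height_ge0.
have [B1 hB1] := height_exp x0.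
rewrite -(ler_pXn2r d_gt0) ?nnegrE // (hB1 B1) // -[leRHS]mulr1.
apply: ler_pM.
- by apply: prodr_ge0 => k _; exact: bigmax_ge_id.
- apply: prodr_ge0 => p pp; have [le lu] := padic_embeddings R K pp.
  by rewrite (pcontentE le) content_ge0.
- have -> : B ^+ d = \prod_(k < d) B by rewrite prodr_const card_ord.
  by apply: ler_prod => k _; rewrite bigmax_ge_id /=; apply: bigmax_le.
apply: prodr_ile1 => p pp; have [le lu] := padic_embeddings R K pp.
rewrite (pcontentE le) content_ge0 /=; apply: prodr_ile1 => k _.
rewrite bigmax_ge_id /=; apply: bigmax_le => // j _.
by apply: (algint_le1 lu); exact: xi.
Qed.

End Infinite.
End Places.

(** * Lattices of integral points of a subspace *)

Section LatticeBasis.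

Variable K : fieldExtType rat.
Let d := \dim {:K}.
Variable c : 'I_d -> K.
Hypothesis cu : crdmx c \in unitmx.

(** Coordinates with respect to c, written in one row: for an integral basis c this identifies O^n
    with Z^(nd). *)
Definition coords n (y : 'cV[K]_n) : 'rV[rat]_(n * d) :=
  mxvec ((\matrix_t crd (y t 0)) *m invmx (crdmx c)).

Definition of_coords n (u : 'rV[rat]_(n * d)) : 'cV[K]_n :=
  \col_t \sum_l vec_mx u t l *: c l.

Lemma coordsK n : cancel (@coords n) (@of_coords n).
Proof.
move=> y; apply/colP => t; rewrite mxE mxvecK [RHS](crd_crdmx _ cu).
by apply: eq_bigr => l _; rewrite -[in RHS](rowK (fun t => crd (y t 0))) -row_mul [in RHS]mxE.
Qed.

Lemma of_coordsK n : cancel (@of_coords n) (@coords n).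
Proof.
move=> u; apply: (canLR vec_mxK); apply: (canLR (mulmxK cu)).
apply/row_matrixP => t; rewrite rowK row_mul mxE crd_bigsum.
by apply/rowP => k; rewrite summxE !mxE; apply: eq_bigr => l _; rewrite crdZ !mxE.
Qed.

Lemma coordsD n (a : rat) (y y' : 'cV[K]_n) :
  coords (a%:A *: y + y') = a *: coords y + coords y'.
Proof.
rewrite /coords -!linearP /= scalemxAl -mulmxDl; congr (mxvec (_ *m _)).
apply/row_matrixP => t; rewrite linearP /= !rowK !mxE crdD -crdZ.
by rewrite mulr_algl.
Qed.

Lemma of_coordsD n (a : rat) (u u' : 'rV[rat]_(n * d)) :
  of_coords (a *: u + u') = a%:A *: of_coords u + of_coords u'.
Proof.
apply/colP => t; rewrite !mxE mulr_sumr -big_split; apply: eq_bigr => l _.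
by rewrite linearP /= !mxE scalerDl -scalerA mulr_algl.
Qed.

Lemma coords_integral n (y : 'cV[K]_n) :
  (forall x, algebraic_integer x <-> exists z : 'rV[int]_d, crd x *m invmx (crdmx c) = map_mx intr z) ->
  (forall t, algebraic_integer (y t 0)) <-> exists z : 'rV[int]_(n * d), coords y = map_mx intr z.
Proof.
move=> ci; split=> [yi|[z zE] t].
  have [z zE] := choice (fun t => (ci _).1 (yi t)).
  exists (mxvec (\matrix_t z t)); rewrite map_mxvec; congr mxvec.
  by apply/row_matrixP => t; rewrite row_mul -map_row !rowK zE.
apply/ci; exists (row t (vec_mx z)); rewrite map_row map_vec_mx -zE mxvecK.
by rewrite row_mul rowK.
Qed.

Section Subspace.

Variables (N J : nat) (X : 'M[K]_(N, J)).

Let f (u : 'rV[rat]_(J * d)) : 'rV[rat]_(N * d) := coords (X *m of_coords u).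

Let f_linear : linear f.
Proof. by move=> a u v; rewrite /f of_coordsD mulmxDr -scalemxAr coordsD. Qed.

HB.instance Definition _ := GRing.isLinear.Build rat _ _ _ f f_linear.

Lemma of_coords_mul q (w : 'rV[rat]_q) (U : 'M[rat]_(q, J * d)) :
  of_coords (w *m U) = (\matrix_(t, l) of_coords (row l U) t 0) *m map_mx (in_alg K) w^T.
Proof.
apply/colP => t; rewrite !mxE.
under [RHS]eq_bigr => l _ do rewrite !mxE mulr_suml.
rewrite exchange_big; apply: eq_bigr => l _ /=.
rewrite mulmx_sum_row linear_sum summxE scaler_suml; apply: eq_bigr => k _.
by rewrite linearZ !mxE -scalerAl mulr_algr scalerA mulrC.
Qed.

(** In coordinates, y -> X y is an injective Q-linear map with matrix A. A Z-basis of the integral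
    points of the row space of A, pulled back along A, gives the columns of C. *)
Lemma integral_lattice_basis : \rank X = J ->
  (forall x, algebraic_integer x <-> exists z : 'rV[int]_d, crd x *m invmx (crdmx c) = map_mx intr z) ->
  exists C : 'M[K]_(J, J * d), (forall t l, algebraic_integer ((X *m C) t l)) /\
    forall y : 'cV[K]_J, (forall t, algebraic_integer ((X *m y) t 0)) ->
    exists z : 'cV[int]_(J * d), y = C *m map_mx intr z.
Proof.
move=> rX ci; have /row_fullP[X' X'X] : row_full X by rewrite /row_full rX.
pose A := lin1_mx f.
have fE u : f u = u *m A by rewrite mul_rV_lin1.
have Af : row_free A.
  apply: inj_row_free => u; rewrite -fE => /(congr1 (@of_coords N)); rewrite coordsK.
  have c0 n : of_coords (0 : 'rV_(n * d)) = 0.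
    by apply/colP => t; rewrite !mxE big1 // => l _; rewrite linear0 mxE scale0r.
  rewrite c0 => /(congr1 (mulmx X')); rewrite mulmx0 mulmxA X'X mul1mx => u0.
  by rewrite -[u]of_coordsK u0 -(c0 J) of_coordsK.
have rk : \rank A = (J * d)%N by apply/eqP.
have [B [D [BD BA Bgen]]] := integral_points_basis A.
rewrite rk in B D BD BA Bgen.
have [U UE] := submxP BA.
exists (\matrix_(t, l) of_coords (row l U) t 0); split=> [t l|y yi].
  pose y : 'cV[K]_N := X *m of_coords (row l U).
  have -> : (X *m (\matrix_(t, l) of_coords (row l U) t 0)) t l = y t 0.
    by rewrite [LHS]mxE [RHS]mxE; apply: eq_bigr => j _; rewrite [X in _ * X]mxE.
  move: t; apply/coords_integral => //; exists (row l B).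
  by rewrite -[LHS]/(f _) fE -row_mul -UE map_row.
have [v vE] := (coords_integral _ ci).1 yi.
have uA : coords y *m A = map_mx intr v by rewrite -fE /f coordsK.
have := Bgen (map_mx intr v); rewrite -uA submxMl => /(_ isT).
rewrite uA UE mulmxA => vB.
have uE : coords y = map_mx intr v *m map_mx intr D *m U.
  by apply: (row_free_inj Af); rewrite uA.
exists (v *m D)^T; rewrite -{1}[y]coordsK uE of_coords_mul -map_mxM -map_trmx; congr (_ *m _).
by apply/matrixP => i j; rewrite !mxE; exact: (rmorph_int (in_alg K)).
Qed.

End Subspace.
End LatticeBasis.

(** * The real Gram matrix of the conjugates *)

Section Gram.

Variables (R : realType) (K : fieldExtType rat).
Let d := \dim {:K}.
Variable s : 'I_d -> {rmorphism K -> R[i]}.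
Hypothesis s_unit : embmx s \in unitmx.
Let i : {rmorphism rat -> R[i]} := real_complex R \o ratr.

Lemma mul_conjc_normc (z : R[i]) : z * conjc z = real_complex R (normc z ^+ 2).
Proof.
case: z => x y; rewrite /= sqr_sqrtr ?addr_ge0 ?sqr_ge0 //.
by apply/eqP; rewrite eq_complex /=; apply/andP; split; apply/eqP; ring.
Qed.

(** The conjugate of an embedding is an embedding, and the sigma k exhaust the embeddings without
    repetition. *)
Lemma conj_embedding : exists pi : 'I_d -> 'I_d, involutive pi /\
  forall k x, conjc (s k x) = s (pi k) x.
Proof.
have [pi piE] := choice (fun k => rmorphism_sigma i s_unit (conjc \o s k)).
exists pi; split=> // k; apply: (sigma_inj s_unit) => x.
by rewrite -piE /= -piE /= conjcK.
Qed.

Definition gram N r (Y : 'M[K]_(N, r)) : 'M[R[i]]_r :=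
  \sum_k (map_mx (s k) Y)^T *m map_mx conjc (map_mx (s k) Y).

Lemma gram_conj N r (Y : 'M[K]_(N, r)) : map_mx conjc (gram Y) = gram Y.
Proof.
have [pi [piK piE]] := conj_embedding.
apply/matrixP => a b; rewrite mxE !summxE rmorph_sum [RHS](reindex_inj (inv_inj piK)).
apply: eq_bigr => k _; rewrite !mxE rmorph_sum; apply: eq_bigr => t _.
by rewrite !mxE rmorphM -!piE.
Qed.

Lemma gram_tr N r (Y : 'M[K]_(N, r)) : (gram Y)^T = gram Y.
Proof.
rewrite -[RHS]gram_conj /gram linear_sum /= raddf_sum /=; apply: eq_bigr => k _.
rewrite trmx_mul trmxK map_mxM map_trmx; congr (_ *m _).
  by apply/matrixP => a b; rewrite !mxE.
by apply/matrixP => a b; rewrite !mxE; apply/esym/conjcK.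
Qed.

(** With S the stacked conjugates of C, the Gram matrix is S^T times the block diagonal of the H k
    times the conjugate of S. Here (det S)^2 is the image of tau, and Cauchy-Binet makes det (H k) a
    sum of squared absolute values of minors. *)
Lemma det_gram N J r (X : 'M[K]_(N, J)) (C : 'M[K]_(J, r)) : (\sum_(k < d) J)%N = r ->
  \det (gram (X *m C)) = real_complex R (ratr `|\det (trace_gram C)| * arch_norm2 s (grassmann X)).
Proof.
move=> er; case: r / er in C *.
pose S := \mxcol_k map_mx (s k) C.
pose H k := (map_mx (s k) X)^T *m map_mx conjc (map_mx (s k) X).
have -> : gram (X *m C) = S^T *m \mxdiag_k H k *m map_mx conjc S.
  rewrite -mulmxA.
  have -> : map_mx conjc S = \mxcol_k map_mx conjc (map_mx (s k) C).
    by apply/matrixP => a b; rewrite !mxE.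
  rewrite mul_mxdiag_mxcol tr_mxcol mul_mxrow_mxcol; apply: eq_bigr => k _.
  by rewrite /H !map_mxM trmx_mul !mulmxA.
rewrite !det_mulmx det_tr det_map_mx det_mxdiag mulrAC mul_conjc_normc [RHS]rmorphM; congr (_ * _).
  congr (real_complex R _); rewrite -(avX (normc_absval R)).
  have -> : \det S ^+ 2 = i (\det (trace_gram C)).
    by rewrite -det_map_mx (trace_gram_sigma i s_unit) det_mulmx det_tr.
  by rewrite -[i _]/(real_complex R (ratr _)) normc_real ratr_norm.
rewrite /arch_norm2 rmorph_prod; apply: eq_bigr => k _.
rewrite /H cauchy_binet trmxK rmorph_sum; apply: eq_bigr => Q _.
have gE : map_mx (s k) (grassmann X) 0 Q = s k (grassmann X 0 Q) by rewrite mxE.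
by rewrite !map_grassmann [X in _ * X]mxE !gE; exact: mul_conjc_normc.
Qed.

Lemma gram_form N r (Y : 'M[K]_(N, r)) (u : 'rV[R]_r) :
  (map_mx (real_complex R) u *m gram Y *m (map_mx (real_complex R) u)^T) 0 0 =
  real_complex R (\sum_k \sum_t normc ((map_mx (s k) Y *m (map_mx (real_complex R) u)^T) t 0) ^+ 2).
Proof.
set w := (map_mx _ u)^T; rewrite /gram mulmx_sumr mulmx_suml summxE rmorph_sum.
apply: eq_bigr => k _; rewrite -[map_mx _ u]trmxK -/w.
have wc : map_mx conjc w = w.
  by apply/matrixP => a b; rewrite !mxE /= oppr0.
rewrite mulmxA -trmx_mul -mulmxA -{2}wc -map_mxM mxE rmorph_sum; apply: eq_bigr => t _.
by rewrite [X in X * _]mxE [X in _ * X]mxE mul_conjc_normc.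
Qed.

(** The matrix is real because conjugation permutes the embeddings, and definite because X has full
    rank and the stacked conjugates of C are invertible when tau is not 0. *)
Lemma real_gram N J r (X : 'M[K]_(N, J)) (C : 'M[K]_(J, r)) : (\sum_(k < d) J)%N = r ->
  \rank X = J -> \det (trace_gram C) != 0 ->
  exists G : 'M[R]_r, [/\ G^T = G,
    forall u : 'rV[R]_r, u != 0 -> 0 < (u *m G *m u^T) 0 0,
    \det G = ratr `|\det (trace_gram C)| * arch_norm2 s (grassmann X) &
    forall u : 'rV[R]_r, (u *m G *m u^T) 0 0 =
      \sum_k \sum_t normc ((map_mx (s k) (X *m C) *m (map_mx (real_complex R) u)^T) t 0) ^+ 2].
Proof.
move=> er rX t0; pose G : 'M[R]_r := \matrix_(a, b) complex.Re (gram (X *m C) a b).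
have GE : map_mx (real_complex R) G = gram (X *m C).
  apply/matrixP => a b; rewrite !mxE.
  have := congr1 (fun M : 'M[R[i]]_r => M a b) (gram_conj (X *m C)); rewrite /= mxE.
  case: (gram _ a b) => x y [/eqP]; rewrite eq_sym -subr_eq0 opprK -mulr2n mulrn_eq0 /= => /eqP ->.
  by [].
have rc_inj : injective (real_complex R) by exact: fmorph_inj.
have form (u : 'rV[R]_r) : (u *m G *m u^T) 0 0 =
    \sum_k \sum_t normc ((map_mx (s k) (X *m C) *m (map_mx (real_complex R) u)^T) t 0) ^+ 2.
  apply: rc_inj; apply: (etrans _ (gram_form (X *m C) u)).
  by rewrite -GE map_trmx -!map_mxM [RHS]mxE.
exists G; split=> //.
- apply: (map_mx_inj (f := real_complex R)).
  by rewrite -map_trmx GE gram_tr.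
- move=> u u0; rewrite form lt_neqAle; apply/andP; split; last first.
    by apply: sumr_ge0 => k _; apply: sumr_ge0 => t _; exact: sqr_ge0.
  apply: contra u0; rewrite eq_sym => /eqP u0.
  have /row_fullP[X' X'X] : row_full X by rewrite /row_full rX.
  set w := (map_mx (real_complex R) u)^T in u0.
  have wk k : map_mx (s k) C *m w = 0.
    have h : map_mx (s k) (X *m C) *m w = 0.
      apply/colP => t; rewrite [RHS]mxE; apply/eqP.
      have := u0; move/eqP; rewrite psumr_eq0 => [/allP /(_ k)|k' _]; last first.
        by apply: sumr_ge0 => t' _; exact: sqr_ge0.
      rewrite mem_index_enum => /(_ isT) /=; rewrite psumr_eq0 => [/allP /(_ t)|t' _]; last exact: sqr_ge0.
      rewrite mem_index_enum => /(_ isT) /=; rewrite sqrf_eq0.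
      by rewrite (av_eq0 (normc_absval R)).
    by rewrite -[LHS]mul1mx -(map_mx1 (s k)) -X'X map_mxM -mulmxA [map_mx (s k) X *m _]mulmxA -map_mxM h mulmx0.
  subst r.
  pose S := \mxcol_k map_mx (s k) C.
  have Su : S \in unitmx.
    rewrite unitmxE unitfE -sqrf_eq0; move: t0; rewrite -(fmorph_eq0 i) -det_map_mx.
    by rewrite (trace_gram_sigma i s_unit) det_mulmx det_tr expr2.
  have Sw : S *m w = 0.
    by rewrite mxcol_mul; under eq_mxcol do rewrite wk; apply/matrixP => a b; rewrite !mxE.
  have w0 : w = 0 by rewrite -[w](mulKmx Su) Sw mulmx0.
  apply/eqP/rowP => a; rewrite [RHS]mxE; have /colP/(_ a) := w0.
  rewrite /w [X in X = _]mxE [X in X = _]mxE [X in _ = X]mxE => h.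
  by apply: rc_inj; rewrite h rmorph0.
- by apply: rc_inj; rewrite -det_map_mx GE (det_gram X C er).
Qed.

End Gram.

(** * Counting integral points of a subspace with bounded conjugates *)

Section Counting.

Variables (R : realType) (K : fieldExtType rat).
Let d := \dim {:K}.

Lemma integral_data : exists c : 'I_d -> K, [/\ crdmx c \in unitmx,
  forall l, algebraic_integer (c l),
  forall x, algebraic_integer x <-> exists z : 'rV[int]_d, crd x *m invmx (crdmx c) = map_mx intr z &
  discriminant K = \det (trace_form c)].
Proof.
have [c [cu ci cD]] := discriminantE R K; exists c; split=> // l.
apply/ci; exists (delta_mx 0 l).
have -> : crd (c l) = row l (crdmx c) by rewrite rowK.
rewrite -row_mul mulmxV //; apply/rowP => k; rewrite !mxE eqxx /= eq_sym.
by case: eqP.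
Qed.

Lemma discriminant_ge1 : 1 <= (ratr `|discriminant K| : R).
Proof.
have [c [cu ci _ ->]] := integral_data.
have [z zE] := det_trace_form_int R ci.
rewrite zE -intr_norm ratr_int ler1z; have := trace_form_neq0 R cu; rewrite zE intr_eq0.
by rewrite -normr_gt0; case: (`|z|) => [[|n]|].
Qed.

Lemma rank_basis_matrix N (V : {vspace 'rV[K]_N}) : \rank (basis_matrix V) = \dim V.
Proof.
rewrite -mxrank_tr; apply/eqP; rewrite -[_ == _]/(row_free _); apply: inj_row_free => u uX.
have /freeP f : free (vbasis V) by exact: basis_free (vbasisP V).
apply/rowP => j; rewrite [RHS]mxE; apply: (f (fun j => u 0 j)).
rewrite -[RHS]uX; apply/rowP => t; rewrite summxE [RHS]mxE.
by apply: eq_bigr => l _; rewrite !mxE.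
Qed.

Lemma mem_basis_matrix N (V : {vspace 'rV[K]_N}) x :
  (x \in V) <-> exists y : 'cV[K]_(\dim V), x^T = basis_matrix V *m y.
Proof.
split=> [xV|[y xE]].
  exists (\col_j coord (vbasis V) j x); apply/colP => t; rewrite mxE {1}(coord_vbasis xV).
  by rewrite summxE mxE; apply: eq_bigr => j _; rewrite !mxE mulrC.
have -> : x = \sum_j y j 0 *: (vbasis V)`_j.
  apply/rowP => t; have /colP/(_ t) := xE; rewrite [X in X = _]mxE [X in _ = X]mxE => ->.
  by rewrite summxE; apply: eq_bigr => j _; rewrite !mxE mulrC.
by apply: memv_suml => j _; apply: memvZ; apply: vbasis_mem; rewrite mem_nth ?size_tuple.
Qed.

Lemma diag_form n (G : 'M[R]_n) j :
  G j j = ((delta_mx 0 j : 'rV[R]_n) *m G *m (delta_mx 0 j : 'rV[R]_n)^T) 0 0.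
Proof. by rewrite -rowE trmx_delta -colE !mxE. Qed.

Section Embeddings.

Variable s : 'I_d -> {rmorphism K -> R[i]}.
Hypothesis s_unit : embmx s \in unitmx.
Let vk k : K -> R := sigma_abs (@normc R) s k.
Hypothesis s_places : forall v : K -> R, is_absval v -> (forall q : rat, v q%:A = ratr `|q|) ->
  exists k, v = vk k.
Hypothesis s_rat : forall k (q : rat), vk k q%:A = ratr `|q|.
Hypothesis s_degree : forall k0, local_degree (vk k0) = #|[pred k | vk k == vk k0]|.

Let i : {rmorphism rat -> R[i]} := real_complex R \o ratr.
Let d_gt0 : (0 < d)%N. Proof. exact: (adim_gt0 {:K}%AS). Qed.
Let D : R := ratr `|discriminant K|.

(** The norm of x is an integer of absolute value less than 1, while a nonzero x has nonzero
    norm. *)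
Lemma algint_small_eq0 (x : K) : algebraic_integer x -> (forall k, normc (s k x) < 1) -> x = 0.
Proof.
move=> xi x1; apply/eqP; apply/negPn/negP => x0; pose q := \det (mulmat x).
have q0 : q != 0.
  by rewrite -(fmorph_eq0 i) (norm_sigma i s_unit); apply/prodf_neq0 => k _; rewrite fmorph_eq0.
have [z zE] : exists z : int, q = z%:~R.
  apply: padic_le1_int => p pp; have [le lu] := padic_embeddings R K pp.
  rewrite -(le_ratE1 le) (norm_sigma (le_rat le) (le_unit le)) (av_prod (le_absP le)).
  by apply: prodr_ile1 => k _; rewrite (av_ge0 (le_absP le)) (algint_le1 lu).
have qE : \prod_k normc (s k x) = ratr `|q|.
  rewrite -(av_prod (normc_absval R)) -(norm_sigma i s_unit) -/q.
  by rewrite -[i q]/(real_complex R (ratr q)) normc_real ratr_norm.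
have : \prod_k normc (s k x) < 1.
  rewrite (bigD1 (Ordinal d_gt0)) //=; apply: le_lt_trans (x1 (Ordinal d_gt0)).
  rewrite -[leRHS]mulr1; apply: ler_wpM2l; first exact: (av_ge0 (normc_absval R)).
  by apply: prodr_ile1 => k _; rewrite (av_ge0 (normc_absval R)) ltW.
rewrite qE zE -intr_norm ratr_int ltrz1; move: q0; rewrite zE intr_eq0 -normr_gt0.
by case: (`|z|) => [[|n]|].
Qed.

Definition integral_bounded N (B : R) (x : 'rV[K]_N) :=
  (forall t, algebraic_integer (x 0 t)) /\ forall k t, normc (s k (x 0 t)) <= B.

(** The last two clauses bracket the squared covolume of the lattice: the lower bound limits the
    points of the V_i, the upper bound provides points of W. *)
Lemma subspace_lattice N (V : {vspace 'rV[K]_N}) : exists C : 'M[K]_(\dim V, \dim V * d),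
  let X := basis_matrix V in let tau := \det (trace_gram C) in
  [/\ forall t l, algebraic_integer ((X *m C) t l),
   forall x, x \in V -> (forall t, algebraic_integer (x 0 t)) ->
     exists z : 'rV[int]_(\dim V * d), x^T = X *m C *m map_mx intr z^T,
   tau != 0,
   subspace_height R V ^+ (2 * d) <= ratr `|tau| * arch_norm2 s (grassmann X) &
   ratr `|tau| * arch_norm2 s (grassmann X) <= D ^+ \dim V * subspace_height R V ^+ (2 * d)].
Proof.
have [c [cu ci cI cD]] := integral_data; set X := basis_matrix V.
have rX : \rank X = \dim V by exact: rank_basis_matrix.
have er : (\sum_(k < d) \dim V)%N = (\dim V * d)%N by rewrite sum_nat_const card_ord mulnC.
have [C [XC Cgen]] := integral_lattice_basis cu rX cI.
have [t0 up] := trace_gram_le_height2 s_places s_rat s_degree er rX cu ci Cgen.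
exists C; split=> //.
- move=> x /mem_basis_matrix[y xE] xi; have [|z yE] := Cgen y.
    by move=> t; rewrite -xE mxE.
  by exists z^T; rewrite xE yE mulmxA trmxK.
- rewrite /subspace_height; exact: (height2_le_trace_gram s_places s_rat s_degree er rX XC t0).
by rewrite /D cD.
Qed.

Lemma subspace_height_ge1 N (V : {vspace 'rV[K]_N}) : 1 <= subspace_height R V.
Proof.
exact: (height2_ge1 s_unit s_places s_rat s_degree (grassmann_neq0 (rank_basis_matrix V))).
Qed.

Lemma map_lattice_point N r (Y : 'M[K]_(N, r)) k (z : 'rV[int]_r) :
  map_mx (s k) Y *m (map_mx (real_complex R) (map_mx intr z))^T =
  map_mx (s k) (Y *m map_mx intr z^T).
Proof.
rewrite map_mxM; congr (_ *m _); apply/matrixP => a b; rewrite !mxE.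
by rewrite !rmorph_int.
Qed.

(* Minkowski's bound in the form given by pigeonholing the coordinates z L, where
   L L^T is the Gram matrix of a Z-basis of the integral points. *)
Lemma many_points N (W : {vspace 'rV[K]_N}) (B : R) : 0 < B -> (0 < \dim W)%N ->
  exists S : seq 'rV[K]_N, [/\ uniq S, forall x, x \in S -> x \in W /\ integral_bounded B x &
    B ^+ (\dim W * d) <= 2 ^+ (\dim W * d) * Num.sqrt (\dim W * d)%:R ^+ (\dim W * d) *
      Num.sqrt (D ^+ \dim W) * subspace_height R W ^+ d * (size S)%:R].
Proof.
move=> B0 w0; have [C [XC _ t0 _ up]] := subspace_lattice W.
set X := basis_matrix W in XC up; set r := (\dim W * d)%N in C XC t0 up *.
have er : (\sum_(k < d) \dim W)%N = r by rewrite sum_nat_const card_ord mulnC.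
have [G [GT Gpos Gdet Gform]] := real_gram s_unit er (rank_basis_matrix W) t0.
have [L GL _] := cholesky GT Gpos; have [dG _] := hadamard GT Gpos.
have dL : \det G = \det L ^+ 2 by rewrite GL det_mulmx det_tr.
have Lu : L \in unitmx by rewrite unitmxE unitfE; move: dG; rewrite dL; apply: contraTneq => ->; rewrite expr0n ltxx.
have r0 : (0 < r)%N by rewrite muln_gt0 w0.
have sr0 : 0 < Num.sqrt (r%:R : R) by rewrite sqrtr_gt0 ltr0n.
(* The cube with coordinates at most B / sqrt r lies in the ball of radius B, where the sum of all
   |sigma k x_t|^2 is at most B^2. *)
have t_gt0 : 0 < B / Num.sqrt r%:R by rewrite divr_gt0.
have [S [Su SL Ssize]] := lower_count Lu t_gt0.
pose pt (z : 'rV[int]_r) : 'rV[K]_N := (X *m C *m map_mx intr z^T)^T.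
have pt_inj : injective pt.
  move=> z z' /trmx_inj zz; apply/eqP; rewrite -subr_eq0; apply/negPn/negP => n0.
  have u0 : map_mx intr (z - z') != 0 :> 'rV[R]_r.
    apply: contra n0 => /eqP/rowP h; apply/eqP/rowP => j; have := h j; rewrite !mxE => /eqP.
    by rewrite intr_eq0 => /eqP.
  have := Gpos _ u0; rewrite Gform big1 ?ltxx // => k _; rewrite big1 // => t _.
  rewrite map_lattice_point linearB map_mxB mulmxBr zz subrr mxE mxE rmorph0.
  by rewrite (av0 (normc_absval R)) expr0n.
exists (map pt S); split; first by rewrite map_inj_uniq.
  move=> _ /mapP[z zS ->]; split.
    by apply/mem_basis_matrix; exists (C *m map_mx intr z^T); rewrite trmxK mulmxA.
  split=> [t|k t].
    rewrite mxE mxE; apply: algint_sum => l _; apply: algintM => //.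
    by rewrite !mxE; exact: algint_int.
  have h : \sum_k \sum_t normc (s k (pt z 0 t)) ^+ 2 <= B ^+ 2.
    have -> : \sum_k \sum_t normc (s k (pt z 0 t)) ^+ 2 = (map_mx intr z *m G *m (map_mx intr z)^T) 0 0.
      rewrite Gform; apply: eq_bigr => k' _; apply: eq_bigr => t' _.
      by rewrite map_lattice_point !mxE.
    rewrite GL mulmxA -mulmxA -trmx_mul mxE.
    apply: (le_trans (y := \sum_(j < r) (B / Num.sqrt r%:R) ^+ 2)).
      apply: ler_sum => j _; rewrite [X in _ * X]mxE -expr2 -real_normK ?num_real //.
      by apply: lerXn2r; rewrite ?nnegrE ?(ltW t_gt0) // SL.
    rewrite sumr_const card_ord -[leLHS]mulr_natr exprMn exprVn sqr_sqrtr ?ler0n //.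
    by rewrite divfK // pnatr_eq0 -lt0n.
  rewrite -ler_sqr ?nnegrE ?(av_ge0 (normc_absval R)) ?(ltW B0) //.
  apply: le_trans h; rewrite (bigD1 k) //= (bigD1 t) //= -addrA lerDl.
  by rewrite addr_ge0 ?sumr_ge0 // => *; rewrite ?sumr_ge0 // => *; exact: sqr_ge0.
have -> : B ^+ r = 2 ^+ r * Num.sqrt r%:R ^+ r * (B / Num.sqrt r%:R / 2) ^+ r.
  by rewrite -!exprMn; congr (_ ^+ _); field; rewrite gt_eqF.
rewrite -[leRHS]mulrA -[leRHS]mulrA; apply: ler_wpM2l.
  by rewrite mulr_ge0 ?exprn_ge0 // ltW.
apply: (le_trans Ssize); rewrite size_map mulrA; apply: ler_wpM2r; first exact: ler0n.
have H0 : 0 <= subspace_height R W by apply: le_trans (subspace_height_ge1 W).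
rewrite -ler_sqr ?nnegrE ?mulr_ge0 ?sqrtr_ge0 ?exprn_ge0 // real_normK ?num_real // -dL Gdet.
rewrite exprMn sqr_sqrtr ?exprn_ge0 ?ler0q ?normr_ge0 // -exprM [(d * 2)%N]mulnC.
exact: up.
Qed.

(* Either the points span and their Gram determinant, bounded by Hadamard, is at
   least the height of V, or they have smaller rank and are counted modulo an integer
   exceeding 2 B: a congruent pair would differ by a multiple of an integral point
   all of whose conjugates are less than 1. *)
Lemma few_points N (V : {vspace 'rV[K]_N}) (B : R) m (S : seq 'rV[K]_N) : 0 < B ->
  (0 < m)%N -> (\dim V <= m)%N -> uniq S ->
  (forall x, x \in S -> x \in V /\ integral_bounded B x) ->
  (size S)%:R <= 3 ^+ (m * d) * Num.sqrt (N * d)%:R ^+ (m * d) * B ^+ (m * d) *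
    (1 / subspace_height R V ^+ d) + (2 * B + 1) ^+ (m * d).-1.
Proof.
move=> B0 m0 Vm Su SV; have [C [XC Cgen t0 low _]] := subspace_lattice V.
set X := basis_matrix V in XC Cgen low; set r := (\dim V * d)%N in C XC Cgen t0 low *.
have er : (\sum_(k < d) \dim V)%N = r by rewrite sum_nat_const card_ord mulnC.
have H1 := subspace_height_ge1 V; have H0 : 0 < subspace_height R V := lt_le_trans ltr01 H1.
have B21 : 0 <= 2 * B + 1 by rewrite addr_ge0 ?mulr_ge0 // ltW.
pose pt (z : 'rV[int]_r) : 'rV[K]_N := (X *m C *m map_mx intr z^T)^T.
have zex x : exists z, x \in S -> x = pt z.
  have [xS|xS] := boolP (x \in S); last by exists 0.
  have [xV [xi _]] := SV x xS; have [z xE] := Cgen x xV xi.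
  by exists z; rewrite /pt -xE trmxK.
have [zf zfE] := choice zex.
have zu : uniq (map zf S).
  by rewrite map_inj_in_uniq // => x y xS yS; rewrite {2}(zfE x xS) {2}(zfE y yS) => ->.
have mem z : z \in map zf S -> integral_bounded B (pt z).
  by case/mapP=> x xS ->; rewrite -zfE //; have [] := SV x xS.
have ptin z : z \in map zf S -> zf (pt z) = z by case/mapP=> x xS ->; rewrite -zfE.
(* 2 B < M <= 2 B + 1: conjugates of a difference are at most 2 B, and M is replaced by 2 B + 1 in
   the final count. *)
pose M := (Num.truncn (2 * B)).+1.
have MB : 2 * B < M%:R by exact: truncnS_gt.
have BM : M%:R <= 2 * B + 1 by rewrite /M -natr1 lerD2r truncn_le mulr_ge0 // ltW.
have Bf0 : 0 <= 3 ^+ (m * d) * Num.sqrt (N * d)%:R ^+ (m * d) * B ^+ (m * d) *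
    (1 / subspace_height R V ^+ d).
  apply: mulr_ge0; last by apply: divr_ge0 => //; apply: exprn_ge0; exact: ltW.
  apply: mulr_ge0; last by apply: exprn_ge0; exact: ltW.
  by apply: mulr_ge0; apply: exprn_ge0 => //; exact: sqrtr_ge0.
have cong x y z : x \in map zf S -> y \in map zf S -> x - y = M%:Z *: z -> x = y.
  move=> xS yS xyz; rewrite -(ptin x xS) -(ptin y yS); congr zf.
  have pE : pt x - pt y = M%:R *: pt z.
    rewrite /pt -linearB -mulmxBr -map_mxB -linearB xyz linearZ map_mxZ -scalemxAr linearZ.
    by rewrite /= -pmulrn.
  have M0 : 0 < (M%:R : R) by rewrite ltr0n.
  suff p0 : pt z = 0 by apply/eqP; rewrite -subr_eq0 pE p0 scaler0.
  apply/rowP => t; rewrite [RHS]mxE; apply: algint_small_eq0 => [|k].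
    rewrite mxE mxE; apply: algint_sum => l _; apply: algintM => //.
    by rewrite !mxE; exact: algint_int.
  have [_ hx] := mem x xS; have [_ hy] := mem y yS.
  have := congr1 (fun u : 'rV[K]_N => normc (s k (u 0 t))) pE.
  rewrite /= [in X in X = _]mxE [(- pt y) 0 t]mxE [in X in _ = X]mxE rmorphM rmorph_nat.
  rewrite (avM (normc_absval R)) rmorphB.
  have -> : normc (M%:R : R[i]) = M%:R.
    by rewrite -(rmorph_nat (real_complex R)) normc_real normr_nat.
  move=> hM; rewrite -(ltr_pM2l M0) -hM mulr1; apply: le_lt_trans MB.
  apply: (le_trans (av_leB (normc_absval R) _ _)).
  by rewrite mulr_natl mulr2n; apply: lerD.
have degenerate (A : 'M[rat]_r) : (\rank A <= (m * d).-1)%N ->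
    (forall x, x \in map zf S -> (map_mx intr x <= A)%MS) ->
    (size S)%:R <= (2 * B + 1) ^+ (m * d).-1.
  move=> rA SA; have := count_mod zu rA (ltn0Sn _ : (0 < M)%N) SA cong.
  rewrite size_map -(ler_nat R) natrX => h; apply: (le_trans h).
  by apply: lerXn2r; rewrite ?nnegrE ?ler0n.
(* If dim V < m, the whole lattice has rank at most m d - 1, and the degenerate count applies with
   the identity matrix. *)
move: Vm; rewrite leq_eqVlt => /orP[/eqP Vm|Vm]; last first.
  apply: (le_trans (degenerate 1%:M _ _)); last by rewrite lerDr.
    rewrite mxrank1 /r -ltnS prednK ?muln_gt0 ?m0 // -[X in (X < _)%N]mulnC.
    by rewrite mulnC ltn_pmul2r.
  by move=> x _; exact: submx1.
have [[Vz [VS Vdet Vsize]]|[A [rA SA]]] := count_span zu; last first.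
  apply: (le_trans (degenerate A _ SA)); last by rewrite lerDr.
  by rewrite -ltnS prednK ?muln_gt0 ?m0 // -Vm.
apply: ler_wpDr; first exact: exprn_ge0.
rewrite size_map in Vsize.
(* The columns of X C' are r independent points of S, spanning a sublattice of index |det Vz|. *)
pose C' := C *m map_mx (in_alg K) (map_mx intr Vz^T).
have t'E : \det (trace_gram C') = (\det Vz)%:~R ^+ 2 * \det (trace_gram C).
  rewrite /C' (trace_gram_mulmx i s_unit) !det_mulmx det_tr !det_map_mx det_tr.
  by rewrite mulrAC expr2.
have t'0 : \det (trace_gram C') != 0 by rewrite t'E mulf_neq0 ?expf_neq0 ?intr_eq0.
have [G [GT Gpos Gdet Gform]] := real_gram s_unit er (rank_basis_matrix V) t'0.
have [_ had] := hadamard GT Gpos.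
(* A diagonal entry is the sum, over d embeddings and N coordinates, of the squared conjugates of
   one point; this is the source of (Nd)^(sd) in the constant. *)
have Gjj j : G j j <= (N * d)%:R * B ^+ 2.
  rewrite (diag_form G) Gform; apply: (le_trans (y := \sum_(k < d) \sum_(t < N) B ^+ 2)); last first.
    by rewrite !sumr_const !card_ord -mulrnA mulr_natl.
  apply: ler_sum => k _; apply: ler_sum => t _.
  have -> : (map_mx (s k) (X *m C') *m (map_mx (real_complex R) (delta_mx 0 j : 'rV[R]_r))^T) t 0 =
      s k (pt (row j Vz) 0 t).
    rewrite map_delta_mx trmx_delta -colE mxE mxE /pt; congr (s k _).
    rewrite [RHS]mxE /C' mulmxA [LHS]mxE [RHS]mxE; apply: eq_bigr => l _; rewrite !mxE; congr (_ * _).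
    exact: (rmorph_int (in_alg K)).
  apply: lerXn2r; rewrite ?nnegrE ?(av_ge0 (normc_absval R)) ?(ltW B0) //.
  by have [_] := mem _ (VS j).
have sz : (size S)%:R <= 3 ^+ r * `|(\det Vz)%:~R| :> R.
  rewrite -intr_norm -abszE -[X in _ * X]/((`|\det Vz|%N)%:R) -natrX -natrM ler_nat.
  exact: Vsize.
rewrite -Vm -/r mul1r ler_pdivlMr ?exprn_gt0 //.
apply: (le_trans (y := 3 ^+ r * (`|(\det Vz)%:~R| * subspace_height R V ^+ d))).
  by rewrite mulrA; apply: ler_wpM2r => //; rewrite exprn_ge0 // ltW.
rewrite -[leRHS]mulrA; apply: ler_wpM2l; first exact: exprn_ge0.
rewrite -exprMn -ler_sqr ?nnegrE ?mulr_ge0 ?exprn_ge0 ?sqrtr_ge0 ?(ltW B0) ?(ltW H0) //; last first.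
  by rewrite mulr_ge0 ?sqrtr_ge0 // ltW.
have a2 : `|(\det Vz)%:~R : R| ^+ 2 = (\det Vz)%:~R ^+ 2 by rewrite real_normK ?num_real.
have b2 : (Num.sqrt (N * d)%:R * B) ^+ 2 = (N * d)%:R * B ^+ 2 by rewrite exprMn sqr_sqrtr ?ler0n.
rewrite [leLHS]exprMn a2 -[_ ^+ d ^+ 2]exprM [(d * 2)%N]mulnC [leRHS]exprAC b2.
apply: (le_trans (y := \det G)).
  have tn : `|\det (trace_gram C')| = (\det Vz)%:~R ^+ 2 * `|\det (trace_gram C)|.
    by rewrite t'E normrM ger0_norm ?sqr_ge0.
  rewrite Gdet tn rmorphM rmorphXn /= ratr_int -[leRHS]mulrA.
  exact: ler_wpM2l (sqr_ge0 _) _ _ low.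
apply: (le_trans had); have -> : ((N * d)%:R * B ^+ 2) ^+ r = \prod_(j < r) ((N * d)%:R * B ^+ 2).
  by rewrite prodr_const card_ord.
apply: ler_prod => j _; rewrite Gjj andbT.
by rewrite (diag_form G) Gform; apply: sumr_ge0 => k _; apply: sumr_ge0 => t _; exact: sqr_ge0.
Qed.

End Embeddings.
End Counting.

(** * The constant *)

(** Factor by factor, n (k - j) <= k (n - j). This trades (Nd)^(sd) for a binomial coefficient. *)
Lemma expn_le_bin n k : (k <= n)%N -> (n ^ k <= k ^ k * 'C(n, k))%N.
Proof.
move=> kn; rewrite -(leq_pmul2r (fact_gt0 k)) -mulnA bin_ffact -[in leqLHS]ffactnn !ffact_prod.
have pn a : (a ^ k)%N = (\prod_(i < k) a)%N by rewrite prod_nat_const card_ord.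
rewrite !pn -!big_split /=; apply: leq_prod => j _.
by rewrite !mulnBr [(k * n)%N]mulnC; apply: leq_sub2l; rewrite leq_mul2r kn orbT.
Qed.

Lemma bin_mono n a b : (a <= b)%N -> (b.*2 <= n)%N -> ('C(n, a) <= 'C(n, b))%N.
Proof.
move=> ab; elim: b ab => [|b ih]; first by rewrite leqn0 => /eqP ->.
rewrite leq_eqVlt => /orP[/eqP -> //|ab] bn.
apply: (leq_trans (ih ab _)); first by rewrite (leq_trans _ bn) // leq_double.
rewrite -(leq_pmul2l (ltn0Sn b)) mul_bin_left leq_mul2r; apply/orP; right.
by move: bn; rewrite doubleS -addnn; lia.
Qed.

(** For s > l symmetry replaces s d by (N - s) d, where N - s <= l also for odd N; both indices then
    lie in the increasing half. *)
Lemma bin_le_middle N d s : (s <= N)%N -> ('C(N * d, s * d) <= 'C(N * d, N %/ 2 * d))%N.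
Proof.
move=> sN; have lN : ((N %/ 2 * d).*2 <= N * d)%N by rewrite -muln2 mulnAC leq_mul2r leq_trunc_div orbT.
have [sl|sl] := leqP s (N %/ 2)%N; first by apply: bin_mono; rewrite // leq_mul2r sl orbT.
rewrite -bin_sub ?leq_mul2r ?sN ?orbT // -mulnBl; apply: bin_mono => //.
by rewrite leq_mul2r; apply/orP; right; lia.
Qed.

Section Numeric.

Variable R : realType.
Implicit Types x y : R.

Lemma powRV_exprn x n : 0 <= x -> (0 < n)%N -> (x `^ (1 / n%:R)) ^+ n = x.
Proof. by move=> x0 n0; rewrite -[1 / _]/(1%:R / _) powR_exprn. Qed.

(** Here n = (w - s) d, m = s d and h = H(W)^d. The first summand of B gives 4 p h A S <= B^n, the
    second 4 p h 3^(m-1) M <= B^(n+1), and (2B+1)^(m-1) <= (3B)^(m-1) as B >= 1. Each error term is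
    thus at most a quarter of B^(n+m). Since h >= 1, h <= h^n. *)
Lemma counting_inequality (c h A p S : R) (M n m : nat) :
  1 <= c -> 1 <= h -> 0 <= p -> (3 ^+ m <= A) -> 0 <= S -> (0 < M)%N -> (0 < n)%N -> (0 < m)%N ->
  4 * p * A <= c ^+ n ->
  forall B, B = c * h * (S `^ (1 / n%:R) + M%:R `^ (1 / (n + 1)%:R)) ->
  p * h * (A * B ^+ m * S + M%:R * (2 * B + 1) ^+ m.-1) < B ^+ (n + m).
Proof.
move=> c1 h1 p0 A3 S0 M0 n0 m0 cA B.
set u := S `^ _; set v := M%:R `^ _ => BE.
have un : u ^+ n = S by rewrite powRV_exprn.
have vn : v ^+ n.+1 = M%:R by rewrite -addn1 powRV_exprn // addn1.
have u0 : 0 <= u by exact: powR_ge0.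
have v1 : 1 <= v.
  by rewrite -(powRr0 (M%:R : R)) /v; apply: ler_powR; rewrite ?ler1n // divr_ge0.
have c0 : 0 < c by lra.
have h0 : 0 < h by lra.
have ch1 : 1 <= c * h by rewrite -[1]mulr1 ler_pM.
have B1 : 1 <= B by rewrite BE -[1]mulr1 ler_pM //; lra.
have B0 : 0 < B by lra.
have ch0 : 0 < c * h by rewrite mulr_gt0.
have Bu : c * h * u <= B by rewrite BE ler_pM2l //; lra.
have Bv : c * h * v <= B by rewrite BE ler_pM2l //; lra.
have hle k : (0 < k)%N -> h <= h ^+ k by move=> k0; rewrite -{1}[h]expr1 ler_weXn2l.
have Bn : 4 * (p * h * A * S) <= B ^+ n.
  apply: (le_trans (y := (c * h * u) ^+ n)); last first.
    by apply: lerXn2r; rewrite ?nnegrE ?(ltW B0) ?(mulr_ge0 (ltW ch0)) //; lra.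
  rewrite !exprMn un.
  have -> : 4 * (p * h * A * S) = (4 * p * A) * h * S by ring.
  apply: ler_wpM2r => //; apply: ler_pM => //; last exact: hle.
    by rewrite !mulr_ge0 //; apply: le_trans A3; rewrite exprn_ge0.
  by lra.
have BM : 4 * (p * h * 3 ^+ m.-1 * M%:R) <= B ^+ n.+1.
  apply: (le_trans (y := (c * h * v) ^+ n.+1)); last first.
    by apply: lerXn2r; rewrite ?nnegrE ?(ltW B0) ?(mulr_ge0 (ltW ch0)) //; lra.
  rewrite !exprMn vn.
  have -> : 4 * (p * h * 3 ^+ m.-1 * M%:R) = (4 * p * 3 ^+ m.-1) * h * M%:R by ring.
  apply: ler_wpM2r; first exact: ler0n.
  apply: ler_pM; [| lra | | exact: hle].
    by rewrite !mulr_ge0 // exprn_ge0.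
  apply: (le_trans (y := c ^+ n)); last by rewrite exprS ler_peMl // exprn_ge0 // ltW.
  apply: le_trans cA; apply: ler_wpM2l; first by rewrite mulr_ge0.
  apply: le_trans A3; apply: ler_weXn2l; [lra|exact: leq_pred].
have -> : p * h * (A * B ^+ m * S + M%:R * (2 * B + 1) ^+ m.-1) =
   (p * h * A * S) * B ^+ m + (p * h * M%:R) * (2 * B + 1) ^+ m.-1 by ring.
have h3 : (2 * B + 1) ^+ m.-1 <= 3 ^+ m.-1 * B ^+ m.-1.
  by rewrite -exprMn; apply: lerXn2r; rewrite ?nnegrE; lra.
have e1 : (p * h * A * S) * B ^+ m <= 4^-1 * B ^+ (n + m).
  rewrite exprD mulrA; apply: ler_wpM2r; first by rewrite exprn_ge0 // ltW.
  lra.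
have e2 : (p * h * M%:R) * (2 * B + 1) ^+ m.-1 <= 4^-1 * B ^+ (n + m).
  apply: (le_trans (ler_wpM2l _ h3)); first by rewrite !mulr_ge0 // ltW.
  have -> : (n + m)%N = (n.+1 + m.-1)%N by rewrite -{1}(prednK m0) addnS addSn.
  rewrite exprD !mulrA; apply: ler_wpM2r; first by rewrite exprn_ge0 // ltW.
  have -> : p * h * M%:R * 3 ^+ m.-1 = p * h * 3 ^+ m.-1 * M%:R by ring.
  lra.
have B2 : 0 < B ^+ (n + m) by rewrite exprn_gt0.
lra.
Qed.

Lemma powR_half x n : 0 <= x -> x `^ (n%:R / 2) = Num.sqrt (x ^+ n).
Proof. by move=> x0; rewrite powRrM powR_mulrn // powR12_sqrt // exprn_ge0. Qed.

(** The power of 2 absorbs 4, 2^(wd) and 3^(sd) <= 4^(sd), since 2 + wd + 2sd <= 3wd. After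
    squaring, half of the factor (wd)^(2wd) in F^(2d) pays for the cube, the other half for the
    (sd)^(sd) of [expn_le_bin]. *)
Lemma constant_inequality (D : R) (N w s d : nat) : (s < w <= N)%N -> (0 < d)%N -> 1 <= D ->
  4 * (2 ^+ (w * d) * Num.sqrt (w * d)%:R ^+ (w * d) * Num.sqrt (D ^+ w)) *
    (3 ^+ (s * d) * Num.sqrt (N * d)%:R ^+ (s * d)) <=
  (2 ^+ (w * (d + 3)) * D `^ (w%:R / 2)
  * ((w * d)%:R ^+ w * 'C(N * d, N %/ 2 * d)%:R `^ (1 / (2 * d%:R)))
      `^ (1 / (w - s)%:R)) ^+ ((w - s) * d).
Proof.
move=> /andP[sw wN] d0 D1; set n := ((w - s) * d)%N.
have n0 : (0 < n)%N by rewrite muln_gt0 subn_gt0 sw.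
set F := (w * d)%:R ^+ w * _.
have F0 : 0 <= F by rewrite mulr_ge0 ?exprn_ge0 ?powR_ge0.
rewrite powR_half; last by lra.
rewrite !exprMn [(F `^ _) ^+ n]exprM powRV_exprn ?subn_gt0 //.
have D2 : 1 <= Num.sqrt (D ^+ w) by rewrite -sqrtr1 ler_wsqrtr // exprn_ege1.
have h1 : 4 * 2 ^+ (w * d) * 3 ^+ (s * d) <= (2 ^+ (w * (d + 3))) ^+ n :> R.
  apply: (le_trans (y := 2 ^+ (2 + w * d + 2 * (s * d)))).
    rewrite [2 ^+ (_ + _ + _)]exprD [2 ^+ (2 + _)]exprD; apply: ler_pM; rewrite ?mulr_ge0 ?exprn_ge0 //.
      by rewrite [2 ^+ 2](_ : _ = 4) //; ring.
    by rewrite [leRHS]exprM; apply: lerXn2r; rewrite ?nnegrE ?exprn_ge0 //; lra.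
  rewrite -exprM; apply: ler_weXn2l; first lra.
  have a : (s * d + d <= w * d)%N by rewrite -mulSnr leq_mul2r sw orbT.
  apply: (@leq_trans (3 * (w * d))%N); first by move: a d0; clear; lia.
  rewrite mulnA [(3 * w)%N]mulnC; apply: leq_mul; first by rewrite leq_mul2l leq_addl orbT.
  by rewrite leq_pmull ?subn_gt0.
have h2 : Num.sqrt (D ^+ w) <= Num.sqrt (D ^+ w) ^+ n.
  by rewrite -{1}[Num.sqrt _]expr1 ler_weXn2l.
have h3 : Num.sqrt (w * d)%:R ^+ (w * d) * Num.sqrt (N * d)%:R ^+ (s * d) <= F ^+ d.
  have l0 : 0 <= Num.sqrt (w * d)%:R ^+ (w * d) * Num.sqrt (N * d)%:R ^+ (s * d) :> R.
    by rewrite mulr_ge0 // exprn_ge0 // sqrtr_ge0.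
  rewrite -ler_sqr ?nnegrE ?exprn_ge0 // /F !exprMn.
  rewrite -[((_ `^ _) ^+ d) ^+ 2]exprM [(d * 2)%N]mulnC.
  rewrite -natrM powRV_exprn ?muln_gt0 //.
  rewrite ![(Num.sqrt _ ^+ _) ^+ 2]exprAC !sqr_sqrtr ?ler0n // -!natrX -!natrM ler_nat.
  rewrite -2!expnM muln2 -addnn mulnDr expnD -mulnA leq_mul2l; apply/orP; right.
  apply: (@leq_trans ((s * d) ^ (s * d) * 'C(N * d, s * d))%N).
    by apply: expn_le_bin; rewrite leq_mul2r (ltnW (leq_trans sw wN)) orbT.
  apply: leq_mul; last by apply: bin_le_middle; rewrite (ltnW (leq_trans sw wN)).
  apply: (@leq_trans ((w * d) ^ (s * d))%N).
    have [->|sd0] := posnP (s * d)%N; first by rewrite !expn0.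
    by rewrite leq_exp2r // leq_mul2r (ltnW sw) orbT.
  by apply: leq_pexp2l; rewrite ?muln_gt0 ?d0 ?(leq_ltn_trans _ sw) // leq_mul2r (ltnW sw) orbT.
rewrite [leLHS](_ : _ = (4 * 2 ^+ (w * d) * 3 ^+ (s * d)) * Num.sqrt (D ^+ w) *
   (Num.sqrt (w * d)%:R ^+ (w * d) * Num.sqrt (N * d)%:R ^+ (s * d))); last by ring.
apply: ler_pM h3; rewrite ?mulr_ge0 ?exprn_ge0 ?sqrtr_ge0 //.
by apply: ler_pM h1 h2; rewrite ?mulr_ge0 ?exprn_ge0 ?sqrtr_ge0.
Qed.

Lemma constant_ge1 (D : R) (N w s d : nat) : (s < w <= N)%N -> (0 < d)%N -> 1 <= D ->
  1 <= 2 ^+ (w * (d + 3)) * D `^ (w%:R / 2)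
  * ((w * d)%:R ^+ w * 'C(N * d, N %/ 2 * d)%:R `^ (1 / (2 * d%:R))) `^ (1 / (w - s)%:R).
Proof.
move=> /andP[sw wN] d0 D1.
have pow1 (x y : R) : 1 <= x -> 0 <= y -> 1 <= x `^ y.
  by move=> x1 y0; rewrite -(powRr0 x); apply: ler_powR.
have mul1 (x y : R) : 1 <= x -> 1 <= y -> 1 <= x * y by move=> x1 y1; rewrite -[1]mulr1 ler_pM.
apply: (mul1 _ _); first by apply: (mul1 _ _); [apply: exprn_ege1; lra|apply: (pow1 _ _); rewrite ?divr_ge0].
apply: (pow1 _ _); last by rewrite divr_ge0.
apply: (mul1 _ _); first by apply: exprn_ege1; rewrite ler1n muln_gt0 d0 (leq_ltn_trans _ sw).
apply: (pow1 _ _); last by rewrite divr_ge0 // mulr_ge0.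
by rewrite ler1n bin_gt0 leq_mul2r leq_div orbT.
Qed.

End Numeric.

(** * Comparison of the counts for W and for the V_i *)

Theorem theorem1p2 (R : realType) (K : fieldExtType rat) (d N w s M : nat)
    (W : {vspace 'rV[K]_N}) (V : 'I_M -> {vspace 'rV[K]_N})
    (hd : \dim {:K} = d) (hN : (2 <= N)%N)
    (hW : \dim W = w) (hw : (1 <= w <= N)%N) (hs : (1 <= s < w)%N)
    (hV0 : forall i, V i != 0%VS)
    (hVs : (\max_(i < M) \dim (V i) <= s)%N) :
  exists x : 'rV[K]_N,
    [/\ x \in W, forall i, x \notin V i &
        height R x <=
          siegel_const R K N w s * subspace_height R W ^+ d *
          ((\sum_(i < M) 1 / subspace_height R (V i) ^+ d)
              `^ (1 / ((w - s) * d)%:R)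
           + M%:R `^ (1 / ((w - s) * d + 1)%:R))].
Proof.
have [sigma [s_unit s_places s_rat s_degree]] := complex_embeddings R K.
have H1 := subspace_height_ge1 s_unit s_places s_rat s_degree.
set S := \sum_(i < M) _; set c := siegel_const R K N w s; set h := _ ^+ d.
set B := c * h * _.
have d0 : (0 < d)%N by rewrite -hd; exact: (adim_gt0 {:K}%AS).
have /andP[s0 sw] := hs; have /andP[w0 wN] := hw.
have D1 := discriminant_ge1 R K.
have c1 : 1 <= c by rewrite /c /siegel_const hd; apply: constant_ge1 => //; rewrite sw.
have h1 : 1 <= h by exact: exprn_ege1.
have S0 : 0 <= S.
  by apply: sumr_ge0 => i _; rewrite divr_ge0 // exprn_ge0 // (le_trans ler01 (H1 _ _)).
(* For M = 0 the right-hand side is 0, and the zero vector, whose [height] is 0, avoids the empty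
   family. *)
have [M0|M0] := posnP M.
  exists 0; split; first exact: mem0v.
    by move=> i; have := ltn_ord i; rewrite [X in (_ < X)%N]M0.
  rewrite /height eqxx; apply: mulr_ge0; last by rewrite addr_ge0 ?powR_ge0.
  by apply: mulr_ge0; rewrite (le_trans ler01).
have B0 : 0 < B.
  apply: mulr_gt0; first by apply: mulr_gt0; rewrite (lt_le_trans ltr01).
  by apply: ltr_wpDl; rewrite ?powR_ge0 // powR_gt0 // ltr0n.
have W0 : (0 < \dim W)%N by rewrite hW.
have [P [Pu PW Psize]] := many_points s_unit s_places s_rat s_degree B0 W0.
(* A point of P outside every V i would satisfy the claim by [height_le], so it may be assumed that
   the V i cover P. *)
apply: contrapT => none.
have cover x : x \in P -> exists i, x \in V i.
  move=> xP; apply: contrapT => /forallNP xV; apply: none; exists x.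
  have [xW [xi xB]] := PW x xP; split=> // [i|]; first by apply/negP/xV.
  exact: (height_le s_places s_rat s_degree (ltW B0)).
set m := (s * d)%N; set A : R := 3 ^+ m * Num.sqrt (N * d)%:R ^+ m.
have Pcount : (size P)%:R <= A * B ^+ m * S + M%:R * (2 * B + 1) ^+ m.-1.
  have : (size P <= \sum_(i < M) size [seq x <- P | x \in V i])%N.
    under eq_bigr do rewrite size_filter.
    move: cover; clear.
    elim: P => [|x P ih] cover; first by [].
    have [i xi] := cover x (mem_head _ _).
    under eq_bigr do rewrite /=.
    rewrite big_split /= -add1n leq_add //; first by rewrite (bigD1 i) //= xi.
    by apply: ih => y yP; apply: cover; rewrite in_cons yP orbT.
  rewrite -(ler_nat R) natr_sum => h2; apply: (le_trans h2).
  rewrite /S mulr_sumr mulr_natl -[M in X in _ <= _ + X]card_ord -sumr_const -big_split /=.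
  apply: ler_sum => i _.
  have := few_points s_unit s_places s_rat s_degree (V := V i) B0 s0 _ (filter_uniq _ Pu).
  rewrite hd; apply.
    by apply: leq_trans hVs; exact: (leq_bigmax (F := fun i => \dim (V i))).
  by move=> x; rewrite mem_filter => /andP[xV /PW[]].
pose D : R := ratr `|discriminant K|.
pose p := 2 ^+ (w * d) * Num.sqrt (w * d)%:R ^+ (w * d) * Num.sqrt (D ^+ w).
have A3 : 3 ^+ m <= A.
  rewrite /A ler_peMr ?exprn_ge0 // exprn_ege1 // -[leLHS]sqrtr1 ler_wsqrtr // ler1n muln_gt0 d0 andbT.
  exact: ltn_trans hN.
have key : 4 * p * A <= c ^+ ((w - s) * d).
  rewrite /c /siegel_const hd; apply: constant_inequality => //.
  by rewrite sw.
have n0 : (0 < (w - s) * d)%N by rewrite muln_gt0 subn_gt0 sw.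
have m0 : (0 < m)%N by rewrite muln_gt0 s0.
have p0 : 0 <= p by rewrite !mulr_ge0 ?exprn_ge0 ?sqrtr_ge0.
have := counting_inequality c1 h1 p0 A3 S0 M0 n0 m0 key (erefl B).
rewrite ltNge => /negP; apply.
move: Psize; rewrite hd hW -/p -/h -/D => Psize.
(* (w - s) d + s d = w d, so the count of P in W and that of P in the V i bear on the same power of
   B. *)
rewrite /m -mulnDl subnK ?(ltnW sw) //; apply: (le_trans Psize).
by apply: ler_wpM2l Pcount; rewrite mulr_ge0 // (le_trans ler01 h1).
Qed.
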